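(* Let $X\subset\mathbb{P}^3$ be the cubic surface $x_1x_2x_3=x_4(x_1+x_2+x_3)^2$, and let $U\subset X$ be the open subset obtained by deleting from $X$ the six lines $x_i=x_4=0$ and $x_i=x_j+x_k=0$, for $\{i,j,k\}=\{1,2,3\}$. For a rational point $x\in\mathbb{P}^3(\mathbb{Q})$ written as $x=[x_1,x_2,x_3,x_4]$ with $x_1,\dots,x_4$ coprime integers, put $H(x)=\max_{1\le i\le 4}|x_i|$, and for $B\ge 1$ let $$N_{U,H}(B)=\#\{x\in U\cap\mathbb{P}^3(\mathbb{Q}) : H(x)\le B\}.$$ Then there are absolute constants $c_1,c_2>0$ such that for all $B\ge 2$, $$c_1\,B(\log B)^6\le N_{U,H}(B)\le c_2\,B(\log B)^6.$$ *)

(* Defs.v *)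
From HB Require Import structures.
From mathcomp Require Import all_boot all_order all_algebra.
From mathcomp Require Import finmap.
From mathcomp Require Import all_classical all_reals.

Set Implicit Arguments.
Unset Strict Implicit.
Unset Printing Implicit Defensive.

Import Order.TTheory GRing.Theory Num.Theory.

Local Open Scope classical_set_scope.
Local Open Scope ring_scope.

(* P^3(K), as the set of lines through the origin of K^4. *)
Definition P3 (K : fieldType) : Type :=
  {L : {vspace 'rV[K]_4} | \dim L == 1%N}.
HB.instance Definition _ (K : fieldType) := SubChoice.on (P3 K).

Definition line_of (K : fieldType) (p : P3 K) : {vspace 'rV[K]_4} := val p.

Section Surface.
Variable K : fieldType.
Implicit Types v : 'rV[K]_4.

(* Columns are numbered from 0, the coordinates x_1, ..., x_4 from 1. *)
Definition x1 v : K := v 0 (inord 0).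
Definition x2 v : K := v 0 (inord 1).
Definition x3 v : K := v 0 (inord 2).
Definition x4 v : K := v 0 (inord 3).

(* To be used with homogeneous f only. *)
Definition zeros (f : 'rV[K]_4 -> K) : set (P3 K) :=
  [set p | forall v, v \in line_of p -> f v = 0].

Definition surfX : set (P3 K) :=
  zeros (fun v => x1 v * x2 v * x3 v - x4 v * (x1 v + x2 v + x3 v) ^+ 2).

Definition six_lines : set (P3 K) :=
  (zeros x1 `&` zeros x4) `|` (zeros x2 `&` zeros x4) `|`
  (zeros x3 `&` zeros x4) `|`
  (zeros x1 `&` zeros (fun v => x2 v + x3 v)) `|`
  (zeros x2 `&` zeros (fun v => x3 v + x1 v)) `|`
  (zeros x3 `&` zeros (fun v => x1 v + x2 v)).

Definition openU : set (P3 K) := surfX `\` six_lines.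

End Surface.

Definition coprime_coords (p : P3 rat) : set 'rV[int]_4 :=
  [set x : 'rV[int]_4 | \big[gcdn/0%N]_(i < 4) absz (x 0 i) = 1%N
           /\ line_of p = <[map_mx intr x]>%VS].

(* Every rational point has coprime integral coordinates, and these are unique
   up to sign, so that the choice made in [height] below is immaterial. *)
Lemma coprime_coords_exist (p : P3 rat) : coprime_coords p !=set0.
Proof.
case: p => L dimL; rewrite /coprime_coords; set v := vpick L.
have v_neq0 : v != 0.
  by apply: contraTneq dimL => /eqP; rewrite vpick0 => /eqP ->; rewrite dimv0.
have defL : L = <[v]>%VS.
  apply/eqP; rewrite eq_sym eqEdim dim_vline v_neq0 (eqP dimL) leqnn andbT.
  exact: memv_pick.
pose d : int := \prod_(i < 4) denq (v 0 i).
have d_neq0 : d != 0 by apply/prodf_neq0 => i _; exact: denq_neq0.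
pose a : 'rV[int]_4 :=
  \row_i (numq (v 0 i) * \prod_(j < 4 | j != i) denq (v 0 j)).
have aE : map_mx intr a = d%:~R *: v.
  apply/rowP => i; rewrite !mxE.
  have -> : d = denq (v 0 i) * \prod_(j < 4 | j != i) denq (v 0 j).
    by rewrite /d (bigD1 i).
  by rewrite !intrM numqE -mulrA mulrC.
pose g := \big[gcdn/0%N]_(i < 4) absz (a 0 i).
have g_dvd i : (g%:Z %| (a 0 i)%R)%Z by rewrite dvdzE; exact: (biggcdn_inf i).
have g_neq0 : g != 0%N.
  apply: contraNneq v_neq0 => g0.
  suff a0 : map_mx (intr : int -> rat) a = 0.
    have /eqP := aE; rewrite a0 eq_sym scaler_eq0 intr_eq0.
    by rewrite (negPf d_neq0).
  apply/rowP => i; rewrite !mxE; have := g_dvd i.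
  by rewrite g0 dvd0z mxE => /eqP ->.
pose x : 'rV[int]_4 := \row_i ((a 0 i)%R %/ g%:Z)%Z.
have xE i : a 0 i = x 0 i * g%:Z by rewrite [x 0 i]mxE divzK.
exists x; split.
  apply/eqP; rewrite -(@eqn_pmul2r g) ?lt0n // mul1n.
  rewrite /g (big_morph (muln^~ _) (fun m n => muln_gcdl m n _) (mul0n _)).
  by apply/eqP; apply: eq_bigr => i _; rewrite -/g xE abszM.
have xv : map_mx intr x = (d%:~R / g%:~R) *: v.
  have gQ : (g%:~R : rat) != 0 by rewrite intr_eq0.
  apply: (scalerI gQ); rewrite scalerA mulrC divfK // -aE.
  by apply/rowP => i; rewrite 2!mxE [RHS]mxE xE intrM mulrC.
have k_neq0 : (d%:~R / g%:~R : rat) != 0.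
  by rewrite mulf_neq0 ?invr_eq0 ?intr_eq0.
rewrite [LHS]defL xv; apply/eqP; rewrite eq_sym eqEdim !dim_vline.
rewrite scaler_eq0 negb_or k_neq0 v_neq0 /= andbT.
by rewrite -memvE memvZ // memv_line.
Qed.

Lemma coprime_coords_uniq (p : P3 rat) (x y : 'rV[int]_4) :
  coprime_coords p x -> coprime_coords p y -> x = y \/ x = - y.
Proof.
move=> [gx px] [gy py].
have : map_mx intr x \in <[map_mx intr y : 'rV[rat]_4]>%VS.
  by rewrite -py px memv_line.
case/vlineP => k xy.
have E i : x 0 i * denq k = numq k * y 0 i.
  apply/eqP; rewrite -(eqr_int rat) !intrM; apply/eqP.
  have /rowP/(_ i) := xy; rewrite !mxE => ->.
  by rewrite numqE mulrAC.
have nd : `|denq k|%N = `|numq k|%N.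
  have gE (m n : nat) : 1%N = m -> 1%N = n ->
      (m * absz (denq k) = absz (numq k) * n)%N ->
      absz (denq k) = absz (numq k).
    by move=> <- <-; rewrite mul1n muln1.
  apply: (gE _ _ (esym gx) (esym gy)).
  rewrite (big_morph (muln^~ _) (fun m n => muln_gcdl m n _) (mul0n _)).
  rewrite (big_morph (muln _) (fun m n => muln_gcdr _ m n) (muln0 _)).
  by apply: eq_bigr => i _; rewrite -!abszM E.
have d_neq0 := denq_neq0 k.
have /orP[] : (numq k == denq k) || (numq k == - denq k).
- by rewrite -eqr_norm2 -!abszE nd.
- move=> /eqP nk; left; apply/rowP => i.
  by apply: (mulIf d_neq0); rewrite E nk mulrC.
- move=> /eqP nk; right; apply/rowP => i.
  by apply: (mulIf d_neq0); rewrite E nk mxE mulNr mulrC mulNr.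
Qed.

Definition height (p : P3 rat) : nat :=
  let x := xget 0 (coprime_coords p) in \max_(i < 4) absz (x 0 i)%R.

Lemma heightE (p : P3 rat) (x : 'rV[int]_4) :
  coprime_coords p x -> height p = \max_(i < 4) absz (x 0 i)%R.
Proof.
move=> px; apply: eq_bigr => i _.
by case: (coprime_coords_uniq (xgetPex 0 (ex_intro _ x px)) px) => ->;
  rewrite ?mxE ?abszN.
Qed.

(* [fset_set A] is empty when [A] is infinite, so a positive lower bound on
   [NUH B] includes the finiteness of the set of points being counted. *)
Definition NUH (R : realType) (B : R) : nat :=
  #|` fset_set [set p : P3 rat | openU p /\ (height p)%:R <= B]|.

(* Main.v *)
(** A point of [U] is given by a primitive integer vector [(a1, a2, a3)] with
nonzero entries and [s = a1 + a2 + a3 > 0], through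
[x = (a1 s^2, a2 s^2, a3 s^2, a1 a2 a3) / gcd (s^2, a1 a2 a3)]. The gcds
[h_i = gcd (a_i, s)] are pairwise coprime; writing [gcd (a_i, s^2) = u_i y_i^2]
with [u_i y_i = h_i], [a_i = u_i y_i^2 t_i] and [s = h_1 h_2 h_3 s'], the surface
turns into the torsor equation
[u1 y1^2 t1 + u2 y2^2 t2 + u3 y3^2 t3 = u1 u2 u3 y1 y2 y3 s'].

Upper bound: localise the [y_i] and the [a_i] dyadically. For fixed [u, y, s'] the
differences of solutions [t] lie in a plane lattice, so their number is at most
the expected volume unless the lattice has a very short vector; those [y] for which
this happens are points on conics, counted by sorting them into classes modulo the
coefficients, within which the ratios of coordinates are well spaced. Summing the
volumes gives [B] times one logarithm for each of six variables.

Lower bound: let [K] be a factorial and [Q] a small power of [B]. For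
[u_i, y_i <= Q] coprime to [K], with [s' = 1 mod K] and the [t_i] in boxes of size
a constant times the natural one, all prime divisors that can violate the
coprimality conditions exceed a constant [P0], so that the violations, bounded by
sums of [1 / m^2] over [m > P0], cost only a small proportion. What remains is
[B] times the sixth power of the sum of [1 / k] over [k <= Q] coprime to [K]. *)

Require Import Defs.
From mathcomp Require Import all_boot all_order all_algebra.
From mathcomp Require Import finmap.
From mathcomp Require Import all_classical all_reals sequences exp.
From mathcomp Require Import zify ring lra.

Set Implicit Arguments.
Unset Strict Implicit.
Unset Printing Implicit Defensive.

Import Order.TTheory GRing.Theory Num.Theory.

Local Open Scope ring_scope.

(** The exponent 6 leaves no room for error terms, so the loss from lattices with a very short
    vector must itself be of order [B (log B)^6]. Write [U = u1 u2 u3]. The conic count carries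
    three harmonic sums, from averaged divisor functions. Its geometric part is controlled by a
    choice: any of the three coordinates can supply the modulus, the three resulting terms multiply
    to [U A / C], and so one of them is at most [sqrt (U A / C)]. Here the two larger [a_i] are
    bounded by [A] and the smallest by its own, often much smaller, [C]. After the dyadic summation
    the loss for given [u], [s] is of order [1 / (U^(3/2) s^3)], whose sum converges even against
    divisor counts; its logarithms are three dyadic ranges and the three harmonic sums. In the
    volume term the six logarithms are two dyadic ranges and the harmonic sums over [u1], [u2],
    [u3], [s].

    For the lower bound a union bound suffices, since only primes above [P0] can do damage. This is
    done twice: once for the sextuples [(u, y)], weighted by their inverse product, and once inside
    the box of [(s, a, b)] that belongs to a sextuple. Each time at least half survives. *)

(** * Cardinality bounds by lists *)

(** Quantifying over duplicate-free lists asserts finiteness and a real bound at once, for a [Prop]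
    that need not be decidable. *)
Definition card_le (R : realType) (T : eqType) (P : T -> Prop) (r : R) : Prop :=
  forall s : seq T, uniq s -> (forall x, x \in s -> P x) -> (size s)%:R <= r.

Lemma card_le_ge0 (R : realType) (T : eqType) (P : T -> Prop) (r : R) :
  card_le P r -> 0 <= r.
Proof. by move=> /(_ [::] isT); apply. Qed.

Lemma card_le_sub (R : realType) (T : eqType) (P Q : T -> Prop) (r r' : R) :
  (forall x, P x -> Q x) -> card_le Q r -> r <= r' -> card_le P r'.
Proof.
move=> PQ Qr rr' s us sP; apply: le_trans rr'; apply: Qr => // x /sP; exact: PQ.
Qed.

Lemma card_le_void (R : realType) (T : eqType) (P : T -> Prop) (r : R) :
  0 <= r -> (forall x, ~ P x) -> card_le P r.
Proof.
move=> r0 nP [|x s] // us sP; case: (nP x); apply: sP; exact: mem_head.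
Qed.

Lemma card_le_mono (R : realType) (T : eqType) (P : T -> Prop) (r r' : R) :
  card_le P r -> r <= r' -> card_le P r'.
Proof. exact: card_le_sub. Qed.

Lemma card_le_inj (R : realType) (T T' : eqType) (f : T -> T')
    (P : T -> Prop) (Q : T' -> Prop) (r : R) :
  (forall x y, P x -> P y -> f x = f y -> x = y) ->
  (forall x, P x -> Q (f x)) -> card_le Q r -> card_le P r.
Proof.
move=> finj fPQ Qr s us sP; rewrite -(size_map f s); apply: Qr.
  rewrite map_inj_in_uniq // => x y xs ys; apply: finj; exact: sP.
by move=> _ /mapP[x xs ->]; apply: fPQ; exact: sP.
Qed.

(** Repetitions in [l] and values that are never attained only enlarge the sum, since a fibre bound
    is nonnegative. *)
Lemma card_le_fib (R : realType) (T I : eqType) (f : T -> I) (l : seq I)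
    (F : I -> R) (P : T -> Prop) :
  (forall x, P x -> f x \in l) ->
  (forall i, i \in l -> card_le (fun x => P x /\ f x = i) (F i)) ->
  card_le P (\sum_(i <- l) F i).
Proof.
elim: l P => [|i l IH] P fl fF; rewrite ?big_nil ?big_cons.
  by apply: card_le_void => // x /fl.
move=> s us sP.
rewrite -(count_predC (fun x => f x == i) s) -!size_filter natrD; apply: lerD.
  apply: (fF i (mem_head _ _)); first exact: filter_uniq.
  by move=> x; rewrite mem_filter => /andP[/eqP fx /sP].
have P'r : card_le (fun x => P x /\ f x != i) (\sum_(j <- l) F j).
  apply: IH => [x [/fl]|j jl]; first by rewrite inE => /orP[->|].
  apply: card_le_sub (fF j _) _ => //; last by rewrite inE jl orbT.
  by move=> x [[]].
apply: P'r; first exact: filter_uniq.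
by move=> x; rewrite mem_filter => /andP[fx /sP].
Qed.

Lemma sumr_const_seq (R : pzRingType) (I : Type) (l : seq I) (c : R) :
  \sum_(i <- l) c = (size l)%:R * c.
Proof. by rewrite big_const_seq count_predT iter_addr addr0 mulr_natl. Qed.

(** No index list is required: the base values are read off from the sampled list, and there are at
    most [a] of them. *)
Lemma card_le_fibM (R : realType) (T I : eqType) (f : T -> I)
    (P : T -> Prop) (Q : I -> Prop) (a b : R) : 0 <= b ->
  (forall x, P x -> Q (f x)) -> card_le Q a ->
  (forall i, Q i -> card_le (fun x => P x /\ f x = i) b) -> card_le P (a * b).
Proof.
move=> b0 fQ Qa Pb s us sP.
pose l := undup (map f s).
have lQ i : i \in l -> Q i.
  by rewrite mem_undup => /mapP[x /sP/fQ Qx ->].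
have : card_le (fun x => x \in s) (\sum_(i <- l) b).
  apply: (@card_le_fib _ _ _ f) => [x xs|i /lQ Qi].
    by rewrite mem_undup map_f.
  by apply: card_le_sub (Pb i Qi) _ => // x [/sP].
move=> /(_ s us (fun x xs => xs))/le_trans; apply.
rewrite sumr_const_seq.
by apply: ler_wpM2r => //; apply: Qa => //; exact: undup_uniq.
Qed.

Lemma card_leU (R : realType) (T : eqType) (P P1 P2 : T -> Prop) (a b : R) :
  (forall x, P x -> P1 x \/ P2 x) -> card_le P1 a -> card_le P2 b ->
  card_le P (a + b).
Proof.
move=> PU P1a P2b.
pose f x := `[< P1 x >].
have -> : a + b = \sum_(i <- [:: true; false]) (if i then a else b).
  by rewrite !big_cons big_nil addr0.
apply: (@card_le_fib _ _ _ f) => [x _|i _]; first by case: (f x).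
case: i.
  by apply: card_le_sub P1a _ => // x [_ /asboolP].
apply: card_le_sub P2b _ => // x [/PU[] //].
by move=> P1x; rewrite /f; move/asboolP: P1x => ->.
Qed.

Lemma card_le_seq (R : realType) (T : eqType) (l : seq T) (P : T -> Prop) :
  (forall x, P x -> x \in l) -> card_le P ((size l)%:R : R).
Proof.
move=> Pl s us sP; rewrite ler_nat; apply: uniq_leq_size => // x /sP; exact: Pl.
Qed.

Lemma card_le_iota (R : realType) (m n : nat) :
  card_le (fun k => (m <= k < m + n)%N) (n%:R : R).
Proof.
rewrite -{2}(size_iota m n); apply: card_le_seq => k; by rewrite mem_iota.
Qed.

Lemma card_le_dyadic (R : realType) (Y : nat) :
  card_le (fun k => (Y <= k < 2 * Y)%N) (Y%:R : R).
Proof. by have := @card_le_iota R Y Y; rewrite addnn -mul2n. Qed.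

Lemma card_le_prod (R : realType) (T I : eqType) (P : T -> Prop) (Q : I -> Prop)
    (a b : R) : card_le P a -> card_le Q b ->
  card_le (fun x : T * I => P x.1 /\ Q x.2) (a * b).
Proof.
move=> Pa Qb; apply: (@card_le_fibM _ _ _ fst _ P) => //.
- exact: card_le_ge0 Qb.
- by move=> x [].
move=> i _; apply: (@card_le_inj _ _ _ snd _ Q) => //.
  by move=> [x1 x2] [y1 y2] /= [_ ->] [_ ->] ->.
by move=> x [[]].
Qed.

Lemma card_le_absz (R : realType) (r : R) : 0 <= r ->
  card_le (fun z : int => `|z|%N%:R <= r) (2 * r + 1).
Proof.
move=> r0; pose n := Num.truncn r.
have nr : n%:R <= r by rewrite truncn_le.
have -> : 2 * r + 1 = 2 * (r - n%:R) + (2 * n + 1)%:R by rewrite natrD natrM; lra.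
apply: (@card_le_mono _ _ _ ((2 * n + 1)%N%:R)); last by rewrite lerDr mulr_ge0// subr_ge0.
have zn (z : int) : `|z|%N%:R <= r -> (`|z| <= n)%N by rewrite /n truncn_ge_nat.
(* On the range in question [z + n] is nonnegative, so taking its [absz] stays injective and lands
   among [2 n + 1] naturals. *)
apply: (@card_le_inj R int nat (fun z : int => absz (z + n%:Z)%R) _
  (fun k => is_true (0 <= k < 0 + (2 * n + 1))%N)); last exact: card_le_iota.
- by move=> x y /zn xn /zn yn; lia.
- by move=> z /zn; lia.
Qed.

Lemma spaced_le (R : realType) (T : eqType) (P : T -> Prop) (r : T -> R)
    (d l : R) : 0 < d -> 0 <= l ->
  (forall x y, P x -> P y -> x <> y -> d <= `|r x - r y|) ->
  (forall x y, P x -> P y -> `|r x - r y| <= l) ->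
  card_le P (1 + l / d).
Proof.
move=> d0 l0 rd rl s us sP.
case: s us sP => [|x0 s0] us sP; first by rewrite addr_ge0 // divr_ge0 // ltW.
set s := x0 :: s0 in us sP *.
have minE (t : seq T) x :
    exists2 m, m \in x :: t & forall z, z \in x :: t -> r m <= r z.
  elim: t x => [|y t IH] x.
    by exists x; rewrite ?mem_head // => z; rewrite inE => /eqP ->.
  have [m mt mmin] := IH y; have [xm|mx] := leP (r x) (r m).
    exists x; rewrite ?mem_head // => z; rewrite inE => /orP[/eqP -> //|/mmin].
    exact: le_trans.
  exists m; first by rewrite inE mt orbT.
  by move=> z; rewrite inE => /orP[/eqP ->|/mmin //]; exact: ltW.
have [m ms mmin] := minE s0 x0; rewrite -/s in ms mmin.
(* Pigeonhole: measured from the least value in steps of [d], two points with the same integer part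
   would be closer than [d]. *)
pose f x := Num.truncn ((r x - r m) / d).
have f0 x : x \in s -> 0 <= (r x - r m) / d.
  by move=> xs; rewrite divr_ge0 ?subr_ge0 ?mmin // ltW.
have finj : {in s &, injective f}.
  move=> x y xs ys fxy; apply: contrapT => xy.
  have := rd _ _ (sP _ xs) (sP _ ys) xy; apply/negP; rewrite -ltNge.
  have /andP[fx1 fx2] := truncn_itv (f0 _ xs).
  have /andP[fy1 fy2] := truncn_itv (f0 _ ys).
  rewrite -/(f x) -/(f y) fxy in fx1 fx2 fy1 fy2.
  have E : r x - r y = ((r x - r m) / d - (r y - r m) / d) * d by field; rewrite gt_eqF.
  rewrite E normrM (gtr0_norm d0) -[ltRHS]mul1r ltr_pM2r //.
  rewrite -natr1 in fx2 fy2.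
  by rewrite ltr_norml; lra.
pose n := Num.truncn (l / d).
have ld0 : 0 <= l / d by rewrite divr_ge0 // ltW.
have sz : (size s <= n.+1)%N.
  rewrite -(size_map f) -[n.+1](size_iota 0); apply: uniq_leq_size.
    by rewrite map_inj_in_uniq.
  move=> _ /mapP[x xs ->]; rewrite mem_iota /= add0n ltnS; apply: le_truncn.
  rewrite ler_pM2r ?invr_gt0 //; apply: le_trans (rl _ _ (sP _ xs) (sP _ ms)).
  exact: ler_norm.
apply: (@le_trans _ _ (n.+1)%:R); first by rewrite ler_nat.
by rewrite -nat1r lerD2l truncn_le.
Qed.

(** * Pairs on a conic with fixed modulus *)

Lemma dvdn_gauss_cofactor (q d s : nat) : (0 < q)%N -> (q %| d * s)%N ->
  (q %/ gcdn q d %| s)%N.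
Proof.
move=> q0 qds; have g0 : (0 < gcdn q d)%N by rewrite gcdn_gt0 q0.
have co : coprime (q %/ gcdn q d) (d %/ gcdn q d).
  rewrite /coprime -(eqn_pmul2r g0) muln_gcdl mul1n.
  by rewrite !divnK ?dvdn_gcdl ?dvdn_gcdr.
rewrite -(Gauss_dvdr _ co) -(dvdn_pmul2r g0) mulnAC !divnK ?dvdn_gcdl ?dvdn_gcdr //.
Qed.

(* Two pairs in the same class modulo [gcd(q, D)] have ratios that agree modulo
   [e] and modulo [q / e], and the two moduli share at most a factor [2]. *)
Lemma same_class_dvd (q : nat) (x y x' y' x0 y0 : int) : (0 < q)%N ->
  coprime q `|x0| -> coprime q `|y0| -> coprime q `|x| ->
  (q %| `|(x * y0 - x0 * y)%R| * `|(x * y0 + x0 * y)%R|)%N ->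
  (q %| `|(x' * y0 - x0 * y')%R| * `|(x' * y0 + x0 * y')%R|)%N ->
  gcdn q `|(x * y0 - x0 * y)%R| = gcdn q `|(x' * y0 - x0 * y')%R| ->
  (q %| `|(x * y' - x' * y)%R| * 2)%N.
Proof.
move=> q0 cx0 cy0 cx qD qD' eqe.
set e := gcdn q `|(x * y0 - x0 * y)%R| in eqe *.
have eq : (e %| q)%N by rewrite dvdn_gcdl.
have fq : (q %/ e %| q)%N by rewrite dvdn_div.
have fS := dvdn_gauss_cofactor q0 qD; rewrite -/e in fS.
have fS' := dvdn_gauss_cofactor q0 qD'; rewrite -eqe in fS'.
have eD : (e %| `|(x * y0 - x0 * y)%R|)%N by rewrite dvdn_gcdr.
have eD' : (e %| `|(x' * y0 - x0 * y')%R|)%N by rewrite eqe dvdn_gcdr.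
have cop d z : (d %| q)%N -> coprime q z -> coprime d z by exact: coprime_dvdl.
(* Multiplied by [y0], a unit modulo [d], the determinant is a combination of the two numbers
   assumed divisible; it is used with [s = -1] and [s = 1]. *)
have X1 (d : nat) (s : int) : (d %| q)%N ->
    (d %| `|(x * y0 + s * (x0 * y))%R|)%N -> (d %| `|(x' * y0 + s * (x0 * y'))%R|)%N ->
    (d %| `|(x * y' - x' * y)%R|)%N.
  move=> dq; rewrite -!(dvdzE d%:Z) => d1 d2.
  suff : (d%:Z %| (y0 * (x * y' - x' * y))%R)%Z.
    by rewrite !dvdzE /= abszM Gauss_dvdr // cop.
  have -> : y0 * (x * y' - x' * y) =
      y' * (x * y0 + s * (x0 * y)) - y * (x' * y0 + s * (x0 * y')) by ring.
  by rewrite rpredB ?dvdz_mull.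
have eX : (e %| `|(x * y' - x' * y)%R|)%N.
  by apply: (X1 e (-1)) => //; rewrite mulN1r.
have fX : (q %/ e %| `|(x * y' - x' * y)%R|)%N.
  by apply: (X1 _ 1) => //; rewrite mul1r.
(* A common divisor of both moduli divides the difference and the sum of [x y0] and [x0 y], hence
   [2 x y0]. *)
have h2 : (gcdn e (q %/ e) %| 2)%N.
  set h := gcdn _ _.
  have hq : (h %| q)%N by apply: dvdn_trans eq; exact: dvdn_gcdl.
  have hD : (h %| `|(x * y0 - x0 * y)%R|)%N.
    by apply: dvdn_trans eD; exact: dvdn_gcdl.
  have hS : (h %| `|(x * y0 + x0 * y)%R|)%N.
    by apply: dvdn_trans fS; exact: dvdn_gcdr.
  have : (h%:Z %| (x * y0 - x0 * y) + (x * y0 + x0 * y))%Z.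
    by rewrite rpredD ?dvdzE.
  have -> : (x * y0 - x0 * y) + (x * y0 + x0 * y) = 2 * (x * y0) by ring.
  rewrite dvdzE /= abszM abszM Gauss_dvdl //.
  by rewrite coprimeMr; apply/andP; split; apply: cop.
rewrite -[q in (q %| _)%N](divnK eq) mulnC -muln_lcm_gcd; apply: dvdn_mul => //.
by rewrite dvdn_lcm eX.
Qed.

(** On a conic with third coordinate [y3] fixed, [q] is [u3 y3^2] and [n] is minus the third term,
    so that [r] reflects the bound on [t3]. *)
Definition conic_pair (R : realType) (q u v : nat) (t w : int) (Y Z : nat)
    (r : R) (y : nat * nat) : Prop :=
  let n := u%:Z * t * y.1%:Z ^+ 2 + v%:Z * w * y.2%:Z ^+ 2 in
  [/\ (Y <= y.1 < 2 * Y)%N, (Z <= y.2 < 2 * Z)%N,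
      [&& coprime y.1 y.2, coprime q y.1 & coprime q y.2],
      (q %| `|n|)%N & `|n|%N%:R <= r].

(** Eliminating [v w] between the two pairs leaves [u t] times a difference of two squares. Here [u]
    is a unit modulo [q], and [t] costs the factor [gcdn q t]. *)
Lemma conic_pair_class (R : realType) (q u v : nat) (t w : int) (Y Z : nat)
    (r : R) (y z : nat * nat) : (0 < q)%N -> coprime q u ->
  conic_pair q u v t w Y Z r y -> conic_pair q u v t w Y Z r z ->
  (q %/ gcdn q `|t| %| `|(y.1%:Z * z.2%:Z - z.1%:Z * y.2%:Z)%R| *
     `|(y.1%:Z * z.2%:Z + z.1%:Z * y.2%:Z)%R|)%N.
Proof.
move=> q0 cu [_ _ _ qy _] [_ _ _ qz _].
apply: dvdn_gauss_cofactor => //; rewrite -!abszM.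
rewrite -(Gauss_dvdr _ cu) -[X in (_ %| X * _)%N]absz_nat -abszM -(dvdzE q%:Z).
set d := (X in (_ %| X)%Z).
have -> : d = (u%:Z * t * y.1%:Z ^+ 2 + v%:Z * w * y.2%:Z ^+ 2) * z.2%:Z ^+ 2 -
    (u%:Z * t * z.1%:Z ^+ 2 + v%:Z * w * z.2%:Z ^+ 2) * y.2%:Z ^+ 2.
  by rewrite /d; ring.
by rewrite rpredB ?dvdz_mulr ?dvdzE.
Qed.

(** Distinct fractions in lowest terms differ by a nonzero determinant over [y2 z2]. Divisibility
    makes the determinant at least [q / 2], and each denominator is below [2 Z]. *)
Lemma conic_pair_spacing (R : realType) (y1 y2 z1 z2 Z : nat) (q : nat) :
  (0 < Z)%N -> (0 < y2)%N -> (0 < z2)%N ->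
  (y2 < 2 * Z)%N -> (z2 < 2 * Z)%N -> (0 < y1)%N -> (0 < z1)%N ->
  coprime y1 y2 -> coprime z1 z2 -> (y1, y2) <> (z1, z2) ->
  (q %| `|(y1%:Z * z2%:Z - z1%:Z * y2%:Z)%R| * 2)%N ->
  q%:R / (8 * Z%:R ^+ 2) <= `|y1%:R / y2%:R - z1%:R / z2%:R| :> R.
Proof.
move=> Z0 y20 z20 y2Z z2Z y10 z10 cy cz neq qX.
set X := y1%:Z * z2%:Z - z1%:Z * y2%:Z in qX *.
have X0 : X != 0.
  apply/eqP => /eqP; rewrite subr_eq0 -!PoszM => /eqP[E]; apply: neq.
  have d1 : (y1 %| z1)%N.
    by have := dvdn_mulr z2 (dvdnn y1); rewrite E Gauss_dvdl.
  have d2 : (z1 %| y1)%N.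
    by have := dvdn_mulr y2 (dvdnn z1); rewrite -E Gauss_dvdl.
  have E1 : y1 = z1 by apply/eqP; rewrite eqn_dvd d1 d2.
  by move: E; rewrite E1 => /eqP; rewrite eqn_pmul2l // => /eqP ->.
have qle : (q <= `|X| * 2)%N by apply: dvdn_leq => //; rewrite muln_gt0 absz_gt0 X0.
have y2R : (0 : R) < y2%:R by rewrite ltr0n.
have z2R : (0 : R) < z2%:R by rewrite ltr0n.
have ZR : (0 : R) < Z%:R by rewrite ltr0n.
have -> : y1%:R / y2%:R - z1%:R / z2%:R = X%:~R / (y2%:R * z2%:R) :> R.
  rewrite /X rmorphB /= !rmorphM /= -!pmulrn; field.
  by rewrite !gt_eqF.
rewrite normrM normfV (gtr0_norm (mulr_gt0 y2R z2R)).
rewrite ler_pdivlMr ?mulr_gt0 // mulrAC ler_pdivrMr ?mulr_gt0 ?exprn_gt0 //.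
have -> : `|X%:~R : R| = `|X|%N%:R by rewrite natr_absz intr_norm.
have qR : q%:R <= `|X|%N%:R * 2 :> R by rewrite -natrM ler_nat.
have yz : y2%:R * z2%:R <= 4 * Z%:R ^+ 2 :> R.
  have := ltnW y2Z; have := ltnW z2Z; rewrite -!(ler_nat R) !natrM => h1 h2.
  by nra.
by apply: (@le_trans _ _ (`|X|%N%:R * 2 * (4 * Z%:R ^+ 2))); first apply: ler_pM => //;
  rewrite ?mulr_ge0 ?ler0n //; lra.
Qed.

(** One pair [z] serves as reference, and the others are sorted by a gcd relative to it, at most one
    class per divisor of [q]. Within a class the ratios are spaced by [d], while the bound on the
    quadratic form confines them to an interval of length [l]. *)
Lemma conic_pair_le (R : realType) (q u v : nat) (t w : int) (Y Z : nat) (r : R) :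
  (0 < q)%N -> (0 < u)%N -> (0 < Y)%N -> (0 < Z)%N -> t != 0 -> 0 <= r ->
  coprime q u ->
  card_le (conic_pair q u v t w Y Z r)
    ((size (divisors q))%:R *
      (1 + 16 * r * (gcdn q `|t|)%:R * Z%:R / (u%:R * `|t|%N%:R * Y%:R * q%:R))).
Proof.
move=> q0 u0 Y0 Z0 t0 r0 cu.
set P := conic_pair _ _ _ _ _ _ _ _; set g := gcdn q `|t|.
have g0 : (0 < g)%N by rewrite gcdn_gt0 q0.
have gq : (g %| q)%N by exact: dvdn_gcdl.
pose q1 := (q %/ g)%N.
have q10 : (0 < q1)%N by rewrite divn_gt0 // dvdn_leq.
have q1q : (q1 %| q)%N by exact: dvdn_div.
have uR : (0 : R) < u%:R by rewrite ltr0n.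
have tR : (0 : R) < `|t|%N%:R by rewrite ltr0n absz_gt0.
have YR : (0 : R) < Y%:R by rewrite ltr0n.
have ZR : (0 : R) < Z%:R by rewrite ltr0n.
have qR : (0 : R) < q%:R by rewrite ltr0n.
have gR : (0 : R) < g%:R by rewrite ltr0n.
have q1R : (0 : R) < q1%:R by rewrite ltr0n.
have bnd0 : 0 <= 16 * r * g%:R * Z%:R / (u%:R * `|t|%N%:R * Y%:R * q%:R).
  by rewrite divr_ge0 ?mulr_ge0 ?ler0n.
move=> s us sP; case: s us sP => [|z s0] us sP.
  by rewrite mulr_ge0 ?addr_ge0.
set s := z :: s0 in us sP *.
have zP : P z by apply: sP; exact: mem_head.
pose f (y : nat * nat) := gcdn q1 `|(y.1%:Z * z.2%:Z - z.1%:Z * y.2%:Z)%R|.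
suff H : card_le P (\sum_(e <- divisors q)
    (1 + 16 * r * g%:R * Z%:R / (u%:R * `|t|%N%:R * Y%:R * q%:R))).
  have := H s us sP.
  by rewrite sumr_const_seq.
apply: (@card_le_fib _ _ _ f) => [y Py|e _].
  by rewrite -dvdn_divisors //; apply: dvdn_trans q1q; exact: dvdn_gcdl.
pose d : R := q1%:R / (8 * Z%:R ^+ 2).
pose l : R := 2 * r / (u%:R * `|t|%N%:R * (Y%:R * Z%:R)).
have -> : 16 * r * g%:R * Z%:R / (u%:R * `|t|%N%:R * Y%:R * q%:R) = l / d.
  have -> : q%:R = q1%:R * g%:R :> R by rewrite -natrM divnK.
  by rewrite /l /d; field; rewrite !gt_eqF.
have pos y : P y -> [/\ (0 < y.1)%N & (0 < y.2)%N].
  move=> [/andP[h1 _] /andP[h2 _] _ _ _]; split.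
    exact: leq_trans Y0 h1.
  exact: leq_trans Z0 h2.
apply: (@spaced_le _ _ _ (fun y : nat * nat => y.1%:R / y.2%:R)).
- by rewrite divr_gt0 // mulr_gt0 // exprn_gt0.
- by rewrite divr_ge0 ?mulr_ge0 ?ler0n.
- move=> [y1 y2] [x1 x2] [Py ey] [Px ex] neq /=.
  have [/= y10 y20] := pos _ Py; have [/= x10 x20] := pos _ Px.
  have [/= /andP[_ hy1] /andP[_ hy2] /and3P[cy cqy1 cqy2] _ _] := Py.
  have [/= /andP[_ hx1] /andP[_ hx2] /and3P[cx cqx1 cqx2] _ _] := Px.
  have [_ _ /and3P[cz cqz1 cqz2] _ _] := zP.
  apply: conic_pair_spacing => //.
  apply: (@same_class_dvd q1 _ _ _ _ z.1%:Z z.2%:Z) => //=.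
  + exact: coprime_dvdl q1q cqz1.
  + exact: coprime_dvdl q1q cqz2.
  + exact: coprime_dvdl q1q cqy1.
  + exact: (conic_pair_class q0 cu Py zP).
  + exact: (conic_pair_class q0 cu Px zP).
  + by rewrite -/(f (y1, y2)) -/(f (x1, x2)) ey ex.
- move=> [y1 y2] [x1 x2] [Py _] [Px _] /=.
  have [/= y10 y20] := pos _ Py; have [/= x10 x20] := pos _ Px.
  have [/= /andP[hy1 _] /andP[hy2 hy2'] _ _ ny] := Py.
  have [/= /andP[hx1 _] /andP[hx2 hx2'] _ _ nx] := Px.
  have toR (a b : nat) : `|(u%:Z * t * a%:Z ^+ 2 + v%:Z * w * b%:Z ^+ 2)%R|%N%:R =
      `|u%:R * t%:~R * a%:R ^+ 2 + v%:R * w%:~R * b%:R ^+ 2| :> R.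
    by rewrite natr_absz intr_norm !expr2 rmorphD /= !rmorphM /= -!pmulrn.
  rewrite toR in ny; rewrite toR in nx.
  have tE : `|t|%N%:R = `|t%:~R| :> R.
    by rewrite natr_absz intr_norm.
  have y2R : (Z%:R : R) <= y2%:R by rewrite ler_nat.
  have x2R : (Z%:R : R) <= x2%:R by rewrite ler_nat.
  have y1R : (Y%:R : R) <= y1%:R by rewrite ler_nat.
  have x1R : (Y%:R : R) <= x1%:R by rewrite ler_nat.
  have y2R' : (y2%:R : R) <= 2 * Z%:R by rewrite -natrM ler_nat ltnW.
  have x2R' : (x2%:R : R) <= 2 * Z%:R by rewrite -natrM ler_nat ltnW.
  rewrite /l tE ler_pdivlMr; last by rewrite !mulr_gt0 // -tE.
  set a : R := y1%:R / y2%:R; set b : R := x1%:R / x2%:R.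
  (* Divided by [k^2], the form shows that [u t (c / k)^2] lies within [r / Z^2] of the constant
     [- v w]. *)
  have scal (c k : R) : Z%:R <= k -> `|u%:R * t%:~R * c ^+ 2 + v%:R * w%:~R * k ^+ 2| <= r ->
      `|u%:R * t%:~R * (c / k) ^+ 2 + v%:R * w%:~R| * Z%:R ^+ 2 <= r.
    move=> Zk; apply: le_trans.
    have k0 : 0 < k by exact: lt_le_trans Zk.
    have -> : u%:R * t%:~R * c ^+ 2 + v%:R * w%:~R * k ^+ 2 =
        (u%:R * t%:~R * (c / k) ^+ 2 + v%:R * w%:~R) * k ^+ 2.
      by field; rewrite gt_eqF.
    rewrite normrM ler_wpM2l // ger0_norm ?sqr_ge0 //.
    by rewrite ler_sqr ?nnegrE // ltW.
  have ha := scal _ _ y2R ny; have hb := scal _ _ x2R nx.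
  rewrite -/a in ha; rewrite -/b in hb.
  have ab2 : u%:R * `|t%:~R| * `|a - b| * (a + b) * Z%:R ^+ 2 <= 2 * r.
    have a0 : 0 <= a by rewrite divr_ge0.
    have b0 : 0 <= b by rewrite divr_ge0.
    have -> : u%:R * `|t%:~R| * `|a - b| * (a + b) =
        `|(u%:R * t%:~R * a ^+ 2 + v%:R * w%:~R) - (u%:R * t%:~R * b ^+ 2 + v%:R * w%:~R)|.
      have -> : (u%:R * t%:~R * a ^+ 2 + v%:R * w%:~R) - (u%:R * t%:~R * b ^+ 2 + v%:R * w%:~R)
         = u%:R * t%:~R * (a - b) * (a + b) by ring.
      by rewrite !normrM (ger0_norm (addr_ge0 a0 b0)) (gtr0_norm uR).
    apply: (@le_trans _ _ ((`|u%:R * t%:~R * a ^+ 2 + v%:R * w%:~R| +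
      `|u%:R * t%:~R * b ^+ 2 + v%:R * w%:~R|) * Z%:R ^+ 2)).
      by rewrite ler_wpM2r ?sqr_ge0 // ler_normB.
    by rewrite mulrDl; lra.
  (* Each ratio is at least [Y / (2 Z)], so [a + b] is at least [Y / Z]: closeness of the squares
     becomes closeness of the ratios. *)
  have yb (c k : R) : Y%:R <= c -> 0 < k -> k <= 2 * Z%:R -> Y%:R <= (c / k) * (2 * Z%:R).
    move=> Yc k0 kZ; apply: (le_trans Yc); rewrite mulrAC ler_pdivlMr //.
    by rewrite ler_wpM2l //; apply: le_trans Yc; exact: ltW.
  have ya := yb _ _ y1R (lt_le_trans ZR y2R) y2R'; rewrite -/a in ya.
  have yb' := yb _ _ x1R (lt_le_trans ZR x2R) x2R'; rewrite -/b in yb'.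
  apply: le_trans ab2.
  have -> : u%:R * `|t%:~R| * `|a - b| * (a + b) * Z%:R ^+ 2 =
     `|a - b| * (u%:R * `|t%:~R| * ((a + b) * Z%:R * Z%:R)) by ring.
  rewrite ler_wpM2l // ler_wpM2l ?mulr_ge0 ?ler0n // ler_wpM2r ?ler0n //; lra.
Qed.

(** * Conic points in a dyadic box *)

(** A witness is chosen for each listed element; the resulting pairs are distinct because their
    first components are. *)
Lemma card_le_ex (R : realType) (T I : eqType) (Q : T * I -> Prop) (r : R) :
  card_le Q r -> card_le (fun x => exists i, Q (x, i)) r.
Proof.
move=> Qr s us sP.
have [s' s's s'Q] : exists2 s', map fst s' = s & forall z, z \in s' -> Q z.
  elim: s {us} sP => [|x s IH] sP; first by exists [::].
  have [|s' <- s'Q] := IH; first by move=> z zs; apply: sP; rewrite inE zs orbT.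
  have [i Qi] := sP x (mem_head _ _).
  by exists ((x, i) :: s') => // z; rewrite inE => /orP[/eqP ->|/s'Q].
rewrite -s's size_map; apply: Qr => //.
by move: us; rewrite -s's; exact: map_uniq.
Qed.

Lemma sum_inv_sqrt_le (R : realType) (n : nat) :
  \sum_(m <- iota 1 n) (Num.sqrt m%:R)^-1 <= 2 * Num.sqrt n%:R :> R.
Proof.
elim: n => [|n IH]; first by rewrite big_nil sqrtr0 mulr0.
have -> : iota 1 n.+1 = iota 1 n ++ [:: n.+1] by have := iotaD 1 n 1; rewrite addn1 add1n.
rewrite big_cat /= big_seq1.
apply: le_trans (lerD IH (lexx _)) _.
set a := Num.sqrt n%:R; set b := Num.sqrt n.+1%:R.
have a0 : 0 <= a by exact: sqrtr_ge0.
have b0 : 0 < b by rewrite sqrtr_gt0 ltr0n.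
have a2 : a ^+ 2 = n%:R by rewrite sqr_sqrtr.
have b2 : b ^+ 2 = n%:R + 1 by rewrite sqr_sqrtr // -natr1.
have E : b^-1 * b = 1 by rewrite mulVf // gt_eqF.
have : 2 * a * b + 1 <= 2 * b ^+ 2.
  by rewrite !expr2 in a2 b2 *; nra.
move=> h; rewrite -(ler_pM2r b0) mulrDl E; rewrite expr2 in h; lra.
Qed.

Lemma sum_inv_sqrt2_le (R : realType) (m n : nat) (k : R) : 0 <= k ->
  \sum_(x <- [seq (i, j) | i <- iota 1 m, j <- iota 1 n])
     (1 + k / Num.sqrt (x.1%:R * x.2%:R)) <=
  m%:R * n%:R + 4 * k * Num.sqrt (m%:R * n%:R).
Proof.
move=> k0; rewrite big_allpairs /=.
under eq_bigr => i _ do rewrite big_split /= sumr_const_seq mulr1 size_iota.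
rewrite big_split /= sumr_const_seq size_iota lerD2l.
under eq_bigr => i _ do under eq_bigr => j _ do
  rewrite sqrtrM ?ler0n // invfM mulrA.
under eq_bigr => i _ do rewrite -mulr_sumr.
rewrite -mulr_suml -mulr_sumr sqrtrM ?ler0n //.
have -> : 4 * k * (Num.sqrt m%:R * Num.sqrt n%:R) =
  (k * (2 * Num.sqrt m%:R)) * (2 * Num.sqrt n%:R) by ring.
have s0 p : 0 <= \sum_(i <- iota 1 p) (Num.sqrt i%:R)^-1 :> R.
  by apply: sumr_ge0 => i _; rewrite invr_ge0 sqrtr_ge0.
apply: ler_pM; rewrite ?mulr_ge0 ?s0 //; last exact: sum_inv_sqrt_le.
by rewrite ler_wpM2l // sum_inv_sqrt_le.
Qed.

Definition dyadic_box (Y1 Y2 Y3 : nat) (y : nat * nat * nat) : bool :=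
  [&& (Y1 <= y.1.1 < 2 * Y1)%N, (Y2 <= y.1.2 < 2 * Y2)%N & (Y3 <= y.2 < 2 * Y3)%N].

Definition coprime_uy (u1 u2 u3 : nat) (y : nat * nat * nat) : bool :=
  [&& coprime (u1 * y.1.1) (u2 * y.1.2), coprime (u1 * y.1.1) (u3 * y.2) &
      coprime (u2 * y.1.2) (u3 * y.2)].

(** The same equation is linear in [t] and a conic in [y]: [t] will be a short vector of the plane
    lattice attached to [y]. *)
Definition conic_rel (R : realType) (u1 u2 u3 Y1 Y2 Y3 : nat) (a1 a2 a3 : R)
    (x : (nat * nat * nat) * (int * int * int)) : Prop :=
  let: (y, t) := x in
  [/\ dyadic_box Y1 Y2 Y3 y, coprime_uy u1 u2 u3 y,
      [&& t.1.1 != 0, t.1.2 != 0 & t.2 != 0],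
      u1%:Z * t.1.1 * y.1.1%:Z ^+ 2 + u2%:Z * t.1.2 * y.1.2%:Z ^+ 2 +
        u3%:Z * t.2 * y.2%:Z ^+ 2 = 0 &
      [/\ `|t.1.1|%N%:R * (u1 * Y1 ^ 2)%N%:R <= a1,
          `|t.1.2|%N%:R * (u2 * Y2 ^ 2)%N%:R <= a2 &
          `|t.2|%N%:R * (u3 * Y3 ^ 2)%N%:R <= a3]].

Definition conic_pt (R : realType) (u1 u2 u3 Y1 Y2 Y3 : nat) (a1 a2 a3 : R)
    (y : nat * nat * nat) : Prop :=
  exists t, conic_rel u1 u2 u3 Y1 Y2 Y3 a1 a2 a3 (y, t).

Lemma card_le_signs (R : realType) (T : eqType) (P : T -> Prop)
    (f g : T -> int) (r : R) : 0 <= r ->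
  (forall a b : int, card_le (fun x => [/\ P x, f x = a & g x = b]) r) ->
  forall m n : nat, card_le (fun x => [/\ P x, `|f x|%N = m & `|g x|%N = n]) (4 * r).
Proof.
move=> r0 H m n.
apply: (@card_le_fibM _ _ (bool * bool)%type (fun x => (f x < 0, g x < 0)) _
  (fun _ => True)) => //.
  have -> : 4 = (size [:: (true, true); (true, false); (false, true); (false, false)])%:R :> R by [].
  by apply: card_le_seq => -[[] []].
move=> [i j] _.
apply: card_le_sub (H (if i then - m%:Z else m%:Z) (if j then - n%:Z else n%:Z)) (lexx _).
move=> x [[Px <- <-] [<- <-]]; split=> //.
  by case: ltP => h; [rewrite ltz0_abs // opprK | rewrite gez0_abs].
by case: ltP => h; [rewrite ltz0_abs // opprK | rewrite gez0_abs].
Qed.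

(** Modulo [q] the factors [u y^2] and [v z^2] are units, so a divisor of [q] that divides one of
    [t], [w] divides the other. *)
Lemma coprime_pair_gcd (q u v : nat) (t w : int) (y z : nat) :
  coprime q u -> coprime q v -> coprime q y -> coprime q z ->
  (q %| `|(u%:Z * t * y%:Z ^+ 2 + v%:Z * w * z%:Z ^+ 2)%R|)%N ->
  gcdn q `|t| = gcdn q `|w|.
Proof.
move=> cu cv cy cz qn.
have half (u' v' : nat) (t' w' : int) (y' z' : nat) : coprime q u' -> coprime q y' ->
  (q %| `|(u'%:Z * t' * y'%:Z ^+ 2 + v'%:Z * w' * z'%:Z ^+ 2)%R|)%N ->
  (gcdn q `|w'| %| gcdn q `|t'|)%N.
  move=> cu' cy' qn'; rewrite dvdn_gcd dvdn_gcdl /=.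
  set g := gcdn _ _; have gq : (g %| q)%N by exact: dvdn_gcdl.
  have gw : (g%:Z %| w')%Z by rewrite dvdzE dvdn_gcdr.
  have : (g%:Z %| u'%:Z * t' * y'%:Z ^+ 2)%Z.
    have gn : (g%:Z %| u'%:Z * t' * y'%:Z ^+ 2 + v'%:Z * w' * z'%:Z ^+ 2)%Z.
      by rewrite dvdzE; exact: dvdn_trans qn'.
    have := rpredB gn (dvdz_mulr (z'%:Z ^+ 2) (dvdz_mull v'%:Z gw)).
    by rewrite addrK.
  rewrite dvdzE /= abszM abszX abszM /= Gauss_dvdl; last first.
    by rewrite coprimeXr // (coprime_dvdl gq cy').
  by rewrite Gauss_dvdr // (coprime_dvdl gq cu').
apply/eqP; rewrite eqn_dvd (half _ _ _ _ _ _ cu cy qn).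
by move: qn; rewrite addrC => qn; rewrite (half _ _ _ _ _ _ cv cz qn).
Qed.

(** Fixing [y3] gives the modulus [q = u3 y3^2]. Next come [d], the common gcd of [q] with [t1] and
    [t2], and then [t1] and [t2] themselves, which are multiples of [d]; the pairs [(y1, y2)] are
    counted by [conic_pair_le], and the equation returns [t3]. The restriction to multiples of [d]
    leaves a factor [1 / d] in the end. *)
Lemma conic_pt_le (R : realType) (u1 u2 u3 Y1 Y2 Y3 : nat) (a1 a2 a3 : R) :
  (0 < u1)%N -> (0 < u2)%N -> (0 < u3)%N ->
  (0 < Y1)%N -> (0 < Y2)%N -> (0 < Y3)%N -> 0 <= a1 -> 0 <= a2 -> 0 <= a3 ->
  card_le (conic_pt u1 u2 u3 Y1 Y2 Y3 a1 a2 a3)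
    (\sum_(y <- iota Y3 Y3) (size (divisors (u3 * y ^ 2)))%:R *
       (\sum_(d <- divisors (u3 * y ^ 2)) d%:R^-1) *
       (4 * (a1 * a2 + 256 * a3 * Num.sqrt (a1 * a2) * (Y1%:R * Y2%:R) /
          (u3 * Y3 ^ 2)%N%:R) / ((u1 * Y1 ^ 2)%N%:R * (u2 * Y2 ^ 2)%N%:R))).
Proof.
move=> u10 u20 u30 Y10 Y20 Y30 a10 a20 a30; apply: card_le_ex.
apply: (@card_le_fib _ _ _ (fun x => x.1.2)) => [[y t] [/and3P[_ _ h] _ _ _ _]|y3].
  by rewrite mem_iota addnn -mul2n.
rewrite mem_iota => y3Y.
set q := (u3 * y3 ^ 2)%N.
have y30 : (0 < y3)%N by lia.
have q0 : (0 < q)%N by rewrite muln_gt0 u30 expn_gt0 y30.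
have y3le : (Y3 <= y3 <= 2 * Y3)%N by lia.
have q4 : (q <= 4 * (u3 * Y3 ^ 2))%N.
  by rewrite /q mulnCA leq_mul2l -[4%N]/(2 ^ 2)%N -expnMn leq_exp2r // (andP y3le).2 orbT.
have D3q : (u3 * Y3 ^ 2 <= q)%N by rewrite /q leq_mul2l leq_exp2r // (andP y3le).1 orbT.
set tau := (size (divisors q))%:R : R.
set D1 := (u1 * Y1 ^ 2)%N; set D2 := (u2 * Y2 ^ 2)%N; set D3 := (u3 * Y3 ^ 2)%N.
have D1R : (0 : R) < D1%:R by rewrite ltr0n muln_gt0 u10 expn_gt0 Y10.
have D2R : (0 : R) < D2%:R by rewrite ltr0n muln_gt0 u20 expn_gt0 Y20.
have D3R : (0 : R) < D3%:R by rewrite ltr0n muln_gt0 u30 expn_gt0 Y30.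
have qR : (0 : R) < q%:R by rewrite ltr0n.
have Y1R : (0 : R) < Y1%:R by rewrite ltr0n.
have Y2R : (0 : R) < Y2%:R by rewrite ltr0n.
have u1R : (0 : R) < u1%:R by rewrite ltr0n.
have u2R : (0 : R) < u2%:R by rewrite ltr0n.
have tau0 : 0 <= tau by exact: ler0n.
set S := Num.sqrt (a1 * a2).
have S0 : 0 <= S by exact: sqrtr_ge0.
set W := 4 * _ / _.
rewrite mulrAC mulr_sumr.
apply: (@card_le_fib _ _ _ (fun x => gcdn q `|x.2.1.1|)) => [x _|d].
  by rewrite -dvdn_divisors // dvdn_gcdl.
rewrite -dvdn_divisors // => dq.
have d0 : (0 < d)%N by exact: dvdn_gt0 dq.
have dR : (0 : R) < d%:R by rewrite ltr0n.
pose N1 := Num.truncn (a1 / (D1%:R * d%:R)).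
pose N2 := Num.truncn (a2 / (D2%:R * d%:R)).
(* [64] is the [16] of the pair count times [4], because [q] can be four times [u3 Y3^2]. *)
pose k : R := 64 * a3 * (Y1%:R * Y2%:R) / (q%:R * Num.sqrt (D1%:R * D2%:R)).
have k0 : 0 <= k.
  by rewrite divr_ge0 ?mulr_ge0 ?sqrtr_ge0 ?ler0n.
set P0 : (nat * nat * nat) * (int * int * int) -> Prop := fun x => _ /\ _.
have facts y t : P0 (y, t) ->
    [/\ y.2 = y3, coprime q u1, coprime q u2,
        conic_pair q u1 u2 t.1.1 t.1.2 Y1 Y2 (4 * a3) y.1 &
        gcdn q `|t.1.1| = d /\ gcdn q `|t.1.2| = d].
  case=> [[[/and3P[yb1 yb2 _] /and3P[c12 c13 c23] _ eqn [_ _ h3]] /= y2E] gE].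
  rewrite !coprimeMl !coprimeMr y2E in c12 c13 c23.
  move: c12 c13 c23 => /andP[/andP[u12 uy12] /andP[yu12 yy12]].
  move=> /andP[/andP[u13 uy13] /andP[yu13 yy13]] /andP[/andP[u23 uy23] /andP[yu23 yy23]].
  have cq (z : nat) : coprime z u3 -> coprime z y3 -> coprime q z.
    by move=> zu zy; rewrite coprimeMl coprimeXl // coprime_sym ?zu // coprime_sym.
  have nE : u1%:Z * t.1.1 * y.1.1%:Z ^+ 2 + u2%:Z * t.1.2 * y.1.2%:Z ^+ 2 =
      - (q%:Z * t.2).
    have -> : q%:Z = u3%:Z * y3%:Z ^+ 2 by rewrite /q PoszM; congr (_ * _); rewrite expr2 -PoszM mulnn.
    by apply/eqP; rewrite -subr_eq0 opprK -eqn y2E; apply/eqP; ring.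
  have qn : (q %| `|(u1%:Z * t.1.1 * y.1.1%:Z ^+ 2 + u2%:Z * t.1.2 * y.1.2%:Z ^+ 2)%R|)%N.
    by rewrite nE abszN abszM dvdn_mulr.
  have cp : conic_pair q u1 u2 t.1.1 t.1.2 Y1 Y2 (4 * a3) y.1.
    split=> //; first by rewrite yy12 !cq.
    rewrite nE abszN abszM natrM absz_nat.
    have h4 : q%:R <= 4 * D3%:R :> R.
      by rewrite -natrM ler_nat.
    apply: le_trans (ler_wpM2r (ler0n R `|t.2|) h4) _.
    by rewrite -/D3 in h3; lra.
  split=> //; rewrite ?cq //; split=> //.
  by rewrite -(coprime_pair_gcd _ _ _ _ qn) ?cq.
apply: (@card_le_mono _ _ _ (4 * tau * (N1%:R * N2%:R + 4 * k * Num.sqrt (N1%:R * N2%:R)))); last first.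
  have N1R : N1%:R <= a1 / (D1%:R * d%:R) :> R.
    by rewrite truncn_le divr_ge0 // mulr_ge0 ?ler0n.
  have N2R : N2%:R <= a2 / (D2%:R * d%:R) :> R.
    by rewrite truncn_le divr_ge0 // mulr_ge0 ?ler0n.
  have N12 : N1%:R * N2%:R <= a1 * a2 / (D1%:R * D2%:R * d%:R ^+ 2) :> R.
    apply: le_trans (ler_pM _ _ N1R N2R) _; rewrite ?ler0n //.
    rewrite le_eqVlt; apply/orP; left; apply/eqP.
    by field; rewrite !gt_eqF.
  have sN12 : Num.sqrt (N1%:R * N2%:R) <= S / (Num.sqrt (D1%:R * D2%:R) * d%:R) :> R.
    apply: le_trans (ler_wsqrtr N12) _.
    have -> : a1 * a2 / (D1%:R * D2%:R * d%:R ^+ 2) = (S / (Num.sqrt (D1%:R * D2%:R) * d%:R)) ^+ 2.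
      by rewrite expr_div_n exprMn !sqr_sqrtr ?mulr_ge0 ?ler0n.
    by rewrite sqrtr_sqr ger0_norm // divr_ge0 ?mulr_ge0 ?sqrtr_ge0 ?ler0n.
  have -> : tau * W * d%:R^-1 = 4 * tau * (a1 * a2 / (D1%:R * D2%:R * d%:R) +
      256 * a3 * S * (Y1%:R * Y2%:R) / (D3%:R * (D1%:R * D2%:R) * d%:R)).
    by rewrite /W; field; rewrite !gt_eqF.
  apply: ler_wpM2l; first by rewrite mulr_ge0.
  apply: lerD.
    apply: le_trans N12 _.
    rewrite ler_wpM2l ?mulr_ge0 // lef_pV2 ?posrE ?mulr_gt0 ?exprn_gt0 //.
    by rewrite expr2 ler_wpM2l ?mulr_ge0 ?ler0n // ler_peMl ?ler0n // ler1n.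
  apply: le_trans (ler_wpM2l _ sN12) _; first by rewrite mulr_ge0.
  have sD : Num.sqrt (D1%:R * D2%:R) * Num.sqrt (D1%:R * D2%:R) = D1%:R * D2%:R :> R.
    by rewrite -expr2 sqr_sqrtr // mulr_ge0 ?ler0n.
  have sD0 : (0 : R) < Num.sqrt (D1%:R * D2%:R) by rewrite sqrtr_gt0 mulr_gt0.
  have -> : 4 * k * (S / (Num.sqrt (D1%:R * D2%:R) * d%:R)) =
      256 * a3 * S * (Y1%:R * Y2%:R) / (q%:R * (D1%:R * D2%:R) * d%:R).
    move: sD sD0; rewrite /k; move: (Num.sqrt (D1%:R * D2%:R)) => sd sD sd0.
    by rewrite -sD; field; rewrite !gt_eqF.
  rewrite ler_wpM2l ?mulr_ge0 ?ler0n // lef_pV2 ?posrE ?mulr_gt0 //.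
  by rewrite ler_wpM2r ?ler0n // ler_wpM2r ?mulr_ge0 ?ler0n // ler_nat.
have : card_le P0 (\sum_(x <- [seq (i, j) | i <- iota 1 N1, j <- iota 1 N2])
    4 * (tau * (1 + k / Num.sqrt (x.1%:R * x.2%:R)))).
  apply: (@card_le_fib _ _ _ (fun x => (`|x.2.1.1| %/ d, `|x.2.1.2| %/ d)%N)).
    move=> [y t] Px; have [_ _ _ _ [g1 g2]] := facts _ _ Px.
    have [[[_ _ /and3P[t1 t2 _] _ [/= h1 h2 _]] _] _] := Px.
    have d1 : (d %| `|t.1.1|)%N by rewrite -g1 dvdn_gcdr.
    have d2 : (d %| `|t.1.2|)%N by rewrite -g2 dvdn_gcdr.
    have mem (t' : int) (D : nat) (a : R) : (d %| `|t'|)%N -> t' != 0 -> (0 : R) < D%:R ->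
        `|t'|%N%:R * D%:R <= a ->
        (`|t'| %/ d)%N \in iota 1 (Num.truncn (a / (D%:R * d%:R))).
      move=> dt t'0 D0 ha; rewrite mem_iota add1n ltnS divn_gt0 //.
      rewrite dvdn_leq ?absz_gt0 //=.
      have a0 : 0 <= a by apply: le_trans ha; rewrite mulr_ge0 ?ler0n.
      rewrite truncn_ge_nat ?divr_ge0 ?mulr_ge0 ?ler0n //.
      rewrite ler_pdivlMr ?mulr_gt0 //; apply: le_trans ha.
      have E : `|t'|%N%:R = (`|t'| %/ d)%N%:R * d%:R :> R by rewrite -natrM divnK.
      by rewrite [leRHS](_ : _ = (`|t'| %/ d)%N%:R * (D%:R * d%:R)) // {1}E; ring.
    by apply/allpairsP; exists ((`|t.1.1| %/ d)%N, (`|t.1.2| %/ d)%N);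
      split=> //=; apply: mem.
  move=> [m n]; case/allpairsP => -[m' n'] /= [+ + [-> ->]]; rewrite !mem_iota.
  move=> /andP[m0 _] /andP[n0 _].
  have m0R : (0 : R) < m'%:R by rewrite ltr0n.
  have n0R : (0 : R) < n'%:R by rewrite ltr0n.
  apply: (@card_le_sub _ _ _ (fun x => [/\ P0 x, `|x.2.1.1|%N = (m' * d)%N & `|x.2.1.2|%N = (n' * d)%N]) _ _ _ _ (lexx _)).
    move=> [y t] [Px [<- <-]] /=; have [_ _ _ _ [g1 g2]] := facts _ _ Px.
    have d1 : (d %| `|t.1.1|)%N by rewrite -g1 dvdn_gcdr.
    have d2 : (d %| `|t.1.2|)%N by rewrite -g2 dvdn_gcdr.
    by rewrite !divnK.
  apply: (@card_le_sub _ _ _ (fun x => [/\ P0 x /\ (`|x.2.1.1|%N = (m' * d)%N /\ `|x.2.1.2|%N = (n' * d)%N),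
     `|x.2.1.1|%N = (m' * d)%N & `|x.2.1.2|%N = (n' * d)%N]) _ _ _ _ (lexx _)).
    by move=> x [? ? ?].
  apply: (@card_le_signs R _ (fun x => P0 x /\ (`|x.2.1.1|%N = (m' * d)%N /\ `|x.2.1.2|%N = (n' * d)%N)) (fun x => x.2.1.1) (fun x => x.2.1.2)).
    by rewrite mulr_ge0 // addr_ge0 // mulr_ge0 // invr_ge0 sqrtr_ge0.
  move=> t1 t2.
  case: (pselect (exists x, [/\ P0 x /\ (`|x.2.1.1|%N = (m' * d)%N /\ `|x.2.1.2|%N = (n' * d)%N), x.2.1.1 = t1 & x.2.1.2 = t2])); last first.
    move=> nex; apply: card_le_void; last by move=> x Px; apply: nex; exists x.
    by rewrite mulr_ge0 // addr_ge0 // mulr_ge0 // invr_ge0 sqrtr_ge0.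
  move=> [[y0 t0] [[Px0 /= [t01 t02]] E1 E2]].
  have [_ cu1 cu2 _ [g1 g2]] := facts _ _ Px0.
  rewrite E1 in t01 g1; rewrite E2 in t02 g2.
  have t1n : t1 != 0 by rewrite -absz_gt0 t01 muln_gt0 m0.
  have t2n : t2 != 0 by rewrite -absz_gt0 t02 muln_gt0 n0.
  have sub (r : R) : card_le (conic_pair q u1 u2 t1 t2 Y1 Y2 (4 * a3)) r ->
    card_le (fun x => [/\ P0 x /\ (`|x.2.1.1|%N = (m' * d)%N /\ `|x.2.1.2|%N = (n' * d)%N), x.2.1.1 = t1 & x.2.1.2 = t2]) r.
    apply: (@card_le_inj R _ (nat * nat)%type (fun x => x.1.1)).
      move=> [[[y1 y2] y] [[s1 s2] s3]] [[[x1 x2] x] [[r1 r2] r3]].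
      move=> [[Px _] /= Ex1 Ex2] [[Py _] /= Ey1 Ey2] [Z1 Z2].
      have [/= yE _ _ _ _] := facts _ _ Px; have [/= xE _ _ _ _] := facts _ _ Py.
      have [[[_ _ _ /= e1 _] _] _] := Px; have [[[_ _ _ /= e2 _] _] _] := Py.
      move: e1 e2; rewrite Ex1 Ex2 Ey1 Ey2 yE xE -Z1 -Z2 => e1 e2.
      have e3 : u3%:Z * s3 * y3%:Z ^+ 2 = u3%:Z * r3 * y3%:Z ^+ 2.
        by apply: (addrI (u1%:Z * t1 * y1%:Z ^+ 2 + u2%:Z * t2 * y2%:Z ^+ 2)); rewrite e1 e2.
      have u3Z : u3%:Z != 0 by rewrite eqz_nat -lt0n.
      have y3Z : y3%:Z ^+ 2 != 0 by rewrite expf_eq0 /= eqz_nat -lt0n.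
      by move: e3 => /(mulIf y3Z)/(mulfI u3Z) ->.
    by move=> [y t] [[Px _] /= <- <-]; have [_ _ _ cp _] := facts _ _ Px.
  apply: sub.
  set x1 : R := D1%:R * `|t1|%N%:R; set x2 : R := D2%:R * `|t2|%N%:R.
  have x10 : 0 < x1 by rewrite mulr_gt0 // ltr0n absz_gt0.
  have x20 : 0 < x2 by rewrite mulr_gt0 // ltr0n absz_gt0.
  have s0 : 0 < Num.sqrt (x1 * x2) by rewrite sqrtr_gt0 mulr_gt0.
  have kE : k / Num.sqrt (m'%:R * n'%:R) =
      16 * (4 * a3) * d%:R * (Y1%:R * Y2%:R) / (Num.sqrt (x1 * x2) * q%:R).
    have -> : x1 * x2 = (D1%:R * D2%:R) * (m'%:R * n'%:R) * d%:R ^+ 2.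
      by rewrite /x1 /x2 t01 t02 !natrM; ring.
    rewrite [Num.sqrt (_ * d%:R ^+ 2)]sqrtrM ?mulr_ge0 ?ler0n // sqrtr_sqr gtr0_norm //.
    rewrite [Num.sqrt (_ * (m'%:R * _))]sqrtrM ?mulr_ge0 ?ler0n //.
    rewrite /k; field.
    by rewrite !gt_eqF // sqrtr_gt0 mulr_gt0.
  (* Either coordinate may lead in the pair count. Leading with the larger of [x1], [x2] does at
     least as well as their geometric mean, and the geometric mean separates the sums over the two
     multipliers of [d]. *)
  have mono (e : R) : Num.sqrt (x1 * x2) <= e ->
     tau * (1 + 16 * (4 * a3) * d%:R * (Y1%:R * Y2%:R) / (e * q%:R)) <=
     tau * (1 + k / Num.sqrt (m'%:R * n'%:R)).
    move=> se; rewrite ler_wpM2l // lerD2l kE ler_wpM2l ?mulr_ge0 ?ler0n //.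
    rewrite lef_pV2 ?posrE ?mulr_gt0 ?ler_wpM2r ?ler0n //.
    exact: lt_le_trans se.
  have [x12|x21] := leP x1 x2.
    apply: card_le_mono (mono x2 _); last first.
      have h : x1 * x2 <= x2 ^+ 2 by rewrite expr2 ler_wpM2r // ltW.
      by apply: le_trans (ler_wsqrtr h) _; rewrite sqrtr_sqr gtr0_norm.
    have := @conic_pair_le R q u2 u1 t2 t1 Y2 Y1 (4 * a3) q0 u20 Y20 Y10 t2n _ cu2.
    rewrite g2 -/tau => /(_ (mulr_ge0 (ler0n _ _) a30)) H.
    apply: (@card_le_inj R _ _ (fun y : nat * nat => (y.2, y.1)) _ (conic_pair q u2 u1 t2 t1 Y2 Y1 (4 * a3))).
    - by move=> [? ?] [? ?] _ _ /= [-> ->].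
    - move=> [y1 y2] [/= h1 h2 /and3P[h3 h4 h5] h6 h7].
      split=> //=; [|by rewrite addrC..].
      by rewrite coprime_sym h3 h4 h5.
    apply: card_le_mono H _; rewrite ler_wpM2l // lerD2l le_eqVlt; apply/orP; left; apply/eqP.
    rewrite /x2 /D2 natrM natrX; field.
    by rewrite !gt_eqF // ltr0n absz_gt0.
  apply: card_le_mono (mono x1 _); last first.
    have h : x1 * x2 <= x1 ^+ 2 by rewrite expr2 ler_wpM2l // ltW.
    by apply: le_trans (ler_wsqrtr h) _; rewrite sqrtr_sqr gtr0_norm.
  have := @conic_pair_le R q u1 u2 t1 t2 Y1 Y2 (4 * a3) q0 u10 Y10 Y20 t1n _ cu1.
  rewrite g1 -/tau => /(_ (mulr_ge0 (ler0n _ _) a30)) H.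
  apply: card_le_mono H _; rewrite ler_wpM2l // lerD2l le_eqVlt; apply/orP; left; apply/eqP.
  rewrite /x1 /D1 natrM natrX; field.
  by rewrite !gt_eqF // ltr0n absz_gt0.
move=> H; apply: card_le_mono H _.
under eq_bigr => x _ do rewrite mulrA.
rewrite -mulr_sumr ler_wpM2l ?mulr_ge0 // sum_inv_sqrt2_le //.
Qed.

(** * Averages of divisor functions *)

Lemma sum_sub_le (R : realType) (T : eqType) (l1 l2 : seq T) (F : T -> R) :
  uniq l1 -> {subset l1 <= l2} -> (forall i, 0 <= F i) ->
  \sum_(i <- l1) F i <= \sum_(i <- l2) F i.
Proof.
move=> u1 + F0; elim: l1 l2 u1 => [|x l IH] l2 /=.
  by move=> _ _; rewrite big_nil; apply: sumr_ge0.
move=> /andP[xl ul] sub; have xl2 : x \in l2 by apply: sub; exact: mem_head.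
rewrite big_cons (perm_big _ (perm_to_rem xl2)) big_cons lerD2l; apply: IH => // y yl.
have yl2 : y \in l2 by apply: sub; rewrite inE yl orbT.
move: yl2; rewrite (perm_mem (perm_to_rem xl2)) inE => /orP[/eqP yx|//].
by rewrite -yx yl in xl.
Qed.

Definition harm (R : realType) (n : nat) : R := \sum_(i <- iota 1 n) i%:R^-1.

Lemma harm_ge0 (R : realType) n : 0 <= harm R n.
Proof. by apply: sumr_ge0 => i _; rewrite invr_ge0. Qed.

Lemma sum_multiples_le (R : realType) (e n : nat) (F : nat -> R) : (0 < e)%N ->
  (forall i, 0 <= F i) ->
  \sum_(d <- iota 1 n | (e %| d)%N) F d <= \sum_(m <- iota 1 n) F (e * m)%N.
Proof.
move=> e0 F0; rewrite -[leLHS]big_filter -[leRHS](big_map (muln e) xpredT F).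
apply: sum_sub_le => //; first by rewrite filter_uniq // iota_uniq.
move=> d; rewrite mem_filter mem_iota => /andP[/dvdnP[m ->] hm].
rewrite mulnC map_f // mem_iota.
have : (m <= m * e)%N by rewrite leq_pmulr.
have : (0 < m)%N by case: m hm => //; lia.
lia.
Qed.

Lemma sum_divisors (R : realType) (q n : nat) (F : nat -> R) :
  (0 < q <= n)%N ->
  \sum_(d <- divisors q) F d = \sum_(d <- iota 1 n | (d %| q)%N) F d.
Proof.
move=> /andP[q0 qn]; rewrite -[RHS]big_filter; apply: perm_big; apply: uniq_perm.
- exact: divisors_uniq.
- by rewrite filter_uniq // iota_uniq.
move=> d; rewrite -dvdn_divisors // mem_filter mem_iota add1n ltnS.
case dq : (d %| q)%N => //=.
by rewrite (dvdn_gt0 q0 dq) (leq_trans (dvdn_leq q0 dq) qn).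
Qed.

Lemma size_divisors (R : realType) (q : nat) :
  (size (divisors q))%:R = \sum_(d <- divisors q) 1 :> R.
Proof. by rewrite sumr_const_seq mulr1. Qed.

Lemma sum_inv_divisors_le (R : realType) (q n : nat) : (0 < q <= n)%N ->
  \sum_(d <- divisors q) d%:R^-1 <= harm R n.
Proof.
move=> qn; rewrite (sum_divisors _ qn) big_mkcond /=; apply: ler_sum => i _.
by case: ifP; rewrite // invr_ge0.
Qed.

(** A divisor [e] of [m n] is determined by [gcdn e m] and its cofactor, which divides [n]. *)
Lemma size_divisorsM (m n : nat) : (0 < m)%N -> (0 < n)%N ->
  (size (divisors (m * n)) <= size (divisors m) * size (divisors n))%N.
Proof.
move=> m0 n0; have mn0 : (0 < m * n)%N by rewrite muln_gt0 m0.
pose f (e : nat) := (gcdn e m, e %/ gcdn e m)%N.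
have e0 e : e \in divisors (m * n) -> (0 < e)%N.
  by rewrite -dvdn_divisors //; exact: dvdn_gt0.
rewrite -(size_map f) -(size_allpairs pair); apply: uniq_leq_size.
  rewrite map_inj_in_uniq ?divisors_uniq // => x y xD yD [E1 E2].
  by rewrite -(divnK (dvdn_gcdl x m)) E2 E1 divnK // dvdn_gcdl.
move=> _ /mapP[e eD ->].
apply/allpairsP; exists (f e); split=> //=; rewrite -dvdn_divisors // ?dvdn_gcdr //.
have := e0 _ eD; move: eD; rewrite -dvdn_divisors // => eD e0'.
by apply: dvdn_gauss_cofactor.
Qed.

(** A divisor [e] of [y^2] is determined by [gcdn e y] and its cofactor. The cofactor divides [y] as
    well as [e], hence divides the gcd. *)
Lemma size_divisors_sqr (y : nat) : (0 < y)%N ->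
  (size (divisors (y ^ 2)) <= \sum_(d <- divisors y) size (divisors d))%N.
Proof.
move=> y0; have y20 : (0 < y ^ 2)%N by rewrite expn_gt0 y0.
pose f (e : nat) := (gcdn e y, e %/ gcdn e y)%N.
have -> : (\sum_(d <- divisors y) size (divisors d))%N =
    size [seq (d, e) | d <- divisors y, e <- divisors d].
  by rewrite size_allpairs_dep sumnE big_map.
rewrite -(size_map f); apply: uniq_leq_size.
  rewrite map_inj_in_uniq ?divisors_uniq // => x z xD zD [E1 E2].
  by rewrite -(divnK (dvdn_gcdl x y)) E2 E1 divnK // dvdn_gcdl.
move=> _ /mapP[e eD ->]; move: eD; rewrite -dvdn_divisors // => eD.
have e0 : (0 < e)%N by exact: dvdn_gt0 eD.
have g0 : (0 < gcdn e y)%N by rewrite gcdn_gt0 e0.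
apply/allpairsPdep; exists (gcdn e y), (e %/ gcdn e y)%N; split=> //.
  by rewrite -dvdn_divisors // dvdn_gcdr.
rewrite -dvdn_divisors //.
have h1 : (e %/ gcdn e y %| y)%N.
  by apply: dvdn_gauss_cofactor => //; rewrite mulnn.
have h2 : (e %/ gcdn e y %| e)%N by rewrite dvdn_div // dvdn_gcdl.
by rewrite dvdn_gcd h1 h2.
Qed.

Lemma sum_div_le (R : realType) (n : nat) (F : nat -> R) : (forall i, 0 <= F i) ->
  \sum_(d <- iota 1 n) (size (divisors d))%:R * F d <=
  \sum_(e <- iota 1 n) \sum_(m <- iota 1 n) F (e * m)%N.
Proof.
move=> F0.
have -> : \sum_(d <- iota 1 n) (size (divisors d))%:R * F d =
   \sum_(d <- iota 1 n) \sum_(e <- iota 1 n | (e %| d)%N) F d.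
  rewrite big_seq [RHS]big_seq; apply: eq_bigr => d; rewrite mem_iota add1n ltnS => dn.
  by rewrite size_divisors -(sum_divisors (fun=> F d) dn) mulr_suml; apply: eq_bigr => ? _; rewrite mul1r.
rewrite (exchange_big_dep xpredT) //= big_seq [leRHS]big_seq.
apply: ler_sum => e; rewrite mem_iota => /andP[e0 _].
exact: sum_multiples_le.
Qed.

Lemma card_multiples_le (R : realType) (d Y : nat) : (0 < d)%N -> (0 < Y)%N ->
  \sum_(y <- iota Y Y | (d %| y)%N) 1 <= 2 * Y%:R / d%:R :> R.
Proof.
move=> d0 Y0; rewrite -big_filter sumr_const_seq mulr1.
rewrite ler_pdivlMr ?ltr0n // -!natrM ler_nat.
apply: leq_trans (leq_trunc_div (2 * Y) d); rewrite leq_mul2r; apply/orP; right.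
rewrite -[leqRHS](size_iota 1) -[leqRHS](size_map (muln d)).
apply: uniq_leq_size; first by rewrite filter_uniq // iota_uniq.
move=> y; rewrite mem_filter mem_iota => /andP[/dvdnP[m ->] hm].
rewrite mulnC map_f // mem_iota add1n ltnS leq_divRL //.
by case: m hm => [|m]; lia.
Qed.

(** One factor [harm] bounds the sum of inverse divisors pointwise. For the divisor count,
    [size_divisors_sqr] passes to a sum over [d] dividing [y], and averaging over [y] leaves the sum
    of [tau d / d], at most two more harmonic factors. A pointwise bound on the number of divisors
    would cost more than logarithms. *)
Lemma sum_tau_sigma_le (R : realType) (u Y n : nat) :
  (0 < u)%N -> (0 < Y)%N -> (4 * (u * Y ^ 2) <= n)%N ->
  \sum_(y <- iota Y Y) (size (divisors (u * y ^ 2)))%:R *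
       (\sum_(d <- divisors (u * y ^ 2)) d%:R^-1) <=
  (size (divisors u))%:R * (2 * Y%:R * harm R n ^+ 3) :> R.
Proof.
move=> u0 Y0 hn.
pose H := harm R n; have H0 : 0 <= H by exact: harm_ge0.
pose tau (m : nat) : R := (size (divisors m))%:R.
have tau0 m : 0 <= tau m by exact: ler0n.
apply: (@le_trans _ _ (\sum_(y <- iota Y Y) tau u * H *
    \sum_(d <- iota 1 n | (d %| y)%N) tau d)).
  rewrite big_seq [leRHS]big_seq; apply: ler_sum => y; rewrite mem_iota => hy.
  have y0 : (0 < y)%N by lia.
  have q0 : (0 < u * y ^ 2)%N by rewrite muln_gt0 u0 expn_gt0 y0.
  have y2 : (y ^ 2 <= 4 * Y ^ 2)%N.
    by rewrite -[4%N]/(2 ^ 2)%N -expnMn leq_exp2r //; lia.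
  have qn : (u * y ^ 2 <= n)%N.
    by apply: leq_trans hn; rewrite mulnCA leq_mul2l y2 orbT.
  have yn : (y <= n)%N.
    apply: leq_trans qn; apply: (@leq_trans (y ^ 2)); last by rewrite leq_pmull.
    by rewrite -mulnn leq_pmull.
  rewrite mulrAC; apply: ler_pM; rewrite ?ler0n //.
  - by apply: sumr_ge0 => i _; rewrite invr_ge0.
  - apply: (@le_trans _ _ (tau u * tau (y ^ 2)%N)).
      by rewrite -natrM ler_nat size_divisorsM // expn_gt0 y0.
    rewrite ler_wpM2l // -(sum_divisors tau (n := n)) ?y0 // -natr_sum ler_nat.
    exact: size_divisors_sqr.
  - by apply: sum_inv_divisors_le; rewrite q0.
rewrite -mulr_sumr (exchange_big_dep xpredT) //=.
have -> : tau u * (2 * Y%:R * harm R n ^+ 3) = tau u * H * (2 * Y%:R * H ^+ 2).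
  by rewrite /H; ring.
rewrite ler_wpM2l ?mulr_ge0 //.
apply: (@le_trans _ _ (\sum_(d <- iota 1 n) 2 * Y%:R * (tau d * d%:R^-1))).
  rewrite big_seq [leRHS]big_seq; apply: ler_sum => d; rewrite mem_iota => /andP[d0 _].
  have -> : \sum_(y <- iota Y Y | (d %| y)%N) tau d =
     (\sum_(y <- iota Y Y | (d %| y)%N) 1) * tau d.
    by rewrite mulr_suml; apply: eq_bigr => ? _; rewrite mul1r.
  have -> : 2 * Y%:R * (tau d * d%:R^-1) = (2 * Y%:R / d%:R) * tau d.
    by rewrite mulrA mulrAC.
  by rewrite ler_wpM2r // card_multiples_le.
rewrite -mulr_sumr ler_wpM2l ?mulr_ge0 ?ler0n //.
apply: le_trans (@sum_div_le R n (fun d => d%:R^-1) _) _.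
  by move=> i; rewrite invr_ge0.
rewrite expr2 /H /harm mulr_suml le_eqVlt; apply/orP; left; apply/eqP.
apply: eq_bigr => e _; rewrite mulr_sumr; apply: eq_bigr => m _.
by rewrite natrM invfM.
Qed.

Lemma sum_inv_pow32_le (R : realType) (n : nat) :
  \sum_(i <- iota 1 n) (i%:R * Num.sqrt i%:R)^-1 <= 3 :> R.
Proof.
case: n => [|n]; first by rewrite big_nil.
(* The sum is compared with the telescoping differences of [2 / sqrt n]. *)
apply: (@le_trans _ _ (3 - 2 / Num.sqrt n.+1%:R)); last first.
  by rewrite lerBlDr lerDl divr_ge0 ?sqrtr_ge0.
elim: n => [|n IH].
  by rewrite /= big_seq1 sqrtr1 mulr1 invr1; lra.
have -> : iota 1 n.+2 = iota 1 n.+1 ++ [:: n.+2].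
  by have := iotaD 1 n.+1 1; rewrite addn1 add1n.
rewrite big_cat big_seq1; apply: le_trans (lerD IH (lexx _)) _.
set a := Num.sqrt n.+1%:R; set b := Num.sqrt n.+2%:R.
have a0 : 0 < a by rewrite sqrtr_gt0 ltr0n.
have b0 : 0 < b by rewrite sqrtr_gt0 ltr0n.
have a2 : a * a = n.+1%:R by rewrite -expr2 sqr_sqrtr.
have b2 : b * b = n.+2%:R by rewrite -expr2 sqr_sqrtr.
have ab : b * b = a * a + 1 by rewrite a2 b2 -natr1.
have le : a <= b by rewrite ler_wsqrtr // ler_nat.
rewrite -b2.
have : (b * b * b)^-1 <= 2 * (b - a) / (a * b).
  rewrite ler_pdivlMr ?mulr_gt0 // mulrC ler_pdivrMr ?mulr_gt0 //.
  have E : (b - a) * (b + a) = 1 by rewrite mulrBl !mulrDr (mulrC b a); lra.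
  have h1 : 1 <= (b - a) * (2 * b).
    by rewrite -[leLHS]E; apply: ler_wpM2l; lra.
  have h2 : a * b <= b * b by rewrite ler_wpM2r // ltW.
  have -> : 2 * (b - a) * (b * b * b) = ((b - a) * (2 * b)) * (b * b) by ring.
  have := ler_pM ler01 (mulr_ge0 (ltW a0) (ltW b0)) h1 h2; by rewrite mul1r.
have -> : 2 * (b - a) / (a * b) = 2 / a - 2 / b by field; rewrite !gt_eqF.
by move=> h; lra.
Qed.

Lemma sum_tau_pow32_le (R : realType) (n : nat) :
  \sum_(i <- iota 1 n) (size (divisors i))%:R * (i%:R * Num.sqrt i%:R)^-1 <= 9 :> R.
Proof.
apply: le_trans (@sum_div_le R n (fun d => (d%:R * Num.sqrt d%:R)^-1) _) _.
  by move=> i; rewrite invr_ge0 mulr_ge0 ?sqrtr_ge0.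
have -> : \sum_(e <- iota 1 n) \sum_(m <- iota 1 n) ((e * m)%N%:R * Num.sqrt (e * m)%N%:R)^-1 =
  (\sum_(i <- iota 1 n) (i%:R * Num.sqrt i%:R)^-1) * (\sum_(i <- iota 1 n) (i%:R * Num.sqrt i%:R)^-1) :> R.
  rewrite mulr_suml; apply: eq_bigr => e _; rewrite mulr_sumr; apply: eq_bigr => m _.
  by rewrite natrM sqrtrM ?ler0n // -invfM; congr (_^-1); ring.
have s0 : 0 <= \sum_(i <- iota 1 n) (i%:R * Num.sqrt i%:R)^-1 :> R.
  by apply: sumr_ge0 => i _; rewrite invr_ge0 mulr_ge0 ?sqrtr_ge0.
have s3 := @sum_inv_pow32_le R n.
by have := ler_pM s0 s0 s3 s3; lra.
Qed.

(** * Points of a plane lattice in a box *)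

(** As [v] has content 1, [w1] is up to sign the gcd of its products with the entries of [v], and by
    proportionality [v1] divides each of these. *)
Lemma dvdn_parallel (v1 v2 v3 w1 w2 w3 : int) :
  gcdn (gcdn `|v1| `|v2|) `|v3| = 1%N ->
  v1 * w2 = v2 * w1 -> v1 * w3 = v3 * w1 -> (`|v1| %| `|w1|)%N.
Proof.
move=> g1 E2 E3; rewrite -[ `|w1|%N]muln1 -g1 !muln_gcdr !dvdn_gcd.
rewrite dvdn_mull //= -!abszM (mulrC w1 v2) (mulrC w1 v3) -E2 -E3.
by rewrite !abszM !dvdn_mulr.
Qed.

Lemma eq_divz_small (x y v : int) : v != 0 -> (x %/ `|v|)%Z = (y %/ `|v|)%Z ->
  (`|v| %| `|(x - y)%R|)%N -> x = y.
Proof.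
move=> v0 E; have v0' : `|v| != 0 by rewrite normr_eq0.
have := divz_eq x `|v|; have := divz_eq y `|v|; rewrite E.
have := modz_ge0 x v0'; have := modz_ge0 y v0'.
have := ltz_mod x v0'; have := ltz_mod y v0'; rewrite normr_id.
move: (x %% `|v|)%Z (y %% `|v|)%Z (y %/ `|v|)%Z => a b c yv xv b0 a0 yE xE dv.
apply/eqP; rewrite -subr_eq0; apply: contraTT dv => d0.
rewrite gtnNdvd ?absz_gt0 //.
have : `|x - y| < `|v| by rewrite xE yE ltr_norml; lra.
by rewrite -!abszE ltz_nat.
Qed.

Definition in_plane (d1 d2 d3 : nat) (x : int * int * int) : Prop :=
  d1%:Z * x.1.1 + d2%:Z * x.1.2 + d3%:Z * x.2 = 0.

(** The lattice is cut into lines parallel to [v]. The index [jj] of a line is a determinant divided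
    by [d1], and it is at most [2 M / 2^l] because [v] is short. On a line the points differ by
    multiples of [v], and the coordinate in which [v] does not fit at scale [2^(l+1)] leaves at most
    [4 * 2^l + 1] places. The bound is the product with [4 M / 2^l + 1], simplified. *)
Lemma plane_lattice_le (R : realType) (d1 d2 d3 : nat) (Z1 Z2 Z3 M : R)
    (v : int * int * int) (l : nat) :
  (0 < d1)%N -> coprime d1 d2 -> coprime d1 d3 -> 0 <= Z1 -> 0 <= Z2 -> 0 <= Z3 -> 0 <= M ->
  Z2 * Z3 <= M * d1%:R ->
  in_plane d1 d2 d3 v -> gcdn (gcdn `|v.1.1| `|v.1.2|) `|v.2| = 1%N ->
  [/\ `|v.1.1|%N%:R * 2 ^+ l <= Z1, `|v.1.2|%N%:R * 2 ^+ l <= Z2 & `|v.2|%N%:R * 2 ^+ l <= Z3] ->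
  ~ [/\ `|v.1.1|%N%:R * 2 ^+ l.+1 <= Z1, `|v.1.2|%N%:R * 2 ^+ l.+1 <= Z2 &
        `|v.2|%N%:R * 2 ^+ l.+1 <= Z3] ->
  card_le (fun x => in_plane d1 d2 d3 x /\
      [/\ `|x.1.1|%N%:R <= Z1, `|x.1.2|%N%:R <= Z2 & `|x.2|%N%:R <= Z3])
    (20 * M + 5 * 2 ^+ l).
Proof.
case: v => -[v1 v2] v3 /= d10 c12 c13 Z10 Z20 Z30 M0 ZM vP vg [h1 h2 h3] nh.
rewrite /in_plane /= in vP.
have p0 : (0 : R) < 2 ^+ l by rewrite exprn_gt0.
have p1 : (1 : R) <= 2 ^+ l by rewrite exprn_ege1 // ler1n.
pose jj (x : int * int * int) := ((v2 * x.2 - v3 * x.1.2) %/ d1%:Z)%Z.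
have d1Z : d1%:Z != 0 by rewrite eqz_nat -lt0n.
have jE x : in_plane d1 d2 d3 x -> v2 * x.2 - v3 * x.1.2 = jj x * d1%:Z.
  move=> xP; rewrite /jj divzK //.
  have : (d1%:Z %| d2%:Z * (v2 * x.2 - v3 * x.1.2))%Z.
    have -> : d2%:Z * (v2 * x.2 - v3 * x.1.2) = d1%:Z * (v3 * x.1.1 - v1 * x.2).
      rewrite /in_plane in xP.
      have e1 : d2%:Z * v2 = - (d1%:Z * v1 + d3%:Z * v3) by lra.
      have e2 : d2%:Z * x.1.2 = - (d1%:Z * x.1.1 + d3%:Z * x.2) by lra.
      have -> : d2%:Z * (v2 * x.2 - v3 * x.1.2) = (d2%:Z * v2) * x.2 - v3 * (d2%:Z * x.1.2) by ring.
      by rewrite e1 e2; ring.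
    exact: dvdz_mulr.
  by rewrite !dvdzE abszM /= Gauss_dvdr.
have jbound x : in_plane d1 d2 d3 x -> `|x.1.2|%N%:R <= Z2 -> `|x.2|%N%:R <= Z3 ->
    `|jj x|%N%:R <= 2 * M / 2 ^+ l.
  move=> xP x2 x3; rewrite ler_pdivlMr // -(ler_pM2r (_ : (0 : R) < d1%:R)) ?ltr0n //.
  have -> : `|jj x|%N%:R * 2 ^+ l * d1%:R = `|(v2 * x.2 - v3 * x.1.2)%R|%N%:R * 2 ^+ l :> R.
    by rewrite jE // abszM natrM absz_nat mulrAC.
  have hh : (`|(v2 * x.2 - v3 * x.1.2)%R| <= `|v2| * `|x.2| + `|v3| * `|x.1.2|)%N.
    rewrite -lez_nat PoszD !PoszM !abszE -!normrM; exact: ler_normB.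
  rewrite -(ler_nat R) natrD !natrM in hh.
  apply: (@le_trans _ _ ((`|v2|%N%:R * `|x.2|%N%:R + `|v3|%N%:R * `|x.1.2|%N%:R) * 2 ^+ l)).
    by rewrite ler_wpM2r // ltW.
  have k1 : (`|v2|%N%:R * 2 ^+ l) * `|x.2|%N%:R <= Z2 * Z3.
    by apply: ler_pM => //; rewrite mulr_ge0 ?ler0n // ltW.
  have k2 : (`|v3|%N%:R * 2 ^+ l) * `|x.1.2|%N%:R <= Z3 * Z2.
    by apply: ler_pM => //; rewrite mulr_ge0 ?ler0n // ltW.
  lra.
have sing x y : in_plane d1 d2 d3 x -> in_plane d1 d2 d3 y -> jj x = jj y ->
   [/\ v2 * (x.2 - y.2) = v3 * (x.1.2 - y.1.2), v1 * (x.2 - y.2) = v3 * (x.1.1 - y.1.1) &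
       v1 * (x.1.2 - y.1.2) = v2 * (x.1.1 - y.1.1)].
  move=> xP yP jxy; have e1 := jE _ xP; have e2 := jE _ yP; rewrite -jxy in e2.
  rewrite /in_plane in xP yP.
  have E1 : v2 * (x.2 - y.2) = v3 * (x.1.2 - y.1.2) by rewrite !mulrBr; lra.
  have : d1%:Z * (x.1.1 - y.1.1) + d2%:Z * (x.1.2 - y.1.2) + d3%:Z * (x.2 - y.2) = 0.
    by rewrite !mulrBr; lra.
  move: (x.1.1 - y.1.1) (x.1.2 - y.1.2) (x.2 - y.2) E1 => a b c E1 abc.
  split=> //; apply: (mulfI d1Z).
    have e3 : d1%:Z * v1 = - (d2%:Z * v2 + d3%:Z * v3) by lra.
    have e4 : d1%:Z * a = - (d2%:Z * b + d3%:Z * c) by lra.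
    have -> : d1%:Z * (v1 * c) = (d1%:Z * v1) * c by ring.
    have -> : d1%:Z * (v3 * a) = v3 * (d1%:Z * a) by ring.
    rewrite e3 e4; have -> : - (d2%:Z * v2 + d3%:Z * v3) * c = - (d2%:Z * (v2 * c) + d3%:Z * v3 * c) by ring.
    by rewrite E1; ring.
  have e3 : d1%:Z * v1 = - (d2%:Z * v2 + d3%:Z * v3) by lra.
  have e4 : d1%:Z * a = - (d2%:Z * b + d3%:Z * c) by lra.
  have -> : d1%:Z * (v1 * b) = (d1%:Z * v1) * b by ring.
  have -> : d1%:Z * (v2 * a) = v2 * (d1%:Z * a) by ring.
  rewrite e3 e4; have -> : v2 * - (d2%:Z * b + d3%:Z * c) = - (d2%:Z * v2 * b + d3%:Z * (v2 * c)) by ring.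
  by rewrite E1; ring.
(* [sel] is the coordinate in which scale [2^(l+1)] leaves the box, [vs] the matching entry of [v].
   A point is encoded by its line and by the quotient of that coordinate by [vs]. *)
have main (sel : int * int * int -> int) (vs : int) (Z : R) :
    Z < `|vs|%N%:R * 2 ^+ l.+1 -> 0 <= Z ->
    (forall x y, in_plane d1 d2 d3 x -> in_plane d1 d2 d3 y -> jj x = jj y ->
       (`|vs| %| `|(sel x - sel y)%R|)%N) ->
    (forall x y, in_plane d1 d2 d3 x -> in_plane d1 d2 d3 y -> jj x = jj y -> sel x = sel y -> x = y) ->
  card_le (fun x => [/\ in_plane d1 d2 d3 x, `|sel x|%N%:R <= Z, `|x.1.2|%N%:R <= Z2 & `|x.2|%N%:R <= Z3])
    (20 * M + 5 * 2 ^+ l).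
  move=> Zv Z0 dv inj.
  have vs0 : vs != 0.
    by apply: contraTneq Zv => ->; rewrite mul0r -leNgt.
  have vsR : (0 : R) < `|vs|%N%:R by rewrite ltr0n absz_gt0.
  pose qq (x : int * int * int) := (sel x %/ `|vs|)%Z.
  apply: (@card_le_mono _ _ _ ((2 * (2 * M / 2 ^+ l) + 1) * (2 * 2 ^+ l.+1 + 1))); last first.
    have E : M / 2 ^+ l * 2 ^+ l = M by rewrite divfK // gt_eqF.
    have M' : 0 <= M / 2 ^+ l by rewrite divr_ge0 // ltW.
    have e1 : M / 2 ^+ l <= M by rewrite ler_pdivrMr // ler_peMr.
    rewrite -mulrA exprS; move: (M / 2 ^+ l) E M' e1 => m E M' e1.
    have -> : (2 * (2 * m) + 1) * (2 * (2 * 2 ^+ l) + 1) = 16 * (m * 2 ^+ l) + 4 * m + 4 * 2 ^+ l + 1 :> R by ring.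
    by rewrite E; lra.
  apply: (@card_le_inj R _ (int * int)%type (fun x => (jj x, qq x)) _
     (fun z => `|z.1|%N%:R <= 2 * M / 2 ^+ l /\ `|z.2|%N%:R <= (2 : R) ^+ l.+1)).
  - move=> x y [xP _ _ _] [yP _ _ _] [jxy qxy]; apply: inj => //.
    by apply: eq_divz_small vs0 qxy _; exact: dv.
  - move=> x [xP xs x2 x3] /=; split; first exact: jbound.
    have lt : `|sel x|%N%:R < `|vs|%N%:R * 2 ^+ l.+1 :> R by exact: le_lt_trans Zv.
    have {lt} : (`|sel x| < `|vs| * 2 ^ l.+1)%N by rewrite -(ltr_nat R) natrM natrX.
    rewrite -natrX ler_nat /qq.
    have v0' : `|vs| != 0 by rewrite normr_eq0.
    have := divz_eq (sel x) `|vs|; have := modz_ge0 (sel x) v0'; have := ltz_mod (sel x) v0'.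
    rewrite normr_id -abszE.
    move: (sel x %% _)%Z (sel x %/ _)%Z => r k r1 r0 E lt.
    rewrite leqNgt; apply/negP => kb.
    have vp : (0 < `|vs|)%N by rewrite absz_gt0.
    have : (`|vs| * (2 ^ l.+1).+1 <= `|k| * `|vs|)%N by rewrite mulnC leq_mul2r kb orbT.
    have : (`|k| * `|vs| <= `|sel x| + `|r|)%N.
      rewrite -{1}[ `|vs|%N]absz_nat -abszM -lez_nat PoszD !abszE.
      have -> : k * `|vs|%N%:Z = sel x - r by lra.
      exact: ler_normB.
    have : (`|r| < `|vs|)%N by rewrite -ltz_nat [ `|r|%N%:Z]abszE ger0_norm.
    rewrite mulnS; move: lt; move: (`|vs| * 2 ^ l.+1)%N (`|k| * `|vs|)%N => a b.
    by clear; lia.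
  have := card_le_prod (card_le_absz (_ : 0 <= 2 * M / 2 ^+ l)) (card_le_absz (_ : 0 <= (2 : R) ^+ l.+1)).
  apply; first by rewrite divr_ge0 ?mulr_ge0 // ltW.
  by rewrite exprn_ge0.
have [n1|n1] := boolP (`|v1|%N%:R * 2 ^+ l.+1 <= Z1); last first.
  apply: card_le_sub (main (fun x => x.1.1) v1 Z1 _ Z10 _ _) (lexx _).
  - by move=> x [? [? ? ?]].
  - by rewrite ltNge n1.
  - move=> x y xP yP jxy; have [s1 s2 s3] := sing _ _ xP yP jxy.
    exact: (@dvdn_parallel v1 v2 v3 _ (x.1.2 - y.1.2) (x.2 - y.2)).
  move=> x y xP yP jxy sE; have [s1 s2 s3] := sing _ _ xP yP jxy.
  have v10 : v1 != 0.
    by apply: contraNneq n1 => ->; rewrite mul0r.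
  rewrite sE subrr !mulr0 in s2 s3.
  move: s2 s3 => /eqP; rewrite mulf_eq0 (negbTE v10) subr_eq0 => /eqP e3 /eqP.
  rewrite mulf_eq0 (negbTE v10) subr_eq0 => /eqP e2.
  by case: x y sE e2 e3 {xP yP jxy s1} => [[? ?] ?] [[? ?] ?] /= -> -> ->.
have [n2|n2] := boolP (`|v2|%N%:R * 2 ^+ l.+1 <= Z2); last first.
  apply: card_le_sub (main (fun x => x.1.2) v2 Z2 _ Z20 _ _) (lexx _).
  - by move=> x [? [? ? ?]].
  - by rewrite ltNge n2.
  - move=> x y xP yP jxy; have [s1 s2 s3] := sing _ _ xP yP jxy.
    apply: (@dvdn_parallel v2 v1 v3 _ (x.1.1 - y.1.1) (x.2 - y.2)) => //.
    by rewrite (gcdnC `|v2|%N).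
  move=> x y xP yP jxy sE; have [s1 s2 s3] := sing _ _ xP yP jxy.
  have v20 : v2 != 0.
    by apply: contraNneq n2 => ->; rewrite mul0r.
  rewrite sE subrr !mulr0 in s1 s3.
  move: s1 s3 => /eqP; rewrite mulf_eq0 (negbTE v20) subr_eq0 => /eqP e3 /esym/eqP.
  rewrite mulf_eq0 (negbTE v20) subr_eq0 => /eqP e2.
  by case: x y sE e2 e3 {xP yP jxy s2} => [[? ?] ?] [[? ?] ?] /= -> -> ->.
have n3 : Z3 < `|v3|%N%:R * 2 ^+ l.+1.
  by rewrite ltNge; apply/negP => n3; apply: nh.
apply: card_le_sub (main (fun x => x.2) v3 Z3 n3 Z30 _ _) (lexx _).
- by move=> x [? [? ? ?]].
- move=> x y xP yP jxy; have [s1 s2 s3] := sing _ _ xP yP jxy.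
  apply: (@dvdn_parallel v3 v1 v2 _ (x.1.1 - y.1.1) (x.1.2 - y.1.2)) => //.
  by rewrite -gcdnA gcdnC.
move=> x y xP yP jxy sE; have [s1 s2 s3] := sing _ _ xP yP jxy.
have v30 : v3 != 0.
  by apply: contraTneq n3 => ->; rewrite mul0r -leNgt.
rewrite sE subrr !mulr0 in s1 s2.
move: s1 s2 => /esym/eqP; rewrite mulf_eq0 (negbTE v30) subr_eq0 => /eqP e3 /esym/eqP.
rewrite mulf_eq0 (negbTE v30) subr_eq0 => /eqP e2.
by case: x y sE e2 e3 {xP yP jxy s3} => [[? ?] ?] [[? ?] ?] /= -> -> ->.
Qed.

(** The level [l] says that the vector still fits after [l] doublings; level 0 is the box itself. *)
Definition short_vec (R : realType) (d1 d2 d3 : nat) (Z1 Z2 Z3 : R) (l : nat)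
    (v : int * int * int) : Prop :=
  [/\ v <> (0, 0, 0), in_plane d1 d2 d3 v &
      [/\ `|v.1.1|%N%:R * 2 ^+ l <= Z1, `|v.1.2|%N%:R * 2 ^+ l <= Z2 &
          `|v.2|%N%:R * 2 ^+ l <= Z3]].

Lemma card_le_subsingleton (R : realType) (T : eqType) (P : T -> Prop) :
  (forall x y, P x -> P y -> x = y) -> card_le P (1 : R).
Proof.
move=> P1 [|x [|y s]] //= /andP[+ _] sP.
have -> : x = y by apply: P1; apply: sP; rewrite !inE eqxx ?orbT.
by rewrite mem_head.
Qed.

(* Differences of two solutions of the inhomogeneous equation solve the
   homogeneous one in the doubled box. *)
Lemma affine_plane_le (R : realType) (d1 d2 d3 : nat) (n : int) (Z1 Z2 Z3 r : R) :
  card_le (fun x => in_plane d1 d2 d3 x /\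
      [/\ `|x.1.1|%N%:R <= Z1, `|x.1.2|%N%:R <= Z2 & `|x.2|%N%:R <= Z3]) r ->
  card_le (fun x : int * int * int => d1%:Z * x.1.1 + d2%:Z * x.1.2 + d3%:Z * x.2 = n /\
      [/\ `|x.1.1|%N%:R <= Z1 / 2, `|x.1.2|%N%:R <= Z2 / 2 & `|x.2|%N%:R <= Z3 / 2]) r.
Proof.
move=> H s us sP; case: s us sP => [|x0 s0] us sP; first exact: card_le_ge0 H.
have P0 := sP _ (mem_head _ _); set s := x0 :: s0 in us sP *.
apply: (@card_le_inj R _ _ (fun x : int * int * int =>
  (x.1.1 - x0.1.1, x.1.2 - x0.1.2, x.2 - x0.2)) (fun x => x \in s) _ r _ _ H) => //.
  move=> [[? ?] ?] [[? ?] ?] _ _ /= [/addIr -> /addIr -> /addIr ->] //.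
move=> x /sP [xE [x1 x2 x3]]; have [x0E [y1 y2 y3]] := P0; split.
  by rewrite /in_plane /= !mulrBr; lra.
have tri (a b : int) (Z : R) : `|a|%N%:R <= Z / 2 -> `|b|%N%:R <= Z / 2 ->
    `|(a - b)%R|%N%:R <= Z.
  move=> ha hb; apply: (@le_trans _ _ (`|a|%N%:R + `|b|%N%:R)); last lra.
  rewrite -natrD ler_nat -lez_nat PoszD !abszE; exact: ler_normB.
by split; apply: tri.
Qed.

Lemma no_short_vec_le (R : realType) (d1 d2 d3 : nat) (n : int) (Z1 Z2 Z3 : R) :
  ~ (exists v, short_vec d1 d2 d3 Z1 Z2 Z3 0 v) ->
  card_le (fun x : int * int * int => d1%:Z * x.1.1 + d2%:Z * x.1.2 + d3%:Z * x.2 = n /\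
      [/\ `|x.1.1|%N%:R <= Z1 / 2, `|x.1.2|%N%:R <= Z2 / 2 & `|x.2|%N%:R <= Z3 / 2]) (1 : R).
Proof.
move=> nS; apply: affine_plane_le; apply: card_le_subsingleton.
have z x : in_plane d1 d2 d3 x /\
  [/\ `|x.1.1|%N%:R <= Z1, `|x.1.2|%N%:R <= Z2 & `|x.2|%N%:R <= Z3] -> x = (0, 0, 0).
  move=> [xP xZ]; apply: contrapT => x0; apply: nS; exists x; split=> //.
  by rewrite expr0 !mulr1.
by move=> x y /z -> /z ->.
Qed.

(** Division by the content makes the vector primitive and only shrinks it, so it still has level
    [l]; level [l + 1] is ruled out for every nonzero vector. *)
Lemma max_short_vec_le (R : realType) (d1 d2 d3 : nat) (n : int) (Z1 Z2 Z3 M : R) (l : nat) :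
  (0 < d1)%N -> coprime d1 d2 -> coprime d1 d3 -> 0 <= Z1 -> 0 <= Z2 -> 0 <= Z3 -> 0 <= M ->
  Z2 * Z3 <= M * d1%:R ->
  (exists v, short_vec d1 d2 d3 Z1 Z2 Z3 l v) ->
  ~ (exists v, short_vec d1 d2 d3 Z1 Z2 Z3 l.+1 v) ->
  card_le (fun x : int * int * int => d1%:Z * x.1.1 + d2%:Z * x.1.2 + d3%:Z * x.2 = n /\
      [/\ `|x.1.1|%N%:R <= Z1 / 2, `|x.1.2|%N%:R <= Z2 / 2 & `|x.2|%N%:R <= Z3 / 2])
   (20 * M + 5 * 2 ^+ l).
Proof.
move=> d10 c12 c13 Z10 Z20 Z30 M0 ZM [[[v1 v2] v3] [vn0 vP [/= h1 h2 h3]]] nS.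
apply: affine_plane_le.
pose g := gcdn (gcdn `|v1| `|v2|) `|v3|.
have g0 : (0 < g)%N.
  rewrite lt0n; apply/eqP => g0; apply: vn0.
  move: g0 => /eqP; rewrite -leqn0 leqNgt gcdn_gt0 gcdn_gt0 !absz_gt0 !negb_or !negbK.
  by move=> /andP[/andP[/eqP -> /eqP ->] /eqP ->].
have g1 : (g %| `|v1|)%N by rewrite (dvdn_trans (dvdn_gcdl _ _)) // dvdn_gcdl.
have g2 : (g %| `|v2|)%N by rewrite (dvdn_trans (dvdn_gcdl _ _)) // dvdn_gcdr.
have g3 : (g %| `|v3|)%N by rewrite dvdn_gcdr.
have gZ : g%:Z != 0 by rewrite eqz_nat -lt0n.
have [w1 e1] : exists w, v1 = w * g%:Z by exists (v1 %/ g%:Z)%Z; rewrite divzK ?dvdzE.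
have [w2 e2] : exists w, v2 = w * g%:Z by exists (v2 %/ g%:Z)%Z; rewrite divzK ?dvdzE.
have [w3 e3] : exists w, v3 = w * g%:Z by exists (v3 %/ g%:Z)%Z; rewrite divzK ?dvdzE.
have le w v : v = w * g%:Z -> (`|w|%N%:R : R) <= `|v|%N%:R.
  by move=> ->; rewrite abszM absz_nat ler_nat leq_pmulr.
have p0 k : (0 : R) <= 2 ^+ k by rewrite exprn_ge0.
have wP : in_plane d1 d2 d3 (w1, w2, w3).
  rewrite /in_plane /=; apply: (mulIf gZ); rewrite mul0r -[RHS]vP /=.
  by rewrite e1 e2 e3; ring.
apply: (@plane_lattice_le R d1 d2 d3 Z1 Z2 Z3 M (w1, w2, w3) l) => //=.
- apply/eqP; rewrite -(eqn_pmul2r g0) mul1n !muln_gcdl.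
  by rewrite -[in X in gcdn X _](absz_nat g) -[in X in gcdn _ X](absz_nat g) -!abszM -e1 -e2 -e3.
- split; [apply: le_trans h1|apply: le_trans h2|apply: le_trans h3];
    apply: ler_wpM2r => //; exact: le.
move=> h; apply: nS; exists (w1, w2, w3); split=> // -[z1 z2 z3].
by apply: vn0; rewrite e1 e2 e3 z1 z2 z3 !mul0r.
Qed.

Lemma sum_inv_pow2_gt (R : realType) (x : R) (n : nat) : 0 < x ->
  \sum_(l <- iota 0 n | x < 2 ^+ l) (2 ^+ l)^-1 <= 2 / x.
Proof.
move=> x0.
have p0 k : (0 : R) < 2 ^+ k by rewrite exprn_gt0.
(* The bound is strengthened by the tail [2 / 2^n] still to come, and is 0 until the first term
   enters. *)
apply: (@le_trans _ _ (if x < 2 ^+ n then 2 / x - 2 / 2 ^+ n else 0)); last first.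
  case: ifP => _; last by rewrite divr_ge0 // ltW.
  by rewrite lerBlDr lerDl divr_ge0 // ltW.
elim: n => [|n IH].
  rewrite big_nil expr0; case: ifP => // x1.
  by rewrite divr1 subr_ge0 ler_pdivlMr //; lra.
have -> : iota 0 n.+1 = iota 0 n ++ [:: n] by have := iotaD 0 n 1; rewrite addn1.
rewrite big_cat big_mkcond /= [X in _ + X]big_mkcond big_seq1 /=.
rewrite -big_mkcond; apply: le_trans (lerD IH (lexx _)) _.
have E : 2 / 2 ^+ n.+1 = (2 ^+ n)^-1 :> R.
  by rewrite exprS; field; rewrite gt_eqF.
rewrite E; case: ifP => xn.
  have -> : x < 2 ^+ n.+1 by apply: lt_trans xn _; rewrite exprS; have := p0 n; lra.
  by have := p0 n; rewrite -invr_gt0; lra.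
rewrite addr0; case: ifP => // xn1.
rewrite subr_ge0 ler_pdivlMr // ler_pdivrMl //.
by move: xn1; rewrite exprS; lra.
Qed.

(** * Torsor solutions in one cell *)

Definition cell (R : realType) (u1 u2 u3 Y1 Y2 Y3 : nat) (s : int) (A C : R)
    (x : (nat * nat * nat) * (int * int * int)) : Prop :=
  let: (y, t) := x in
  [/\ dyadic_box Y1 Y2 Y3 y, coprime_uy u1 u2 u3 y,
      u1%:Z * t.1.1 * y.1.1%:Z ^+ 2 + u2%:Z * t.1.2 * y.1.2%:Z ^+ 2 +
        u3%:Z * t.2 * y.2%:Z ^+ 2 = (u1 * u2 * u3 * (y.1.1 * y.1.2 * y.2))%N%:Z * s &
      [/\ `|t.1.1|%N%:R * (u1 * Y1 ^ 2)%N%:R <= A,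
          `|t.1.2|%N%:R * (u2 * Y2 ^ 2)%N%:R <= A &
          `|t.2|%N%:R * (u3 * Y3 ^ 2)%N%:R <= C]].

Lemma card_le_dyadic_box (R : realType) (Y1 Y2 Y3 : nat) :
  card_le (fun y => dyadic_box Y1 Y2 Y3 y) (Y1%:R * Y2%:R * Y3%:R : R).
Proof.
have H := card_le_prod (card_le_prod (@card_le_dyadic R Y1) (@card_le_dyadic R Y2))
  (@card_le_dyadic R Y3).
apply: (card_le_sub _ H (lexx _)).
by move=> [[y1 y2] y3] /and3P[].
Qed.

(** If [l] is the largest level of a short vector for [y], then [y] has at most [20 M + 5 * 2^l]
    companions [t]. While [2^l <= 2 M] this is the expected volume, giving [1 + 30 M]. For larger
    [l] the short vector has no zero entry, so [y] is a conic point of level [l]; such [y] number at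
    most [K / 4^l], and the sum over [l] is a geometric tail. *)
Lemma cell_le (R : realType) (u1 u2 u3 Y1 Y2 Y3 : nat) (s : int) (A C K : R) :
  (0 < u1)%N -> (0 < u2)%N -> (0 < u3)%N -> (0 < Y1)%N -> (0 < Y2)%N -> (0 < Y3)%N ->
  let D1 : R := (u1 * Y1 ^ 2)%N%:R in
  let D2 : R := (u2 * Y2 ^ 2)%N%:R in
  let D3 : R := (u3 * Y3 ^ 2)%N%:R in
  let M : R := 4 * A * C / (D1 * D2 * D3) in
  D1 <= A -> D2 <= A -> D3 <= C -> 0 <= K ->
  (forall l, card_le (conic_pt u1 u2 u3 Y1 Y2 Y3 (2 * A / 2 ^+ l) (2 * A / 2 ^+ l)
      (2 * C / 2 ^+ l)) (K / 4 ^+ l)) ->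
  card_le (cell u1 u2 u3 Y1 Y2 Y3 s A C)
    (Y1%:R * Y2%:R * Y3%:R * (1 + 30 * M) + 15 * K / M).
Proof.
move=> u10 u20 u30 Y10 Y20 Y30 D1 D2 D3 M D1A D2A D3C K0 HK.
have D10 : 0 < D1 by rewrite ltr0n muln_gt0 u10 expn_gt0 Y10.
have D20 : 0 < D2 by rewrite ltr0n muln_gt0 u20 expn_gt0 Y20.
have D30 : 0 < D3 by rewrite ltr0n muln_gt0 u30 expn_gt0 Y30.
have A0 : 0 < A by exact: lt_le_trans D1A.
have C0 : 0 < C by exact: lt_le_trans D3C.
have M0 : 0 < M by rewrite divr_gt0 ?mulr_gt0.
pose Z1 := 2 * A / D1; pose Z2 := 2 * A / D2; pose Z3 := 2 * C / D3.
have Z10 : 0 < Z1 by rewrite divr_gt0 ?mulr_gt0.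
have Z20 : 0 < Z2 by rewrite divr_gt0 ?mulr_gt0.
have Z30 : 0 < Z3 by rewrite divr_gt0 ?mulr_gt0.
have p0 k : (0 : R) < 2 ^+ k by rewrite exprn_gt0.
pose d1 (y : nat * nat * nat) := (u1 * y.1.1 ^ 2)%N.
pose d2 (y : nat * nat * nat) := (u2 * y.1.2 ^ 2)%N.
pose d3 (y : nat * nat * nat) := (u3 * y.2 ^ 2)%N.
pose S (y : nat * nat * nat) (l : nat) := exists v, short_vec (d1 y) (d2 y) (d3 y) Z1 Z2 Z3 l v.
pose good (y : nat * nat * nat) := dyadic_box Y1 Y2 Y3 y && coprime_uy u1 u2 u3 y.
have goodP y : good y -> [/\ D1 <= (d1 y)%:R, D2 <= (d2 y)%:R, D3 <= (d3 y)%:R & (0 < d1 y)%N /\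
   [/\ coprime (d1 y) (d2 y), coprime (d1 y) (d3 y) & coprime (d2 y) (d3 y)]].
  move=> /andP[/and3P[/andP[h1 _] /andP[h2 _] /andP[h3 _]] /and3P[c12 c13 c23]].
  have le (u Y z : nat) : (Y <= z)%N -> ((u * Y ^ 2)%N%:R : R) <= (u * z ^ 2)%N%:R.
    by move=> Yz; rewrite ler_nat leq_mul2l leq_exp2r // Yz orbT.
  have cc (u z u' z' : nat) : coprime (u * z) (u' * z') -> coprime (u * z ^ 2) (u' * z' ^ 2).
    by rewrite -!mulnn !coprimeMl !coprimeMr => /andP[/andP[-> ->] /andP[-> ->]].
  split; rewrite ?le //; split; last by split; apply: cc.
  by rewrite muln_gt0 u10 expn_gt0 (leq_trans Y10 h1).
have ZM y : good y -> Z2 * Z3 <= M * (d1 y)%:R.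
  move=> /goodP[h _ _ _]; apply: le_trans (ler_wpM2l (ltW M0) h).
  rewrite le_eqVlt; apply/orP; left; apply/eqP.
  have E (a c x z w : R) : 0 < x -> 0 < z -> 0 < w ->
      (2 * a / z) * (2 * c / w) = 4 * a * c / (x * z * w) * x.
    by move=> x0 z0 w0; field; rewrite !gt_eqF.
  exact: E.
have fibE y t : cell u1 u2 u3 Y1 Y2 Y3 s A C (y, t) ->
   good y /\ ((d1 y)%:Z * t.1.1 + (d2 y)%:Z * t.1.2 + (d3 y)%:Z * t.2 =
     (u1 * u2 * u3 * (y.1.1 * y.1.2 * y.2))%N%:Z * s /\
     [/\ `|t.1.1|%N%:R <= Z1 / 2, `|t.1.2|%N%:R <= Z2 / 2 & `|t.2|%N%:R <= Z3 / 2]).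
  move=> [h1 h2 h3 [k1 k2 k3]]; split; first by rewrite /good h1 h2.
  split.
    rewrite -h3 /d1 /d2 /d3.
    have sq (u z : nat) (t' : int) : (u * z ^ 2)%N%:Z * t' = u%:Z * t' * z%:Z ^+ 2.
      by rewrite PoszM -mulnn PoszM; ring.
    by rewrite !sq.
  have half (B D : R) : 0 < D -> 2 * B / D / 2 = B / D.
    by move=> D0; field; rewrite gt_eqF.
  by split; rewrite half // ler_pdivlMr.
have fibc y (r : R) : card_le (fun x : int * int * int => (d1 y)%:Z * x.1.1 + (d2 y)%:Z * x.1.2 + (d3 y)%:Z * x.2 =
    (u1 * u2 * u3 * (y.1.1 * y.1.2 * y.2))%N%:Z * s /\
     [/\ `|x.1.1|%N%:R <= Z1 / 2, `|x.1.2|%N%:R <= Z2 / 2 & `|x.2|%N%:R <= Z3 / 2]) r ->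
   card_le (fun x => cell u1 u2 u3 Y1 Y2 Y3 s A C x /\ x.1 = y) r.
  move=> H; apply: (@card_le_inj R _ _ snd _ _ r _ _ H).
    by move=> [y1 t1] [y2 t2] [_ /= ->] [_ /= ->] ->.
  by move=> [y' t] [/fibE[_ h] /= <-].
(* A nonzero entry has absolute value at least 1, so the levels are bounded and a largest one
   exists. *)
have [L HL] : exists L, forall y l, good y -> S y l -> (l < L)%N.
  pose m := Z1 + Z2 + Z3.
  have [L mL] : exists L, m < 2 ^+ L.
    exists (Num.truncn m).+1; apply: lt_le_trans (truncnS_gt m) _.
    by rewrite -natrX ler_nat ltnW // ltn_expl.
  exists L => y l _ [[[v1 v2] v3] [vn _ [/= h1 h2 h3]]].
  rewrite -(ltr_eXn2l (x := 2 : R)) ?ltr1n //; apply: le_lt_trans mL.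
  have ge (v : int) : v != 0 -> (2 : R) ^+ l <= `|v|%N%:R * 2 ^+ l.
    by move=> v0; rewrite ler_peMl ?(ltW (p0 l)) // ler1n absz_gt0.
  case: (eqVneq v1 0) => [v10|/ge]; last by rewrite /m; lra.
  case: (eqVneq v2 0) => [v20|/ge]; last by rewrite /m; lra.
  case: (eqVneq v3 0) => [v30|/ge]; last by rewrite /m; lra.
  by case: vn; rewrite v10 v20 v30.
pose P2 := fun x : (nat * nat * nat) * (int * int * int) => exists l : nat,
  [/\ cell u1 u2 u3 Y1 Y2 Y3 s A C x, S x.1 l, ~ S x.1 l.+1, 2 * M < 2 ^+ l & (l < L)%N].
pose P1 := fun x : (nat * nat * nat) * (int * int * int) => cell u1 u2 u3 Y1 Y2 Y3 s A C x /\
  (~ S x.1 0 \/ exists l, [/\ S x.1 l, ~ S x.1 l.+1 & 2 ^+ l <= 2 * M]).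
apply: (@card_leU R _ _ P1 P2).
- move=> [y t] xP; have [gy _] := fibE _ _ xP.
  case: (pselect (S y 0)) => S0; last by left; split=> //; left.
  have [l [lL Sl nSl]] : exists l, [/\ (l < L)%N, S y l & ~ S y l.+1].
    apply: contrapT => nex.
    have all l : S y l by elim: l => // l IH; apply: contrapT => nS; apply: nex; exists l; split=> //; exact: HL IH.
    by have := HL y L gy (all L); rewrite ltnn.
  have [lM|Ml] := leP (2 ^+ l) (2 * M).
    by left; split=> //; right; exists l.
  by right; exists l.
- apply: (@card_le_fibM R _ _ fst _ (fun y => dyadic_box Y1 Y2 Y3 y)).
  + by rewrite addr_ge0 // mulr_ge0 // ltW.
  + by move=> [y t] [[? _ _ _] _].
  + exact: card_le_dyadic_box.
  move=> y _.
  case: (pselect (exists x, P1 x /\ x.1 = y)) => [[[y' t] [[xP cl] /= yE]]|nex]; last first.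
    apply: card_le_void => [|x xP]; first by rewrite addr_ge0 // mulr_ge0 // ltW.
    by apply: nex; exists x.
  rewrite yE in xP cl; have [gy _] := fibE _ _ xP.
  apply: (@card_le_sub _ _ _ (fun x => cell u1 u2 u3 Y1 Y2 Y3 s A C x /\ x.1 = y) (1 + 30 * M)) => //.
    by move=> x [[]].
  apply: fibc; have [_ _ _ [d10 [c12 c13 _]]] := goodP _ gy.
  case: cl => [nS|[l [Sl nSl lM]]].
    apply: card_le_mono (@no_short_vec_le R _ _ _ _ _ _ _ nS) _.
    by rewrite lerDl mulr_ge0 // ltW.
  apply: card_le_mono (@max_short_vec_le R _ _ _ _ _ _ _ _ _ d10 c12 c13 (ltW Z10) (ltW Z20) (ltW Z30) (ltW M0) (ZM _ gy) Sl nSl) _.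
  by lra.
pose Q2 := fun x : ((nat * nat * nat) * (int * int * int)) * nat =>
   [/\ cell u1 u2 u3 Y1 Y2 Y3 s A C x.1, S x.1.1 x.2, ~ S x.1.1 x.2.+1, 2 * M < 2 ^+ x.2 & (x.2 < L)%N].
apply: (@card_le_ex R _ _ Q2).
have : card_le Q2 (\sum_(l <- iota 0 L) (if 2 * M < 2 ^+ l then 15 * K * (2 ^+ l)^-1 else 0)).
  apply: (@card_le_fib R _ _ snd) => [x [_ _ _ _ h]|l _]; first by rewrite mem_iota.
  case: ifP => Ml; last by apply: card_le_void => // -[x l'] [[_ _ _ /= + _] /= lE]; rewrite lE Ml.
  (* [20 M + 5 * 2^l] is at most [15 * 2^l] here, since [2 M < 2^l]. *)
  have -> : 15 * K * (2 ^+ l)^-1 = (K / 4 ^+ l) * (15 * 2 ^+ l).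
    have -> : 4 ^+ l = 2 ^+ l * 2 ^+ l :> R by rewrite -exprMn; congr (_ ^+ _); ring.
    by field; rewrite gt_eqF.
  apply: (@card_le_fibM R _ _ (fun x => x.1.1) _ (conic_pt u1 u2 u3 Y1 Y2 Y3 (2 * A / 2 ^+ l) (2 * A / 2 ^+ l)
      (2 * C / 2 ^+ l))) => //.
  + by rewrite mulr_ge0 // ltW.
  + move=> [[y t] l'] [[/= xP Sl _ _ _] /= lE]; rewrite lE in Sl.
    have [gy _] := fibE _ _ xP; have [h1 h2 h3 [d10 [c12 c13 c23]]] := goodP _ gy.
    have [[[v1 v2] v3] [vn vP [/= k1 k2 k3]]] := Sl.
    exists (v1, v2, v3); rewrite /conic_rel; have [/= yb yc _ _] := xP.
    have fin (v : int) (B D : R) : 0 < D -> `|v|%N%:R * 2 ^+ l <= 2 * B / D -> `|v|%N%:R * D <= 2 * B / 2 ^+ l.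
      by move=> D0 h; rewrite ler_pdivlMr // mulrAC -ler_pdivlMr.
    rewrite /in_plane /= in vP.
    (* If an entry of the short vector vanished, the plane equation with coprime coefficients would
       make another entry a nonzero multiple of some [d_i]. At level [l] this forces [2 * 2^l <= M],
       against [2 M < 2^l]. *)
    have big (a b : int) (da db : nat) : (0 < da)%N -> coprime da db -> b != 0 ->
        da%:Z * a + db%:Z * b = 0 -> (da <= `|b|)%N.
      move=> da0 cd b0 E; apply: dvdn_leq; rewrite ?absz_gt0 //.
      have : (da%:Z %| db%:Z * b)%Z.
        have -> : db%:Z * b = da%:Z * (- a) by lra.
        exact: dvdz_mulr.
      by rewrite dvdzE abszM /= Gauss_dvdr.
    have d20 : (0 < d2 y)%N by rewrite -(ltr_nat R); apply: lt_le_trans h2.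
    have d30 : (0 < d3 y)%N by rewrite -(ltr_nat R); apply: lt_le_trans h3.
    have kill (v : int) (D B Z : R) (d : nat) : 0 < D -> 0 < B -> D <= d%:R -> (d <= `|v|)%N ->
       `|v|%N%:R * 2 ^+ l <= 2 * B / Z -> 0 < Z -> 4 * B / (D * Z) <= M -> False.
      move=> D0' B0 Dd dv hv Z0' MM.
      have : D * 2 ^+ l <= 2 * B / Z.
        apply: le_trans hv; rewrite ler_wpM2r ?(ltW (p0 l)) //; apply: le_trans Dd _.
        by rewrite ler_nat.
      rewrite ler_pdivlMr // => hh.
      have : 2 * (2 ^+ l) <= M.
        apply: le_trans MM; rewrite ler_pdivlMr ?mulr_gt0 //; lra.
      by have := p0 l; move: Ml; lra.
    have n3 : v3 != 0.
      apply/eqP => v30; rewrite v30 mulr0 addr0 in vP.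
      have v1n : v1 != 0.
        apply/eqP => v10; move: vP; rewrite v10 mulr0 add0r => /eqP; rewrite mulf_eq0 eqz_nat.
        rewrite -leqn0 leqNgt d20 /= => /eqP v20; by apply: vn; rewrite v10 v20 v30.
      apply: (kill v1 D2 A D1 (d2 y)) => //.
        by apply: (big v2 v1 _ (d1 y)); rewrite // 1?coprime_sym // addrC.
      rewrite /M -!mulrA ler_wpM2l // ler_wpM2l ?(ltW A0) //.
      have E (x z w : R) : 0 < x -> 0 < z -> 0 < w -> C / (x * (z * w)) = (z * x)^-1 * (C / w).
        by move=> x0 z0 w0; field; rewrite !gt_eqF.
      rewrite E // ler_peMr ?invr_ge0 ?mulr_ge0 ?(ltW D10) ?(ltW D20) //.
      by rewrite ler_pdivlMr // mul1r.
    have n2 : v2 != 0.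
      apply/eqP => v20; rewrite v20 mulr0 addr0 in vP.
      apply: (kill v3 D1 C D3 (d1 y)) => //; first exact: (big v1 v3 _ (d3 y)).
      rewrite /M -!mulrA ler_wpM2l // ler_pdivrMr ?mulr_gt0 //.
      have E (x z w : R) : 0 < x -> 0 < z -> 0 < w -> A * (C / (x * (z * w))) * (x * w) = A * C / z.
        by move=> x0 z0 w0; field; rewrite !gt_eqF.
      rewrite E //.
      by rewrite ler_pdivlMr // mulrC ler_wpM2r // ltW.
    have n1 : v1 != 0.
      apply/eqP => v10; rewrite v10 mulr0 add0r in vP.
      apply: (kill v3 D2 C D3 (d2 y)) => //; first exact: (big v2 v3 _ (d3 y)).
      rewrite /M -!mulrA ler_wpM2l // ler_pdivrMr ?mulr_gt0 //.
      have E (x z w : R) : 0 < x -> 0 < z -> 0 < w -> A * (C / (x * (z * w))) * (z * w) = A * C / x.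
        by move=> x0 z0 w0; field; rewrite !gt_eqF.
      rewrite E //.
      by rewrite ler_pdivlMr // mulrC ler_wpM2r // ltW.
    split=> //=; rewrite ?n1 ?n2 ?n3 //.
      rewrite -[RHS]vP /d1 /d2 /d3.
      have sq (u z : nat) (t' : int) : (u * z ^ 2)%N%:Z * t' = u%:Z * t' * z%:Z ^+ 2.
        by rewrite PoszM -mulnn PoszM; ring.
      by rewrite !sq.
    by split; apply: fin.
  move=> y _.
  case: (pselect (exists x, (Q2 x /\ x.2 = l) /\ x.1.1 = y)) => [|nex]; last first.
    apply: card_le_void => [|x xP]; first by rewrite mulr_ge0 // ltW.
    by apply: nex; exists x.
  move=> [[[y' t] l'] [[[/= xP Sl nSl _ _] lE] yE]]; rewrite yE lE in xP Sl nSl.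
  have [gy _] := fibE _ _ xP; have [_ _ _ [d10 [c12 c13 _]]] := goodP _ gy.
  apply: (@card_le_inj R _ _ fst _ (fun x => cell u1 u2 u3 Y1 Y2 Y3 s A C x /\ x.1 = y)).
  + by move=> [x1 l1] [x2 l2] [[_ /= ->] _] [[_ /= ->] _] ->.
  + by move=> [x1 l1] [[[/= ? _ _ _ _] _] ?].
  apply: fibc.
  apply: card_le_mono (@max_short_vec_le R _ _ _ _ _ _ _ _ _ d10 c12 c13 (ltW Z10) (ltW Z20) (ltW Z30) (ltW M0) (ZM _ gy) Sl nSl) _.
  by lra.
move=> H; apply: card_le_mono H _.
rewrite -big_mkcond -mulr_sumr.
have -> : 15 * K / M = 15 * K * (2 / (2 * M)) by field; rewrite gt_eqF.
by rewrite ler_wpM2l ?mulr_ge0 // sum_inv_pow2_gt // mulr_gt0.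
Qed.

Ltac nonneg :=
  repeat first [exact: ler0n | exact: ler01 | assumption | apply: ltW; assumption | exact: sqrtr_ge0
    | exact: harm_ge0 | apply: mulr_ge0 | apply: addr_ge0 | rewrite invr_ge0 | apply: exprn_ge0].

(** Cyclic symmetry lets each of the three coordinates supply the modulus. *)
Lemma conic_pt_rot (R : realType) (u1 u2 u3 Y1 Y2 Y3 : nat) (a1 a2 a3 r : R) :
  card_le (conic_pt u2 u3 u1 Y2 Y3 Y1 a2 a3 a1) r ->
  card_le (conic_pt u1 u2 u3 Y1 Y2 Y3 a1 a2 a3) r.
Proof.
apply: (@card_le_inj R _ _ (fun y : nat * nat * nat => (y.1.2, y.2, y.1.1))).
  by move=> [[? ?] ?] [[? ?] ?] _ _ /= [-> -> ->].
move=> [[y1 y2] y3] [[[t1 t2] t3] [/and3P[b1 b2 b3] /and3P[c1 c2 c3] /= /and3P[n1 n2 n3] E [h1 h2 h3]]].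
exists (t2, t3, t1); split=> //=.
- by rewrite /dyadic_box /= b1 b2 b3.
- by rewrite /coprime_uy /= c3 coprime_sym c1 coprime_sym c2.
- by rewrite n1 n2 n3.
- by rewrite -[RHS]E /=; ring.
Qed.

(** Both terms of the conic count are homogeneous of degree two in the [A_i], so the scale [2^l]
    comes out as [4^l]. *)
Lemma conic_pt_level_le (R : realType) (u1 u2 u3 Y1 Y2 Y3 n : nat) (A1 A2 A3 : R) (l : nat) :
  (0 < u1)%N -> (0 < u2)%N -> (0 < u3)%N ->
  (0 < Y1)%N -> (0 < Y2)%N -> (0 < Y3)%N -> 0 <= A1 -> 0 <= A2 -> 0 <= A3 ->
  (4 * (u3 * Y3 ^ 2) <= n)%N ->
  card_le (conic_pt u1 u2 u3 Y1 Y2 Y3 (2 * A1 / 2 ^+ l) (2 * A2 / 2 ^+ l) (2 * A3 / 2 ^+ l))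
    (32 * (size (divisors u3))%:R * Y3%:R * harm R n ^+ 3 *
       ((A1 * A2 + 256 * A3 * Num.sqrt (A1 * A2) * (Y1%:R * Y2%:R) /
          (u3 * Y3 ^ 2)%N%:R) / ((u1 * Y1 ^ 2)%N%:R * (u2 * Y2 ^ 2)%N%:R)) / 4 ^+ l).
Proof.
move=> u10 u20 u30 Y10 Y20 Y30 A10 A20 A30 hn.
have p0 : (0 : R) < 2 ^+ l by rewrite exprn_gt0.
have q0 (B : R) : 0 <= B -> 0 <= 2 * B / 2 ^+ l.
  by move=> B0; rewrite divr_ge0 ?mulr_ge0 // ltW.
have := conic_pt_le u10 u20 u30 Y10 Y20 Y30 (q0 _ A10) (q0 _ A20) (q0 _ A30).
move=> H; apply: card_le_mono H _.
rewrite -mulr_suml.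
set D1 := (u1 * Y1 ^ 2)%N%:R; set D2 := (u2 * Y2 ^ 2)%N%:R; set D3 := (u3 * Y3 ^ 2)%N%:R.
have D10 : (0 : R) < D1 by rewrite ltr0n muln_gt0 u10 expn_gt0 Y10.
have D20 : (0 : R) < D2 by rewrite ltr0n muln_gt0 u20 expn_gt0 Y20.
have D30 : (0 : R) < D3 by rewrite ltr0n muln_gt0 u30 expn_gt0 Y30.
have -> : Num.sqrt (2 * A1 / 2 ^+ l * (2 * A2 / 2 ^+ l)) = 2 / 2 ^+ l * Num.sqrt (A1 * A2).
  have -> : 2 * A1 / 2 ^+ l * (2 * A2 / 2 ^+ l) = (2 / 2 ^+ l) ^+ 2 * (A1 * A2) by ring.
  by rewrite sqrtrM ?sqr_ge0 // sqrtr_sqr ger0_norm // divr_ge0 // ltW.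
have -> : 4 ^+ l = 2 ^+ l * 2 ^+ l :> R by rewrite -exprMn; congr (_ ^+ _); ring.
move: D1 D2 D3 D10 D20 D30 => D1 D2 D3 D10 D20 D30.
have S0 := sqrtr_ge0 (A1 * A2); move: (Num.sqrt _) S0 => S S0.
set W := 4 * _ / _.
have WE : W = 16 * ((A1 * A2 + 256 * A3 * S * (Y1%:R * Y2%:R) / D3) / (D1 * D2)) / (2 ^+ l * 2 ^+ l).
  by rewrite /W; field; rewrite !gt_eqF.
have W0 : 0 <= W.
  rewrite /W divr_ge0 ?mulr_ge0 ?(ltW D10) ?(ltW D20) ?addr_ge0 ?mulr_ge0 ?invr_ge0 ?ler0n ?(ltW D30) ?(ltW p0) //.
apply: le_trans (ler_wpM2r W0 (sum_tau_sigma_le R u30 Y30 hn)) _.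
by rewrite WE le_eqVlt; apply/orP; left; apply/eqP; ring.
Qed.

(** Otherwise the product would exceed [z^3], which is at least [z^2]. *)
Lemma some_factor_le (R : realType) (x1 x2 x3 z : R) : 1 <= z ->
  0 <= x1 -> 0 <= x2 -> 0 <= x3 -> x1 * x2 * x3 = z ^+ 2 ->
  [\/ x1 <= z, x2 <= z | x3 <= z].
Proof.
move=> z1 x10 x20 x30 E.
case: (leP x1 z) => h1; first by constructor 1.
case: (leP x2 z) => h2; first by constructor 2.
case: (leP x3 z) => h3; first by constructor 3.
have z0 : 0 < z by lra.
have k1 : z * z < x1 * x2 by apply: ltr_pM => //; exact: ltW.
have k2 : z * z * z < x1 * x2 * x3.
  by apply: ltr_pM => //; rewrite ?mulr_ge0 // ltW.
have : z * z * 1 <= z * z * z by rewrite ler_wpM2l // mulr_ge0 // ltW.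
by rewrite E expr2 in k2; lra.
Qed.

Lemma rearrange_le (R : realType) (a b c d e k l : R) : 0 <= k * l ->
  a * (c * (d * e)) <= b * (c * (d * e)) ->
  k * a * c * d * (l * e) <= k * l * b * c * d * e.
Proof.
move=> kl h; have -> : k * a * c * d * (l * e) = (k * l) * (a * (c * (d * e))) by ring.
have -> : k * l * b * c * d * e = (k * l) * (b * (c * (d * e))) by ring.
exact: ler_wpM2l.
Qed.

(** With the first, second or third coordinate as modulus, the conic count contributes, next to a
    multiple of [sqrt (A / C)] or of 1, the term [D1 / (Y2 Y3)], [D2 / (Y1 Y3)] or
    [A D3 / (C Y1 Y2)]. Their product is [u1 u2 u3 A / C = z^2], so one of the three choices costs
    at most [z]. *)
Lemma cell_bound (R : realType) (u1 u2 u3 Y1 Y2 Y3 n : nat) (s : int) (A C : R) :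
  (0 < u1)%N -> (0 < u2)%N -> (0 < u3)%N -> (0 < Y1)%N -> (0 < Y2)%N -> (0 < Y3)%N ->
  let D1 : R := (u1 * Y1 ^ 2)%N%:R in
  let D2 : R := (u2 * Y2 ^ 2)%N%:R in
  let D3 : R := (u3 * Y3 ^ 2)%N%:R in
  let Y : R := Y1%:R * Y2%:R * Y3%:R in
  let tau : R := (size (divisors u1) + size (divisors u2) + size (divisors u3))%N%:R in
  D1 <= A -> D2 <= A -> D3 <= C -> C <= A -> 4 * A <= n%:R ->
  card_le (cell u1 u2 u3 Y1 Y2 Y3 s A C)
    (Y * (1 + 30 * (4 * A * C / (D1 * D2 * D3))) +
      120 * 257 * tau * harm R n ^+ 3 * Y * Num.sqrt ((u1 * u2 * u3)%N%:R * A / C)).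
Proof.
move=> u10 u20 u30 Y10 Y20 Y30 D1 D2 D3 Y tau D1A D2A D3C CA An.
have D10 : 0 < D1 by rewrite ltr0n muln_gt0 u10 expn_gt0 Y10.
have D20 : 0 < D2 by rewrite ltr0n muln_gt0 u20 expn_gt0 Y20.
have D30 : 0 < D3 by rewrite ltr0n muln_gt0 u30 expn_gt0 Y30.
have A0 : 0 < A by exact: lt_le_trans D1A.
have C0 : 0 < C by exact: lt_le_trans D3C.
have y1 : (0 : R) < Y1%:R by rewrite ltr0n.
have y2 : (0 : R) < Y2%:R by rewrite ltr0n.
have y3 : (0 : R) < Y3%:R by rewrite ltr0n.
have Y0 : 0 < Y by rewrite !mulr_gt0.
pose H := harm R n; have H0 : 0 <= H ^+ 3 by rewrite exprn_ge0 // harm_ge0.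
have bn (u Z : nat) : ((u * Z ^ 2)%N%:R : R) <= A -> (4 * (u * Z ^ 2) <= n)%N.
  by move=> h; rewrite -(ler_nat R) natrM; apply: le_trans An; rewrite ler_wpM2l.
have lvl K : 0 <= K -> (forall l, card_le (conic_pt u1 u2 u3 Y1 Y2 Y3 (2 * A / 2 ^+ l) (2 * A / 2 ^+ l)
      (2 * C / 2 ^+ l)) (K / 4 ^+ l)) ->
   15 * K / (4 * A * C / (D1 * D2 * D3)) <=
      120 * 257 * tau * harm R n ^+ 3 * Y * Num.sqrt ((u1 * u2 * u3)%N%:R * A / C) ->
   card_le (cell u1 u2 u3 Y1 Y2 Y3 s A C)
    (Y * (1 + 30 * (4 * A * C / (D1 * D2 * D3))) +
      120 * 257 * tau * harm R n ^+ 3 * Y * Num.sqrt ((u1 * u2 * u3)%N%:R * A / C)).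
  move=> K0 HK le; apply: card_le_mono (@cell_le R u1 u2 u3 Y1 Y2 Y3 s A C K u10 u20 u30 Y10 Y20 Y30 D1A D2A D3C K0 HK) _.
  by rewrite lerD2l.
set z := Num.sqrt _.
have AC1 : 1 <= A / C by rewrite ler_pdivlMr // mul1r.
have U1 : 1 <= (u1 * u2 * u3)%N%:R :> R by rewrite ler1n !muln_gt0 u10 u20.
have z2 : z ^+ 2 = (u1 * u2 * u3)%N%:R * (A / C).
  by rewrite /z -mulrA sqr_sqrtr // mulr_ge0 ?ler0n // divr_ge0 // ltW.
have z1 : 1 <= z.
  rewrite -[leLHS]sqrtr1 ler_wsqrtr // -mulrA.
  by apply: le_trans U1 _; rewrite ler_peMr.
have z0 : 0 < z by lra.
pose w := Num.sqrt (A / C).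
have w0 : 0 <= w by exact: sqrtr_ge0.
have w2 : w ^+ 2 = A / C by rewrite sqr_sqrtr // divr_ge0 // ltW.
have wz : w <= z.
  by rewrite ler_wsqrtr // -[leRHS]mulrA ler_peMl // divr_ge0 // ltW.
have DE1 : D1 = u1%:R * Y1%:R ^+ 2 by rewrite /D1 natrM natrX.
have DE2 : D2 = u2%:R * Y2%:R ^+ 2 by rewrite /D2 natrM natrX.
have DE3 : D3 = u3%:R * Y3%:R ^+ 2 by rewrite /D3 natrM natrX.
have x1p : 0 <= D1 / (Y2%:R * Y3%:R) by rewrite divr_ge0 ?mulr_ge0 ?ler0n.
have x2p : 0 <= D2 / (Y1%:R * Y3%:R) by rewrite divr_ge0 ?mulr_ge0 ?ler0n.
have x3p : 0 <= A / C * D3 / (Y1%:R * Y2%:R).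
  by rewrite divr_ge0 ?mulr_ge0 ?ler0n ?invr_ge0 // ltW.
have xE : D1 / (Y2%:R * Y3%:R) * (D2 / (Y1%:R * Y3%:R)) * (A / C * D3 / (Y1%:R * Y2%:R)) = z ^+ 2.
  rewrite z2 DE1 DE2 DE3 !natrM; field.
  by rewrite !gt_eqF.
have [x1z|x2z|x3z] := some_factor_le z1 x1p x2p x3p xE.
- pose K := 32 * (size (divisors u1))%:R * Y1%:R * H ^+ 3 *
       ((A * C + 256 * A * Num.sqrt (A * C) * (Y2%:R * Y3%:R) / D1) / (D2 * D3)).
  have K0 : 0 <= K.
    by rewrite /K; nonneg.
  apply: (lvl K) => // [l|].
    apply: conic_pt_rot; apply: conic_pt_level_le => //; rewrite ?(ltW A0) ?(ltW C0) //.
    exact: bn.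
  have sE : Num.sqrt (A * C) = w * C.
    have -> : A * C = (w * C) ^+ 2 by rewrite exprMn w2; field; rewrite gt_eqF.
    by rewrite sqrtr_sqr ger0_norm // mulr_ge0 // ltW.
  have -> : 15 * K / (4 * A * C / (D1 * D2 * D3)) =
     120 * (size (divisors u1))%:R * H ^+ 3 * Y * (D1 / (Y2%:R * Y3%:R) + 256 * w).
    rewrite /K sE /Y; move: D1 D2 D3 D10 D20 D30 {D1A D2A D3C lvl x1p x2p x3p xE x1z DE1 DE2 DE3 K K0}.
    by move=> D1 D2 D3 D10 D20 D30; field; rewrite !gt_eqF.
  (* [257] is 1 for the term chosen to be at most [z], plus [256] for [w <= z]. *)
  apply: (@le_trans _ _ (120 * (size (divisors u1))%:R * H ^+ 3 * Y * (257 * z))).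
    by apply: ler_wpM2l; [nonneg | lra].
  have t1 : (size (divisors u1))%:R <= tau by rewrite ler_nat -addnA leq_addr.
  apply: rearrange_le; first by nonneg.
  by apply: ler_wpM2r; [nonneg | exact: t1].
- pose K := 32 * (size (divisors u2))%:R * Y2%:R * H ^+ 3 *
       ((C * A + 256 * A * Num.sqrt (C * A) * (Y3%:R * Y1%:R) / D2) / (D3 * D1)).
  have K0 : 0 <= K.
    by rewrite /K; nonneg.
  apply: (lvl K) => // [l|].
    apply: conic_pt_rot; apply: conic_pt_rot; apply: conic_pt_level_le => //; rewrite ?(ltW A0) ?(ltW C0) //.
    exact: bn.
  have sE : Num.sqrt (C * A) = w * C.
    have -> : C * A = (w * C) ^+ 2 by rewrite exprMn w2; field; rewrite gt_eqF.
    by rewrite sqrtr_sqr ger0_norm // mulr_ge0 // ltW.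
  have -> : 15 * K / (4 * A * C / (D1 * D2 * D3)) =
     120 * (size (divisors u2))%:R * H ^+ 3 * Y * (D2 / (Y1%:R * Y3%:R) + 256 * w).
    rewrite /K sE /Y; move: D1 D2 D3 D10 D20 D30 {D1A D2A D3C lvl x1p x2p x3p xE x2z DE1 DE2 DE3 K K0}.
    by move=> D1 D2 D3 D10 D20 D30; field; rewrite !gt_eqF.
  apply: (@le_trans _ _ (120 * (size (divisors u2))%:R * H ^+ 3 * Y * (257 * z))).
    by apply: ler_wpM2l; [nonneg | lra].
  have t1 : (size (divisors u2))%:R <= tau by rewrite ler_nat addnAC leq_addl.
  apply: rearrange_le; first by nonneg.
  by apply: ler_wpM2r; [nonneg | exact: t1].
- pose K := 32 * (size (divisors u3))%:R * Y3%:R * H ^+ 3 *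
       ((A * A + 256 * C * Num.sqrt (A * A) * (Y1%:R * Y2%:R) / D3) / (D1 * D2)).
  have K0 : 0 <= K.
    by rewrite /K; nonneg.
  apply: (lvl K) => // [l|].
    apply: conic_pt_level_le => //; rewrite ?(ltW A0) ?(ltW C0) //.
    by apply: bn; exact: le_trans D3C CA.
  have sE : Num.sqrt (A * A) = A by rewrite -expr2 sqrtr_sqr gtr0_norm.
  have -> : 15 * K / (4 * A * C / (D1 * D2 * D3)) =
     120 * (size (divisors u3))%:R * H ^+ 3 * Y * (A / C * D3 / (Y1%:R * Y2%:R) + 256).
    rewrite /K sE /Y; move: D1 D2 D3 D10 D20 D30 {D1A D2A D3C lvl x1p x2p x3p xE x3z DE1 DE2 DE3 K K0}.
    by move=> D1 D2 D3 D10 D20 D30; field; rewrite !gt_eqF.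
  apply: (@le_trans _ _ (120 * (size (divisors u3))%:R * H ^+ 3 * Y * (257 * z))).
    by apply: ler_wpM2l; [nonneg | lra].
  have t1 : (size (divisors u3))%:R <= tau by rewrite ler_nat leq_addl.
  apply: rearrange_le; first by nonneg.
  by apply: ler_wpM2r; [nonneg | exact: t1].
Qed.

(** * Sums over powers of two *)

Lemma iota0S (n : nat) : iota 0 n.+1 = iota 0 n ++ [:: n].
Proof. by have := iotaD 0 n 1; rewrite addn1. Qed.

Lemma sum_pow2_le (R : realType) (x : R) (n : nat) : 0 <= x ->
  \sum_(k <- iota 0 n | 2 ^+ k <= x) 2 ^+ k <= 2 * x.
Proof.
move=> x0; pose S m : R := \sum_(k <- iota 0 m | 2 ^+ k <= x) 2 ^+ k.
(* The second bound carries the induction: when [2^n] is added, the earlier terms are at most [2^n],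
   which is itself at most [x]. *)
suff : S n <= 2 * x /\ S n <= 2 ^+ n by case.
rewrite /S.
elim: n => [|n [IH1 IH2]]; first by rewrite big_nil expr0; split; lra.
rewrite iota0S big_cat /= [X in _ + X]big_mkcond big_seq1 /= exprS.
have p0 : (0 : R) < 2 ^+ n by rewrite exprn_gt0.
by case: ifP => h; split; lra.
Qed.

Lemma sum_sqrt_pow2_le (R : realType) (x : R) (n : nat) : 0 <= x ->
  \sum_(k <- iota 0 n | 2 ^+ k <= x) Num.sqrt (2 ^+ k) <= 4 * Num.sqrt x.
Proof.
move=> x0; pose S m : R := \sum_(k <- iota 0 m | 2 ^+ k <= x) Num.sqrt (2 ^+ k).
suff : S n <= 4 * Num.sqrt x /\ S n <= 3 * Num.sqrt (2 ^+ n) by case.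
rewrite /S.
have sx := sqrtr_ge0 x.
elim: n => [|n [IH1 IH2]]; first by rewrite big_nil expr0 sqrtr1; split; lra.
rewrite iota0S big_cat /= [X in _ + X]big_mkcond big_seq1 /= exprS sqrtrM //.
have s0 := sqrtr_ge0 ((2 : R) ^+ n).
have s2 : 4 <= 3 * Num.sqrt 2 :> R.
  have E : Num.sqrt 2 ^+ 2 = 2 :> R by rewrite sqr_sqrtr.
  have := sqrtr_ge0 (2 : R); move: (Num.sqrt 2) E => t E t0.
  by rewrite expr2 in E; rewrite leNgt; apply/negP => h; nra.
have h2 : 4 * Num.sqrt (2 ^+ n) <= 3 * (Num.sqrt 2 * Num.sqrt (2 ^+ n)) :> R.
  by rewrite mulrA ler_wpM2r.
case: ifP => h; last by split; lra.
have := ler_wsqrtr h; split; lra.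
Qed.

(** The two members of the minimum cross at [2^k = sqrt (p / r)], and on either side the sum is
    geometric. *)
Lemma sum_min_pow2_le (R : realType) (p r : R) (n : nat) : 0 < p -> 0 < r ->
  \sum_(k <- iota 0 n) Num.min (p / 2 ^+ k) (r * 2 ^+ k) <= 4 * Num.sqrt (p * r).
Proof.
move=> p0 r0; pose x := Num.sqrt (p / r).
have x0 : 0 < x by rewrite sqrtr_gt0 divr_gt0.
have rx : r * x = Num.sqrt (p * r).
  have -> : p * r = (r * x) ^+ 2.
    by rewrite exprMn sqr_sqrtr ?divr_ge0 1?ltW //; field; rewrite gt_eqF.
  by rewrite sqrtr_sqr gtr0_norm // mulr_gt0.
have px : p / x = Num.sqrt (p * r).
  rewrite -rx; apply: (mulIf (_ : x != 0)); first by rewrite gt_eqF.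
  rewrite divfK ?gt_eqF // -mulrA -expr2 sqr_sqrtr ?divr_ge0 1?ltW //.
  by field; rewrite gt_eqF.
rewrite (bigID (fun k => 2 ^+ k <= x)) /=.
have -> : 4 * Num.sqrt (p * r) = r * (2 * x) + p * (2 / x).
  have -> : p * (2 / x) = 2 * (p / x) by ring.
  have -> : r * (2 * x) = 2 * (r * x) by ring.
  by rewrite px rx; ring.
apply: lerD.
  apply: le_trans (ler_wpM2l (ltW r0) (sum_pow2_le n (ltW x0))).
  rewrite mulr_sumr; apply: ler_sum => k _; by rewrite ge_min lexx orbT.
apply: le_trans (ler_wpM2l (ltW p0) (sum_inv_pow2_gt n x0)).
rewrite mulr_sumr; under eq_bigl => k do rewrite -ltNge.
by apply: ler_sum => k _; rewrite ge_min lexx.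
Qed.

(* The height conditions on [x] become those on [t] once the gcds are divided
   out; the third coordinate is the one of smallest absolute value. *)
Definition torsor_pt (R : realType) (B : R) (u1 u2 u3 s : nat)
    (x : (nat * nat * nat) * (int * int * int)) : Prop :=
  let: (y, t) := x in
  let a1 := (u1 * y.1.1 ^ 2 * `|t.1.1|)%N in
  let a2 := (u2 * y.1.2 ^ 2 * `|t.1.2|)%N in
  let a3 := (u3 * y.2 ^ 2 * `|t.2|)%N in
  [/\ [&& (0 < y.1.1)%N, (0 < y.1.2)%N & (0 < y.2)%N] && coprime_uy u1 u2 u3 y,
      u1%:Z * t.1.1 * y.1.1%:Z ^+ 2 + u2%:Z * t.1.2 * y.1.2%:Z ^+ 2 +
        u3%:Z * t.2 * y.2%:Z ^+ 2 = (u1 * u2 * u3 * (y.1.1 * y.1.2 * y.2))%N%:Z * s%:Z,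
      [&& t.1.1 != 0, t.1.2 != 0 & t.2 != 0],
      (a3 <= a1)%N && (a3 <= a2)%N &
      [/\ (u1 * u2 * u3 * s ^ 2 * a1)%N%:R <= B,
          (u1 * u2 * u3 * s ^ 2 * a2)%N%:R <= B &
          (`|t.1.1| * `|t.1.2| * `|t.2|)%N%:R <= B]].

(** * The cell bound summed over dyadic sizes *)

(** The second member comes from the bound [9 U Y^2 B] on the smallest [a_i] times the square of the
    largest. Dyadic rounding alone would give [36 * 64]; with [72 * 64] the number
    [2 * 72 * 64 = 96^2] is a square, which is convenient when roots are taken below. *)
Definition cellC (R : realType) (B U Y A : R) : R :=
  Num.min A (72 * 64 * B * U * Y ^+ 2 / A ^+ 2).

(** A majorant of the cell bound whose dependence on [Y] is linear, or through a minimum of a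
    decreasing and an increasing term, or absent. Each kind can be summed over dyadic [Y]. *)
Definition cell_val (R : realType) (B U T H s Y A : R) : R :=
  Y + 120 * Num.min (A ^+ 2 / (U * Y)) (72 * 64 * B * Y / A) +
  120 * 257 * T * H * (Num.sqrt U * Y + A / (Num.sqrt U * s)).

(** Where [cellC] equals [A], the root is [sqrt U]. Otherwise it is a power of [A] divided by [Y],
    and [U s^2 A <= 2 B] turns that into [A / (sqrt U s)] after multiplication by [Y]. *)
Lemma cell_val_ge (R : realType) (B U T H s Y A : R) :
  0 < B -> 0 < U -> 0 <= T -> 0 <= H -> 0 < s -> 0 < Y -> 0 < A ->
  U * s ^+ 2 * A <= 2 * B ->
  Y * (1 + 30 * (4 * A * cellC B U Y A / (U * Y ^+ 2))) +
    120 * 257 * T * H * Y * Num.sqrt (U * A / cellC B U Y A) <=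
  cell_val B U T H s Y A.
Proof.
move=> B0 U0 T0 H0 s0 Y0 A0 hA; rewrite /cell_val.
have C0 : 0 < cellC B U Y A.
  by rewrite /cellC lt_min A0 divr_gt0 ?mulr_gt0 ?exprn_gt0.
have sU : 0 < Num.sqrt U by rewrite sqrtr_gt0.
apply: lerD.
  rewrite mulrDr mulr1 lerD2l.
  have -> : Y * (30 * (4 * A * cellC B U Y A / (U * Y ^+ 2))) = 120 * (A * cellC B U Y A / (U * Y)).
    by field; rewrite !gt_eqF.
  apply: ler_wpM2l => //; rewrite le_min; apply/andP; split.
    rewrite expr2; apply: ler_wpM2r; first by rewrite invr_ge0 mulr_ge0 // ltW.
    by apply: ler_wpM2l; [exact: ltW | rewrite /cellC ge_min lexx].
  have -> : 72 * 64 * B * Y / A = A * (72 * 64 * B * U * Y ^+ 2 / A ^+ 2) / (U * Y).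
    by field; rewrite !gt_eqF.
  apply: ler_wpM2r; first by rewrite invr_ge0 mulr_ge0 // ltW.
  by apply: ler_wpM2l; [exact: ltW | rewrite /cellC ge_min lexx orbT].
have -> : 120 * 257 * T * H * Y * Num.sqrt (U * A / cellC B U Y A) =
   120 * 257 * T * H * (Y * Num.sqrt (U * A / cellC B U Y A)) by ring.
apply: ler_wpM2l; first by rewrite !mulr_ge0.
have A' : 0 <= A / (Num.sqrt U * s) by rewrite divr_ge0 ?mulr_ge0 // ltW.
have U' : 0 <= Num.sqrt U * Y by rewrite mulr_ge0 // ltW.
rewrite /cellC minEle; case: ifP => _.
  have -> : U * A / A = U by field; rewrite gt_eqF.
  by rewrite mulrC lerDl.
apply: (@le_trans _ _ (A / (Num.sqrt U * s))); last by rewrite lerDr.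
have -> : U * A / (72 * 64 * B * U * Y ^+ 2 / A ^+ 2) = A ^+ 3 / (72 * 64 * B) / Y ^+ 2.
  by field; rewrite !gt_eqF.
have le : A ^+ 3 / (72 * 64 * B) / Y ^+ 2 <= (A / (Num.sqrt U * s) / Y) ^+ 2.
  have -> : (A / (Num.sqrt U * s) / Y) ^+ 2 = A ^+ 2 / (Num.sqrt U ^+ 2 * s ^+ 2) / Y ^+ 2.
    by field; rewrite !gt_eqF.
  rewrite (sqr_sqrtr (ltW U0)).
  apply: ler_wpM2r; first by rewrite invr_ge0 exprn_ge0 // ltW.
  rewrite ler_pdivrMr ?mulr_gt0 // mulrAC ler_pdivlMr ?mulr_gt0 ?exprn_gt0 //.
  have -> : A ^+ 3 * (U * s ^+ 2) = A ^+ 2 * (U * s ^+ 2 * A) by ring.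
  apply: ler_wpM2l; first by rewrite exprn_ge0 // ltW.
  by apply: le_trans hA _; lra.
apply: le_trans (ler_wpM2l (ltW Y0) (ler_wsqrtr le)) _.
rewrite sqrtr_sqr ger0_norm; last by rewrite divr_ge0 // ltW.
by rewrite le_eqVlt; apply/orP; left; apply/eqP; field; rewrite !gt_eqF.
Qed.

(** The sum over [k3] is geometric except for the term of [cell_val] free of [Y], which costs a
    factor [L]. The sums over [k1] and [k2] are estimated trivially and give [L^2], and the sum over
    [kA] is geometric up to [2 B / (U s^2)]. *)
Lemma sum_cell_val_le (R : realType) (B U T H s : R) (L : nat) :
  0 < B -> 1 <= U -> 1 <= T * H -> 0 <= T -> 0 <= H -> 1 <= s -> (0 < L)%N ->
  \sum_(kA <- iota 0 L) \sum_(k1 <- iota 0 L) \sum_(k2 <- iota 0 L) \sum_(k3 <- iota 0 L)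
    (if (U * (2 ^+ k1 * 2 ^+ k2 * 2 ^+ k3) * s <= 3 * 2 ^+ kA) && (U * s ^+ 2 * 2 ^+ kA <= 2 * B)
     then cell_val B U T H s (2 ^+ k1 * 2 ^+ k2 * 2 ^+ k3) (2 ^+ kA) else 0) <=
  L%:R ^+ 2 * B * (120 * 16 * 96 / (U * s) +
     4 * (6 + 120 * 257 * 7) * (T * H * L%:R) / (U * Num.sqrt U * s ^+ 3)).
Proof.
move=> B0 U1 TH1 T0 H0 s1 L0.
have U0 : 0 < U by lra.
have s0 : 0 < s by lra.
have L1 : 1 <= L%:R :> R by rewrite ler1n.
have sU0 : 0 < Num.sqrt U by rewrite sqrtr_gt0.
have sU1 : 1 <= Num.sqrt U by rewrite -[leLHS]sqrtr1 ler_wsqrtr.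
have sUU : Num.sqrt U * Num.sqrt U = U by rewrite -expr2 sqr_sqrtr // ltW.
have p0 k : (0 : R) < 2 ^+ k by rewrite exprn_gt0.
(* [6] is the sum of dyadic [Y] up to [3 A / (U s)], in units of [A / (U s)]; in the [7] the term
   free of [Y] is added to such a [6]. *)
pose c2 : R := 6 + 120 * 257 * 7.
have c20 : 0 <= c2 by rewrite /c2; lra.
pose G kA : R := 480 * Num.sqrt (72 * 64 * (2 ^+ kA * B) / U) + c2 * (T * H * L%:R) * (2 ^+ kA / (Num.sqrt U * s)).
have G0 kA : 0 <= G kA.
  by rewrite /G; nonneg.
have inner kA k1 k2 : \sum_(k3 <- iota 0 L)
    (if (U * (2 ^+ k1 * 2 ^+ k2 * 2 ^+ k3) * s <= 3 * 2 ^+ kA) && (U * s ^+ 2 * 2 ^+ kA <= 2 * B)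
     then cell_val B U T H s (2 ^+ k1 * 2 ^+ k2 * 2 ^+ k3) (2 ^+ kA) else 0) <=
    if U * s ^+ 2 * 2 ^+ kA <= 2 * B then G kA else 0.
  case: ifP => hA; last by rewrite big1 // => k3 _; rewrite andbF.
  rewrite /G; have A0 := p0 kA; move: (2 ^+ kA) hA A0 => A hA A0.
  pose m : R := 2 ^+ k1 * 2 ^+ k2.
  have m0 : 0 < m by rewrite mulr_gt0.
  have sum1 : \sum_(k3 <- iota 0 L | U * (m * 2 ^+ k3) * s <= 3 * A) m * 2 ^+ k3 <= 6 * A / (U * s).
    rewrite -mulr_sumr.
    have x0 : 0 <= 3 * A / (U * m * s) by rewrite divr_ge0 ?mulr_ge0 // ltW.
    have -> : 6 * A / (U * s) = m * (2 * (3 * A / (U * m * s))) by field; rewrite !gt_eqF.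
    apply: ler_wpM2l; first exact: ltW.
    apply: le_trans (sum_pow2_le L x0); rewrite le_eqVlt; apply/orP; left; apply/eqP.
    apply: eq_bigl => k; rewrite ler_pdivlMr ?mulr_gt0 //; congr (_ <= _); ring.
  have sum2 : \sum_(k3 <- iota 0 L) Num.min (A ^+ 2 / (U * (m * 2 ^+ k3))) (72 * 64 * B * (m * 2 ^+ k3) / A)
      <= 4 * Num.sqrt (72 * 64 * (A * B) / U).
    have -> : 72 * 64 * (A * B) / U = (A ^+ 2 / (U * m)) * (72 * 64 * B * m / A).
      by field; rewrite !gt_eqF.
    apply: le_trans (@sum_min_pow2_le R (A ^+ 2 / (U * m)) (72 * 64 * B * m / A) L _ _); last 2 first.
    - by rewrite divr_gt0 ?mulr_gt0 ?exprn_gt0.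
    - by rewrite divr_gt0 ?mulr_gt0.
    rewrite le_eqVlt; apply/orP; left; apply/eqP; apply: eq_bigr => k _.
    by congr (Num.min _ _); field; rewrite !gt_eqF.
  have AUs : 0 <= A / (Num.sqrt U * s) by rewrite divr_ge0 ?mulr_ge0 // ltW.
  apply: (@le_trans _ _ (\sum_(k3 <- iota 0 L)
     ((if U * (m * 2 ^+ k3) * s <= 3 * A then (1 + 120 * 257 * T * H * Num.sqrt U) * (m * 2 ^+ k3) else 0) +
      (120 * Num.min (A ^+ 2 / (U * (m * 2 ^+ k3))) (72 * 64 * B * (m * 2 ^+ k3) / A) +
       120 * 257 * T * H * (A / (Num.sqrt U * s)))))).
    apply: ler_sum => k _; rewrite andbT -/m; case: ifP => _.
      by rewrite /cell_val; lra.
    rewrite add0r; apply: addr_ge0; last by nonneg.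
    by apply: mulr_ge0 => //; rewrite le_min; apply/andP; split; nonneg.
  rewrite big_split /= big_split /= -big_mkcond sumr_const_seq size_iota.
  apply: (@le_trans _ _ ((1 + 120 * 257 * T * H * Num.sqrt U) * (6 * A / (U * s)) +
     (120 * (4 * Num.sqrt (72 * 64 * (A * B) / U)) + L%:R * (120 * 257 * T * H * (A / (Num.sqrt U * s)))))).
    apply: lerD; first by rewrite -mulr_sumr; apply: ler_wpM2l => //; nonneg.
    by apply: lerD => //; rewrite -mulr_sumr; apply: ler_wpM2l.
  have e1 : Num.sqrt U * (6 * A / (U * s)) = 6 * (A / (Num.sqrt U * s)).
    by rewrite -{2}sUU; field; rewrite !gt_eqF.
  have e2 : 6 * A / (U * s) <= 6 * (A / (Num.sqrt U * s)).
    by rewrite -e1 ler_peMl // divr_ge0 ?mulr_ge0 // ltW.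
  have e3 : A / (Num.sqrt U * s) <= T * H * L%:R * (A / (Num.sqrt U * s)).
    rewrite ler_peMl //; apply: le_trans TH1 _.
    by rewrite ler_peMr // mulr_ge0.
  have e4 : T * H * (A / (Num.sqrt U * s)) <= T * H * L%:R * (A / (Num.sqrt U * s)).
    by apply: ler_wpM2r => //; rewrite ler_peMr // mulr_ge0.
  have -> : (1 + 120 * 257 * T * H * Num.sqrt U) * (6 * A / (U * s)) =
     6 * A / (U * s) + 120 * 257 * (T * H * (Num.sqrt U * (6 * A / (U * s)))) by ring.
  rewrite e1 /c2.
  move: (A / (Num.sqrt U * s)) (Num.sqrt (72 * 64 * (A * B) / U)) AUs e2 e3 e4 => a b a0 e2 e3 e4.
  have -> : L%:R * (120 * 257 * T * H * a) = 120 * 257 * (T * H * L%:R * a) by ring.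
  have -> : T * H * (6 * a) = 6 * (T * H * a) by ring.
  have -> : (6 + 120 * 257 * 7) * (T * H * L%:R) * a = 6 * (T * H * L%:R * a) + 120 * 257 * (7 * (T * H * L%:R * a)) by ring.
  move: (T * H * L%:R * a) (T * H * a) e2 e3 e4 => x y e2 e3 e4.
  have : 120 * 257 * (6 * y) <= 120 * 257 * (6 * x) :> R.
    by apply: ler_wpM2l; [rewrite mulr_ge0|lra].
  have -> : 120 * 257 * (7 * x) = 120 * 257 * (6 * x) + 120 * 257 * x by ring.
  move: (120 * 257 * (6 * y)) (120 * 257 * (6 * x)) (120 * 257 * x) => X1 X2 X3.
  by lra.
apply: (@le_trans _ _ (\sum_(kA <- iota 0 L) L%:R ^+ 2 *
    (if U * s ^+ 2 * 2 ^+ kA <= 2 * B then G kA else 0))).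
  apply: ler_sum => kA _.
  apply: (@le_trans _ _ (\sum_(k1 <- iota 0 L) \sum_(k2 <- iota 0 L)
     (if U * s ^+ 2 * 2 ^+ kA <= 2 * B then G kA else 0))).
    by apply: ler_sum => k1 _; apply: ler_sum => k2 _; exact: inner.
  by rewrite !sumr_const_seq size_iota expr2 mulrA.
rewrite -mulr_sumr -big_mkcond -mulrA.
apply: ler_wpM2l; first by rewrite exprn_ge0.
have x0 : 0 <= 2 * B / (U * s ^+ 2) by rewrite divr_ge0 ?mulr_ge0 ?exprn_ge0 // ltW.
have -> : \sum_(i <- iota 0 L | U * s ^+ 2 * 2 ^+ i <= 2 * B) G i =
    \sum_(i <- iota 0 L | 2 ^+ i <= 2 * B / (U * s ^+ 2)) G i.
  apply: eq_bigl => k; rewrite ler_pdivlMr ?mulr_gt0 ?exprn_gt0 //; congr (_ <= _); ring.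
rewrite big_split /= -!mulr_sumr [leRHS]mulrDr.
have s1' := sum_pow2_le L x0; have s2' := sum_sqrt_pow2_le L x0.
apply: lerD.
  have -> : \sum_(i <- iota 0 L | 2 ^+ i <= 2 * B / (U * s ^+ 2)) Num.sqrt (72 * 64 * (2 ^+ i * B) / U) =
     Num.sqrt (72 * 64 * B / U) * \sum_(i <- iota 0 L | 2 ^+ i <= 2 * B / (U * s ^+ 2)) Num.sqrt (2 ^+ i).
    rewrite mulr_sumr; apply: eq_bigr => i _; rewrite -sqrtrM ?divr_ge0 ?mulr_ge0 // 1?ltW //.
    by congr Num.sqrt; ring.
  apply: (@le_trans _ _ (480 * (Num.sqrt (72 * 64 * B / U) * (4 * Num.sqrt (2 * B / (U * s ^+ 2)))))).
    by apply: ler_wpM2l => //; apply: ler_wpM2l => //; exact: sqrtr_ge0.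
  have -> : Num.sqrt (72 * 64 * B / U) * (4 * Num.sqrt (2 * B / (U * s ^+ 2))) = 4 * (96 * B / (U * s)).
    rewrite mulrCA -sqrtrM ?divr_ge0 ?mulr_ge0 // 1?ltW //; congr (_ * _).
    have -> : 72 * 64 * B / U * (2 * B / (U * s ^+ 2)) = (96 * B / (U * s)) ^+ 2.
      by field; rewrite !gt_eqF.
    by rewrite sqrtr_sqr ger0_norm // divr_ge0 ?mulr_ge0 // ltW.
  by rewrite le_eqVlt; apply/orP; left; apply/eqP; field; rewrite !gt_eqF.
rewrite -mulr_suml.
apply: (@le_trans _ _ (c2 * (T * H * L%:R) * (2 * (2 * B / (U * s ^+ 2)) / (Num.sqrt U * s)))).
  apply: ler_wpM2l; first by rewrite !mulr_ge0.
  by apply: ler_wpM2r => //; rewrite invr_ge0 mulr_ge0 // ltW.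
rewrite -/c2; move: c2 c20 {G G0 inner} => c c0.
by rewrite le_eqVlt; apply/orP; left; apply/eqP; field; rewrite !gt_eqF.
Qed.

(** * Torsor points distributed over cells *)

Lemma up_log2_bounds (n : nat) : (0 < n)%N -> (n <= 2 ^ up_log 2 n < 2 * n)%N.
Proof.
case: n => [//|[//|n]] _.
have /andP[h1 h2] := @up_log_bounds 2 n.+2 isT isT.
rewrite h2 /=; case E : (up_log 2 n.+2) h1 h2 => [|k] //= h1 _.
by rewrite expnS ltn_pmul2l.
Qed.

Lemma trunc_log2_bounds (n : nat) : (0 < n)%N ->
  (2 ^ trunc_log 2 n <= n < 2 * 2 ^ trunc_log 2 n)%N.
Proof. by move=> n0; rewrite trunc_logP // -expnS trunc_log_ltn. Qed.

(* Either the sum [s] is comparable with the largest [a], and then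
   [s ^ 2 * a] controls [a ^ 3], or the two largest [a]'s nearly cancel. *)
Lemma smallest_bound (a b c s G : nat) (e1 e2 e3 : int) :
  (c <= b)%N -> (b <= a)%N -> `|e1|%N = a -> `|e2|%N = b -> `|e3|%N = c ->
  e1 + e2 + e3 = s%:Z -> (s ^ 2 * a <= G)%N -> (a * b * c <= G)%N ->
  (c * a ^ 2 <= 9 * G)%N.
Proof.
move=> cb ba E1 E2 E3 E sG abcG.
have [h|h] := leqP a (3 * s).
  have h2 : (a ^ 2 <= (3 * s) ^ 2)%N by rewrite leq_exp2r.
  apply: (@leq_trans (a * (3 * s) ^ 2)).
    by apply: leq_mul => //; exact: leq_trans cb ba.
  by rewrite expnMn mulnCA leq_mul2l mulnC sG orbT.
have h3 : (a <= 3 * b)%N by lia.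
apply: (@leq_trans (3 * (a * b * c))).
  have -> : (3 * (a * b * c) = c * (a * (3 * b)))%N by ring.
  rewrite -mulnn.
  by rewrite leq_mul2l leq_mul2l h3 !orbT.
by rewrite leq_mul //.
Qed.

(** Multiplied by [U Y^2], the height conditions read [S^2 m <= G] and [a1 a2 a3 <= G], where
    [S = U Y s] is the sum of the signed [a_i]. This is the form that [smallest_bound] takes. *)
Lemma torsor_pt_facts (R : realType) (B : R) (u1 u2 u3 s : nat) y t :
  (0 < u1)%N -> (0 < u2)%N -> (0 < u3)%N -> (0 < s)%N ->
  torsor_pt B u1 u2 u3 s (y, t) ->
  let a1 := (u1 * y.1.1 ^ 2 * `|t.1.1|)%N in
  let a2 := (u2 * y.1.2 ^ 2 * `|t.1.2|)%N in
  let a3 := (u3 * y.2 ^ 2 * `|t.2|)%N in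
  let m := maxn a1 a2 in
  let U := (u1 * u2 * u3)%N in
  let Y := (y.1.1 * y.1.2 * y.2)%N in
  [/\ (0 < m)%N, (U * Y * s <= 3 * m)%N, (U * s ^ 2 * m)%N%:R <= B &
      (a3 * m ^ 2)%N%:R <= 9 * (U * Y ^ 2)%N%:R * B].
Proof.
case: y t => [[y1 y2] y3] [[t1 t2] t3] u10 u20 u30 s0 /=.
move=> [/= /andP[/and3P[y10 y20 y30] _] E /and3P[t10 t20 t30] /andP[c1 c2] [h1 h2 h3]].
set a1 := (u1 * y1 ^ 2 * `|t1|)%N in c1 h1 *; set a2 := (u2 * y2 ^ 2 * `|t2|)%N in c2 h2 *.
set a3 := (u3 * y3 ^ 2 * `|t3|)%N in c1 c2 *.
set U := (u1 * u2 * u3)%N in E h1 h2 *; set Y := (y1 * y2 * y3)%N in E *.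
have aE (u y : nat) (t : int) : `|(u%:Z * t * y%:Z ^+ 2)%R|%N = (u * y ^ 2 * `|t|)%N.
  by rewrite abszM abszX abszM !absz_nat mulnAC.
pose S := (U * Y * s)%N.
have ES : u1%:Z * t1 * y1%:Z ^+ 2 + u2%:Z * t2 * y2%:Z ^+ 2 + u3%:Z * t3 * y3%:Z ^+ 2 = S%:Z.
  by rewrite E -PoszM.
have A1 := aE u1 y1 t1; have A2 := aE u2 y2 t2; have A3 := aE u3 y3 t3.
rewrite -/a1 in A1; rewrite -/a2 in A2; rewrite -/a3 in A3.
have mB : (U * s ^ 2 * maxn a1 a2)%N%:R <= B by rewrite /maxn; case: ifP.
have a10 : (0 < a1)%N by rewrite muln_gt0 absz_gt0 t10 andbT muln_gt0 u10 expn_gt0 y10.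
have SS : (S <= a1 + a2 + a3)%N.
  rewrite -lez_nat -ES !PoszD -A1 -A2 -A3 !abszE.
  by rewrite !lerD // ler_norm.
split=> //.
- by rewrite leq_max a10.
- apply: leq_trans SS _; rewrite mulSn mulSn mul1n addnA.
  by apply: leq_add; [apply: leq_add; [exact: leq_maxl | exact: leq_maxr] | rewrite leq_max c1].
have B0 : 0 <= B by exact: le_trans mB.
pose G := Num.truncn ((U * Y ^ 2)%N%:R * B).
have GB : G%:R <= (U * Y ^ 2)%N%:R * B by rewrite truncn_le mulr_ge0 ?ler0n.
have G1 : (S ^ 2 * maxn a1 a2 <= G)%N.
  rewrite truncn_ge_nat ?mulr_ge0 ?ler0n //.
  have -> : (S ^ 2 * maxn a1 a2 = (U * Y ^ 2) * (U * s ^ 2 * maxn a1 a2))%N by rewrite /S; ring.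
  by rewrite natrM ler_wpM2l.
have G2 : (a1 * a2 * a3 <= G)%N.
  rewrite truncn_ge_nat ?mulr_ge0 ?ler0n //.
  have -> : (a1 * a2 * a3 = (U * Y ^ 2) * (`|t1| * `|t2| * `|t3|))%N.
    by rewrite /a1 /a2 /a3 /U /Y; ring.
  by rewrite natrM ler_wpM2l.
suff H : (a3 * maxn a1 a2 ^ 2 <= 9 * G)%N.
  rewrite -mulrA; apply: (@le_trans _ _ (9 * G)%N%:R); first by rewrite ler_nat.
  by rewrite natrM ler_wpM2l.
case: (leqP a1 a2) G1 => le G1.
  apply: (@smallest_bound a2 a1 a3 S G _ _ _ c1 le A2 A1 A3) => //.
    by rewrite -ES; ring.
  by rewrite (mulnC a2 a1).
by apply: (@smallest_bound a1 a2 a3 S G _ _ _ c2 (ltnW le) A1 A2 A3).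
Qed.

(** The [y_i] are rounded down and the larger of [a1], [a2] is rounded up to powers of two. As the
    [t_i] are nonzero, the box bounds on them also bound the [D_i], as the cell count requires. *)
Lemma torsor_pt_cell (R : realType) (B : R) (u1 u2 u3 s : nat) y t :
  (0 < u1)%N -> (0 < u2)%N -> (0 < u3)%N -> (0 < s)%N ->
  torsor_pt B u1 u2 u3 s (y, t) ->
  let k1 := trunc_log 2%N y.1.1 in let k2 := trunc_log 2%N y.1.2 in
  let k3 := trunc_log 2%N y.2 in
  let kA := up_log 2%N (maxn (u1 * y.1.1 ^ 2 * `|t.1.1|)%N (u2 * y.1.2 ^ 2 * `|t.1.2|)%N) in
  let U : R := (u1 * u2 * u3)%N%:R in
  let Y : R := 2 ^+ k1 * 2 ^+ k2 * 2 ^+ k3 in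
  let C := cellC B U Y (2 ^+ kA) in
  [/\ cell u1 u2 u3 (2 ^ k1) (2 ^ k2) (2 ^ k3) s%:Z (2 ^+ kA) C (y, t),
     U * Y * s%:R <= 3 * 2 ^+ kA,
     U * s%:R ^+ 2 * 2 ^+ kA <= 2 * B &
     [/\ (u1 * (2 ^ k1) ^ 2)%N%:R <= (2 : R) ^+ kA, (u2 * (2 ^ k2) ^ 2)%N%:R <= (2 : R) ^+ kA &
        (u3 * (2 ^ k3) ^ 2)%N%:R <= C]].
Proof.
move=> u10 u20 u30 s0 P.
have [] := torsor_pt_facts u10 u20 u30 s0 P.
move: P => [/andP[/and3P[y10 y20 y30] cop] E /and3P[t10 t20 t30] /andP[c1 c2] _].
set a1 := (u1 * y.1.1 ^ 2 * `|t.1.1|)%N in c1 *; set a2 := (u2 * y.1.2 ^ 2 * `|t.1.2|)%N in c2 *.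
set a3 := (u3 * y.2 ^ 2 * `|t.2|)%N in c1 c2 *.
set m := maxn a1 a2; set UN := (u1 * u2 * u3)%N.
move=> m0 Um mB cB k1 k2 k3 kA U Y C.
have /andP[l1 r1] := trunc_log2_bounds y10; rewrite -/k1 in l1 r1.
have /andP[l2 r2] := trunc_log2_bounds y20; rewrite -/k2 in l2 r2.
have /andP[l3 r3] := trunc_log2_bounds y30; rewrite -/k3 in l3 r3.
have /andP[lA rA] := up_log2_bounds m0; rewrite -/kA in lA rA.
have A0 : (0 : R) < 2 ^+ kA by rewrite exprn_gt0.
have mA : m%:R <= (2 : R) ^+ kA by rewrite -natrX ler_nat.
have Am : (2 : R) ^+ kA <= 2 * m%:R by rewrite -natrX -natrM ler_nat ltnW.
have U0 : 0 < U by rewrite ltr0n !muln_gt0 u10 u20.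
have sub (u k z : nat) (w : int) : (2 ^ k <= z)%N -> (`|w| * (u * (2 ^ k) ^ 2) <= u * z ^ 2 * `|w|)%N.
  by move=> h; rewrite mulnC leq_mul2r leq_mul2l leq_exp2r // h !orbT.
have d1 : (`|t.1.1| * (u1 * (2 ^ k1) ^ 2))%N%:R <= (2 : R) ^+ kA.
  by apply: le_trans mA; rewrite ler_nat (leq_trans (sub _ _ _ _ l1)) // leq_maxl.
have d2 : (`|t.1.2| * (u2 * (2 ^ k2) ^ 2))%N%:R <= (2 : R) ^+ kA.
  by apply: le_trans mA; rewrite ler_nat (leq_trans (sub _ _ _ _ l2)) // leq_maxr.
have YN : Y = (2 ^ k1 * 2 ^ k2 * 2 ^ k3)%N%:R by rewrite !natrM !natrX.
have a3C : a3%:R <= C.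
  rewrite /C /cellC le_min; apply/andP; split.
    by apply: le_trans mA; rewrite ler_nat leq_max c1.
  rewrite ler_pdivlMr ?exprn_gt0 //.
  (* Rounding [m] up costs 4 in the square, and rounding the three [y_i] down costs 64. *)
  have A2 : (2 : R) ^+ kA ^+ 2 <= 4 * m%:R ^+ 2.
    have -> : 4 * m%:R ^+ 2 = (2 * m%:R) ^+ 2 :> R by ring.
    by rewrite ler_sqr ?nnegrE // ?mulr_ge0 // ltW.
  apply: (@le_trans _ _ (4 * (a3%:R * m%:R ^+ 2))).
    have -> : 4 * (a3%:R * m%:R ^+ 2) = a3%:R * (4 * m%:R ^+ 2) :> R by ring.
    by rewrite ler_wpM2l.
  have B0 : 0 <= B by exact: le_trans mB.
  have cB' : a3%:R * m%:R ^+ 2 <= 9 * (UN * (y.1.1 * y.1.2 * y.2) ^ 2)%N%:R * B.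
    by rewrite -natrX -natrM.
  have yY : ((y.1.1 * y.1.2 * y.2) ^ 2)%N%:R <= 64 * Y ^+ 2 :> R.
    have -> : 64 * Y ^+ 2 = (((2 * 2 ^ k1) * (2 * 2 ^ k2) * (2 * 2 ^ k3)) ^ 2)%N%:R.
      by rewrite YN natrX !natrM; ring.
    rewrite ler_nat leq_exp2r //.
    by apply: leq_mul; [apply: leq_mul|]; exact: ltnW.
  have k : 9 * (UN * (y.1.1 * y.1.2 * y.2) ^ 2)%N%:R * B <= 9 * (U * (64 * Y ^+ 2)) * B.
    by rewrite ler_wpM2r // ler_wpM2l // natrM ler_wpM2l.
  have Y0 : 0 <= Y by rewrite YN ler0n.
  have W0 : 0 <= 64 * B * U * Y ^+ 2 by nonneg.
  have -> : 72 * 64 * B * U * Y ^+ 2 = 72 * (64 * B * U * Y ^+ 2) by ring.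
  have k' : 9 * (U * (64 * Y ^+ 2)) * B = 9 * (64 * B * U * Y ^+ 2) by ring.
  apply: le_trans (ler_wpM2l (ler0n _ 4) (le_trans cB' k)) _; rewrite k'.
  by move: (64 * B * U * Y ^+ 2) W0 => W W0; clear -W0; lra.
have d3 : (`|t.2| * (u3 * (2 ^ k3) ^ 2))%N%:R <= C.
  by apply: le_trans a3C; rewrite ler_nat sub.
have drop (w : int) (D : nat) (x : R) : w != 0 -> (`|w| * D)%N%:R <= x -> D%:R <= x.
  by move=> tn; apply: le_trans; rewrite ler_nat leq_pmull // absz_gt0.
split.
- split=> //=; first by rewrite /dyadic_box /= l1 r1 l2 r2 l3 r3.
  by rewrite -!natrM; split.
- apply: le_trans (ler_wpM2l (ler0n _ 3) mA); rewrite YN -!natrM ler_nat.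
  apply: leq_trans Um; rewrite leq_mul2r leq_mul2l; apply/orP; right; apply/orP; right.
  by apply: leq_mul => //; apply: leq_mul.
- apply: (@le_trans _ _ (U * s%:R ^+ 2 * (2 * m%:R))).
    by rewrite ler_wpM2l // mulr_ge0 ?sqr_ge0 // ltW.
  by move: mB; rewrite natrM natrM natrX -/U; clear; lra.
split; first exact: drop d1.
  exact: drop d2.
exact: drop d3.
Qed.

Lemma torsor_pt_sum_le (R : realType) (B : R) (u1 u2 u3 s n : nat) :
  (0 < u1)%N -> (0 < u2)%N -> (0 < u3)%N -> (0 < s)%N -> 1 <= B -> 8 * B <= n%:R ->
  let L := (trunc_log 2%N (Num.truncn B)).+2 in
  let U : R := (u1 * u2 * u3)%N%:R in
  let T : R := (size (divisors u1) + size (divisors u2) + size (divisors u3))%N%:R in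
  card_le (torsor_pt B u1 u2 u3 s)
   (\sum_(kA <- iota 0 L) \sum_(k1 <- iota 0 L) \sum_(k2 <- iota 0 L) \sum_(k3 <- iota 0 L)
    (if (U * (2 ^+ k1 * 2 ^+ k2 * 2 ^+ k3) * s%:R <= 3 * 2 ^+ kA) &&
        (U * s%:R ^+ 2 * 2 ^+ kA <= 2 * B)
     then cell_val B U T (harm R n ^+ 3) s%:R (2 ^+ k1 * 2 ^+ k2 * 2 ^+ k3) (2 ^+ kA) else 0)).
Proof.
move=> u10 u20 u30 s0 B1 nB L U T.
have B0 : 0 < B by exact: lt_le_trans B1.
have U1 : 1 <= U by rewrite ler1n !muln_gt0 u10 u20.
have U0 : 0 < U by exact: lt_le_trans U1.
have sR : (0 : R) < s%:R by rewrite ltr0n.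
have mN (m : nat) : (0 < m)%N -> (u1 * u2 * u3 * s ^ 2 * m)%N%:R <= B -> (m <= Num.truncn B)%N.
  move=> m0 h; rewrite truncn_ge_nat ?(ltW B0) //; apply: le_trans h.
  by rewrite ler_nat leq_pmull // -mulnn !muln_gt0 u10 u20 u30 s0.
have inL k m : (0 < m <= Num.truncn B)%N -> (2 ^ k <= m)%N -> k \in iota 0 L.
  move=> /andP[m0 mB] km; rewrite mem_iota /= add0n /L ltnS leqW //.
  by apply: trunc_log_max => //; exact: leq_trans mB.
have yL (y : nat * nat * nat) (t : int * int * int) : torsor_pt B u1 u2 u3 s (y, t) ->
   [/\ up_log 2%N (maxn (u1 * y.1.1 ^ 2 * `|t.1.1|)%N (u2 * y.1.2 ^ 2 * `|t.1.2|)%N) \in iota 0 L,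
       trunc_log 2%N y.1.1 \in iota 0 L, trunc_log 2%N y.1.2 \in iota 0 L &
       trunc_log 2%N y.2 \in iota 0 L].
  move=> P; have [m0 _ mB _] := torsor_pt_facts u10 u20 u30 s0 P.
  have [/andP[/and3P[y10 y20 y30] _] _ /and3P[t10 t20 t30] /andP[c1 c2] _] := P.
  set m := maxn _ _ in m0 mB *.
  have mB' := mN _ m0 mB.
  have ya (u z : nat) (w : int) : (0 < u)%N -> w != 0 -> (z <= u * z ^ 2 * `|w|)%N.
    move=> u0 w0; rewrite -mulnA; apply: leq_trans (_ : z <= z ^ 2)%N _.
      by case: (z) => // z'; rewrite -mulnn leq_pmulr.
    by rewrite mulnCA leq_pmulr // muln_gt0 u0 absz_gt0.
  have ym (z : nat) : (0 < z)%N -> (z <= m)%N -> trunc_log 2 z \in iota 0 L.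
    move=> z0 zm; apply: (inL _ z); last exact: trunc_logP.
    by rewrite z0 (leq_trans zm mB').
  split; [|apply: ym => //..].
  (* The rounded-up logarithm can exceed [trunc_log] by one, hence the [.+2] in [L]. *)
  - rewrite mem_iota /= add0n /L ltnS.
    apply: up_log_min => //; apply: leq_trans mB' _.
    by apply: ltnW; exact: trunc_log_ltn.
  - by apply: leq_trans (ya u1 _ _ u10 t10) _; exact: leq_maxl.
  - by apply: leq_trans (ya u2 _ _ u20 t20) _; exact: leq_maxr.
  - by apply: leq_trans (ya u3 _ _ u30 t30) _; apply: leq_trans c1 _; exact: leq_maxl.
pose fA (x : (nat * nat * nat) * (int * int * int)) :=
  up_log 2%N (maxn (u1 * x.1.1.1 ^ 2 * `|x.2.1.1|)%N (u2 * x.1.1.2 ^ 2 * `|x.2.1.2|)%N).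
apply: (@card_le_fib R _ _ fA) => [[y t] /yL[]//|kA _].
apply: (@card_le_fib R _ _ (fun x => trunc_log 2%N x.1.1.1)) => [[y t] [/yL[]//]|k1 _].
apply: (@card_le_fib R _ _ (fun x => trunc_log 2%N x.1.1.2)) => [[y t] [[/yL[]//]]|k2 _].
apply: (@card_le_fib R _ _ (fun x => trunc_log 2%N x.1.2)) => [[y t] [[[/yL[]//]]]|k3 _].
set P := fun x : (nat * nat * nat) * (int * int * int) => _ /\ _.
have Pcell x : P x -> torsor_pt B u1 u2 u3 s x /\
   [/\ fA x = kA, trunc_log 2%N x.1.1.1 = k1, trunc_log 2%N x.1.1.2 = k2 & trunc_log 2%N x.1.2 = k3].
  by move=> [[[[]]]].
have Y0 : (0 : R) < 2 ^+ k1 * 2 ^+ k2 * 2 ^+ k3 by rewrite !mulr_gt0 ?exprn_gt0.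
have A0 : (0 : R) < 2 ^+ kA by rewrite exprn_gt0.
(* A point of the cell supplies the hypotheses of [cell_bound]; for an empty cell it is enough that
   the summand is nonnegative. *)
case: (pselect (exists x, P x)) => [[[y t] Px]|nex]; last first.
  apply: card_le_void => [|x Px]; last by apply: nex; exists x.
  case: ifP => // _; rewrite /cell_val.
  have sU : 0 <= Num.sqrt U by exact: sqrtr_ge0.
  have H0 := @harm_ge0 R n; have T0 : 0 <= T by exact: ler0n.
  apply: addr_ge0; last by nonneg.
  apply: addr_ge0; first exact: ltW.
  by apply: mulr_ge0 => //; rewrite le_min; apply/andP; split; nonneg.
have [tP [/= eA e1 e2 e3]] := Pcell _ Px.
have [_ h1 h2 [h3 h4 h5]] := torsor_pt_cell u10 u20 u30 s0 tP.
rewrite -[up_log _ _]/(fA (y, t)) eA e1 e2 e3 -/U in h1 h2 h3 h4 h5.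
rewrite h1 h2 /=; set Y : R := 2 ^+ k1 * 2 ^+ k2 * 2 ^+ k3 in Y0 h1 h5 *.
set C := cellC B U Y (2 ^+ kA) in h5.
have CA : C <= 2 ^+ kA by rewrite /C /cellC ge_min lexx.
have A2B : (2 : R) ^+ kA <= 2 * B.
  apply: le_trans h2; rewrite ler_peMl ?(ltW A0) //.
  have : (1 : R) <= s%:R by rewrite ler1n.
  move=> s1; have : (1 : R) <= s%:R ^+ 2 by rewrite exprn_ege1.
  by move=> s2; apply: le_trans U1 _; rewrite ler_peMr // ltW.
have An : 4 * (2 : R) ^+ kA <= n%:R by lra.
have p0 k : (0 < 2 ^ k)%N by rewrite expn_gt0.
have H := @cell_bound R u1 u2 u3 _ _ _ n s%:Z _ _ u10 u20 u30 (p0 k1) (p0 k2) (p0 k3) h3 h4 h5 CA An.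
apply: card_le_sub H _.
  move=> [y' t'] /Pcell[tP' [/= eA' e1' e2' e3']].
  have [+ _ _ _] := torsor_pt_cell u10 u20 u30 s0 tP'.
  by rewrite -[up_log _ _]/(fA (y', t')) eA' e1' e2' e3' -/U.
apply: le_trans (cell_val_ge B0 U0 (ler0n _ _) (exprn_ge0 3 (harm_ge0 R n)) sR Y0 A0 h2).
rewrite -/T -/C.
have E1 : (2 ^ k1)%N%:R * (2 ^ k2)%N%:R * (2 ^ k3)%N%:R = Y by rewrite !natrX.
have E2 : (u1 * (2 ^ k1) ^ 2)%N%:R * (u2 * (2 ^ k2) ^ 2)%N%:R * (u3 * (2 ^ k3) ^ 2)%N%:R = U * Y ^+ 2.
  by rewrite -E1 /U !natrM; ring.
by rewrite E1 E2.
Qed.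

(** * Summation over [u] and [s] *)

Definition torsor_set (R : realType) (B : R)
    (x : (nat * nat * nat * nat) * ((nat * nat * nat) * (int * int * int))) : Prop :=
  let: (u1, u2, u3, s) := x.1 in
  [&& (0 < u1)%N, (0 < u2)%N, (0 < u3)%N & (0 < s)%N] /\ torsor_pt B u1 u2 u3 s x.2.

Lemma sum4_prod (R : realType) (l : seq nat) (f g h k : nat -> R) :
  \sum_(a <- l) \sum_(b <- l) \sum_(c <- l) \sum_(d <- l) (f a * g b * h c * k d) =
  (\sum_(a <- l) f a) * (\sum_(a <- l) g a) * (\sum_(a <- l) h a) * (\sum_(a <- l) k a).
Proof.
under eq_bigr => a _ do under eq_bigr => b _ do under eq_bigr => c _ do rewrite -mulr_sumr.
under eq_bigr => a _ do under eq_bigr => b _ do rewrite -mulr_suml -mulr_sumr.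
under eq_bigr => a _ do rewrite -mulr_suml -mulr_suml -mulr_sumr.
by rewrite -!mulr_suml.
Qed.

Lemma sum4_lin (R : realType) (l : seq nat) (x y : R) (F G : nat -> nat -> nat -> nat -> R) :
  \sum_(a <- l) \sum_(b <- l) \sum_(c <- l) \sum_(d <- l) (x * F a b c d + y * G a b c d) =
  x * (\sum_(a <- l) \sum_(b <- l) \sum_(c <- l) \sum_(d <- l) F a b c d) +
  y * (\sum_(a <- l) \sum_(b <- l) \sum_(c <- l) \sum_(d <- l) G a b c d).
Proof.
rewrite !mulr_sumr -big_split; apply: eq_bigr => a _.
rewrite !mulr_sumr -big_split; apply: eq_bigr => b _.
rewrite !mulr_sumr -big_split; apply: eq_bigr => c _.
by rewrite !mulr_sumr -big_split.
Qed.

(** The volume term sums to four harmonic sums. In the other term the weights [u^(-3/2)] have sum at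
    most 3, and at most 9 against the divisor count; each of the three summands of [T] thus gives
    [9 * 27], together [9 * 81]. *)
Lemma torsor_set_sum_le (R : realType) (B : R) (n : nat) :
  1 <= B -> 8 * B <= n%:R -> (0 < n)%N ->
  let N := Num.truncn B in
  let L := (trunc_log 2%N N).+2 in
  card_le (torsor_set B) (L%:R ^+ 2 * B * (120 * 16 * 96 * harm R N ^+ 4 +
     4 * (6 + 120 * 257 * 7) * (harm R n ^+ 3 * L%:R * (9 * 81)))).
Proof.
move=> B1 nB n0 N L.
have B0 : 0 < B by exact: lt_le_trans B1.
pose H := harm R n ^+ 3.
have h1 : 1 <= harm R n.
  rewrite /harm; case: (n) n0 => // n' _; rewrite /= big_cons invr1 lerDl.
  by apply: sumr_ge0 => i _; rewrite invr_ge0.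
have H1 : 1 <= H by rewrite /H exprn_ege1.
have H0 : 0 <= H by exact: le_trans H1.
have L1 : (0 < L)%N by [].
pose tau (u : nat) : R := (size (divisors u))%:R.
pose w (u : nat) : R := (u%:R * Num.sqrt u%:R)^-1.
have w0 u : 0 <= w u by rewrite invr_ge0 mulr_ge0 ?sqrtr_ge0.
pose F (u1 u2 u3 s : nat) : R := L%:R ^+ 2 * B * (120 * 16 * 96 * (u1%:R^-1 * u2%:R^-1 * u3%:R^-1 * s%:R^-1) +
   4 * (6 + 120 * 257 * 7) * (H * L%:R * ((tau u1 + tau u2 + tau u3) * (w u1 * w u2 * w u3 * w s)))).
have : card_le (torsor_set B) (\sum_(u1 <- iota 1 N) \sum_(u2 <- iota 1 N)
    \sum_(u3 <- iota 1 N) \sum_(s <- iota 1 N) F u1 u2 u3 s).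
  have bnd u1 u2 u3 s y : torsor_set B ((u1, u2, u3, s), y) ->
      [/\ u1 \in iota 1 N, u2 \in iota 1 N, u3 \in iota 1 N & s \in iota 1 N].
    case: y => y t [/and4P[u10 u20 u30 s0] P].
    have [m0 _ mB _] := torsor_pt_facts u10 u20 u30 s0 P.
    set m := maxn _ _ in m0 mB.
    have le k : (0 < k)%N -> (k <= u1 * u2 * u3 * s ^ 2 * m)%N -> k \in iota 1 N.
      move=> k0 h; rewrite mem_iota k0 add1n ltnS /N truncn_ge_nat ?(ltW B0) //.
      by apply: le_trans mB; rewrite ler_nat.
    have s20 : (0 < s ^ 2)%N by rewrite expn_gt0 s0.
    split; apply: le => //.
    - have -> : (u1 * u2 * u3 * s ^ 2 * m = u1 * (u2 * (u3 * (s ^ 2 * m))))%N by ring.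
      by rewrite leq_pmulr // muln_gt0 u20 muln_gt0 u30 muln_gt0 s20 m0.
    - have -> : (u1 * u2 * u3 * s ^ 2 * m = u2 * (u1 * (u3 * (s ^ 2 * m))))%N by ring.
      by rewrite leq_pmulr // muln_gt0 u10 muln_gt0 u30 muln_gt0 s20 m0.
    - have -> : (u1 * u2 * u3 * s ^ 2 * m = u3 * (u1 * (u2 * (s ^ 2 * m))))%N by ring.
      by rewrite leq_pmulr // muln_gt0 u10 muln_gt0 u20 muln_gt0 s20 m0.
    - have -> : (u1 * u2 * u3 * s ^ 2 * m = s * (u1 * (u2 * (u3 * (s * m)))))%N by ring.
      by rewrite leq_pmulr // muln_gt0 u10 muln_gt0 u20 muln_gt0 u30 muln_gt0 s0 m0.
  apply: (@card_le_fib R _ _ (fun x => x.1.1.1.1)) => [[[[[a b] c] d] y] /bnd[]//|u1 + ].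
  rewrite mem_iota => /andP[u10 _].
  apply: (@card_le_fib R _ _ (fun x => x.1.1.1.2)) => [[[[[a b] c] d] y] [/bnd[]//]|u2 + ].
  rewrite mem_iota => /andP[u20 _].
  apply: (@card_le_fib R _ _ (fun x => x.1.1.2)) => [[[[[a b] c] d] y] [[/bnd[]//]]|u3 + ].
  rewrite mem_iota => /andP[u30 _].
  apply: (@card_le_fib R _ _ (fun x => x.1.2)) => [[[[[a b] c] d] y] [[[/bnd[]//]]]|s + ].
  rewrite mem_iota => /andP[s0 _].
  apply: (@card_le_inj R _ _ snd _ (torsor_pt B u1 u2 u3 s)).
  - move=> [[[[a b] c] d] y] [[[[a' b'] c'] d'] y'].
    by move=> [[[[_ /= ->] ->] ->] ->] [[[[_ /= ->] ->] ->] ->] ->.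
  - move=> [[[[a b] c] d] y] [[[[[_ P] /= ea] eb] ec] ed] /=.
    by move: P; rewrite /= ea eb ec ed.
  apply: card_le_mono (torsor_pt_sum_le u10 u20 u30 s0 B1 nB) _.
  have U1 : 1 <= (u1 * u2 * u3)%N%:R :> R by rewrite ler1n !muln_gt0 u10 u20.
  have s1 : 1 <= s%:R :> R by rewrite ler1n.
  set T : R := (_ + _ + _)%N%:R.
  have TE : T = tau u1 + tau u2 + tau u3 by rewrite /T !natrD.
  have T1 : 1 <= T.
    rewrite /T ler1n -addnA addn_gt0; apply/orP; left.
    by rewrite -has_predT; apply/hasP; exists 1%N => //; rewrite -dvdn_divisors.
  have TH1 : 1 <= T * H by rewrite -[leLHS]mulr1; apply: ler_pM.
  have T0 : 0 <= T by exact: le_trans T1.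
  apply: le_trans (@sum_cell_val_le R B _ T H _ L B0 U1 TH1 T0 H0 s1 L1) _.
  rewrite /F; apply: ler_wpM2l; first by rewrite mulr_ge0 ?exprn_ge0 // ltW.
  have p (k : nat) : (0 < k)%N -> (0 : R) < k%:R by rewrite ltr0n.
  have q (k : nat) : (0 < k)%N -> (0 : R) < Num.sqrt k%:R by move=> k0; rewrite sqrtr_gt0 p.
  apply: lerD.
    rewrite le_eqVlt; apply/orP; left; apply/eqP; rewrite !natrM; field.
    by rewrite !gt_eqF ?p.
  rewrite -[leLHS]mulrA; apply: ler_wpM2l; first by nonneg.
  rewrite -TE.
  have -> : T * H * L%:R / ((u1 * u2 * u3)%N%:R * Num.sqrt (u1 * u2 * u3)%N%:R * s%:R ^+ 3) =
     H * L%:R * (T * (w u1 * w u2 * w u3 * (s%:R ^+ 3)^-1)).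
    rewrite !natrM !sqrtrM ?mulr_ge0 ?ler0n // /w; field.
    by rewrite !gt_eqF ?p ?q.
  apply: ler_wpM2l; first by rewrite mulr_ge0.
  apply: ler_wpM2l => //; apply: ler_wpM2l; first by rewrite !mulr_ge0.
  (* [s^3] is weakened to [s sqrt s], so that all four variables carry the same weight [w]. *)
  rewrite /w lef_pV2 ?posrE ?mulr_gt0 ?exprn_gt0 ?p ?q //.
  have ss : Num.sqrt s%:R <= s%:R :> R.
    have h : s%:R <= s%:R ^+ 2 :> R by rewrite expr2 ler_peMr.
    by apply: le_trans (ler_wsqrtr h) _; rewrite sqrtr_sqr ger0_norm.
  rewrite exprS; apply: ler_wpM2l => //; apply: le_trans ss _.
  by rewrite expr2 ler_peMr.
move=> Hc; apply: card_le_mono Hc _.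
pose C := L%:R ^+ 2 * B.
have C0 : 0 <= C by rewrite mulr_ge0 ?exprn_ge0 // ltW.
pose X : R := 120 * 16 * 96; pose Z : R := 4 * (6 + 120 * 257 * 7).
have Z0 : 0 <= Z by rewrite /Z; lra.
pose T3 (a b c d : nat) : R := 1 * (tau a * w a * w b * w c * w d) +
  1 * (1 * (w a * (tau b * w b) * w c * w d) + 1 * (w a * w b * (tau c * w c) * w d)).
have -> : \sum_(u1 <- iota 1 N) \sum_(u2 <- iota 1 N) \sum_(u3 <- iota 1 N)
    \sum_(s <- iota 1 N) F u1 u2 u3 s =
  \sum_(u1 <- iota 1 N) \sum_(u2 <- iota 1 N) \sum_(u3 <- iota 1 N)
    \sum_(s <- iota 1 N) ((C * X) * (u1%:R^-1 * u2%:R^-1 * u3%:R^-1 * s%:R^-1) +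
       (C * Z * H * L%:R) * T3 u1 u2 u3 s).
  apply: eq_bigr => a _; apply: eq_bigr => b _; apply: eq_bigr => c _; apply: eq_bigr => d _.
  by rewrite /F /T3 -/C -/X -/Z; ring.
rewrite sum4_lin sum4_prod /T3 sum4_lin sum4_lin !sum4_prod.
have hs : \sum_(s <- iota 1 N) s%:R^-1 = harm R N by [].
pose W : R := \sum_(u <- iota 1 N) w u.
pose TW : R := \sum_(u <- iota 1 N) tau u * w u.
have W3 : W <= 3 by exact: sum_inv_pow32_le.
have TW9 : TW <= 9 by exact: sum_tau_pow32_le.
have W0 : 0 <= W by apply: sumr_ge0.
have TW0 : 0 <= TW by apply: sumr_ge0 => u _; rewrite mulr_ge0 ?ler0n.
rewrite -/TW -/W !mul1r -/C -/X -/Z hs.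
have -> : C * (X * harm R N ^+ 4 + Z * (harm R n ^+ 3 * L%:R * (9 * 81))) =
   C * X * (harm R N * harm R N * harm R N * harm R N) + C * Z * H * L%:R * (9 * 81).
  by rewrite /H; ring.
rewrite lerD2l; apply: ler_wpM2l; first by nonneg.
have W2 : W * W <= 9 by have := ler_pM W0 W0 W3 W3; lra.
have WW0 : 0 <= W * W by rewrite mulr_ge0.
have W3' : W * W * W <= 27 by have := ler_pM WW0 W0 W2 W3; lra.
have WWW0 : 0 <= W * W * W by rewrite mulr_ge0.
have := ler_pM TW0 WWW0 TW9 W3'.
have -> : TW * W * W * W = TW * (W * W * W) by ring.
have -> : W * TW * W * W = TW * (W * W * W) by ring.
have -> : W * W * TW * W = TW * (W * W * W) by ring.
by move: (TW * (W * W * W)) => z; clear; lra.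
Qed.

Lemma ln2_ge (R : realType) : 1 / 2 <= ln (2 : R).
Proof.
have h : ln (1 + - (1 / 2)) <= - (1 / 2) :> R by apply: le_ln1Dx; lra.
have E : 1 + - (1 / 2) = 2^-1 :> R by lra.
by rewrite E lnV ?posrE // in h; lra.
Qed.

Lemma harm_le (R : realType) (n : nat) : (0 < n)%N -> harm R n <= 1 + ln (n%:R : R).
Proof.
case: n => // n _; elim: n => [|n IH]; first by rewrite /harm /= big_seq1 invr1 ln1 addr0.
have -> : harm R n.+2 = harm R n.+1 + n.+2%:R^-1.
  rewrite /harm; have -> : iota 1 n.+2 = iota 1 n.+1 ++ [:: n.+2].
    by have := iotaD 1 n.+1 1; rewrite addn1 add1n.
  by rewrite big_cat big_seq1.
apply: le_trans (lerD IH (lexx _)) _; rewrite -addrA lerD2l.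
have x0 : (0 : R) < n.+1%:R by rewrite ltr0n.
have y0 : (0 : R) < n.+2%:R by rewrite ltr0n.
have h : ln (1 + - n.+2%:R^-1) <= - n.+2%:R^-1 :> R.
  apply: le_ln1Dx; rewrite ltrN2 invf_lt1 // ltr1n //.
have E : 1 + - n.+2%:R^-1 = n.+1%:R / n.+2%:R :> R.
  by rewrite -[n.+1%:R](addrK 1) natr1 mulrBl divff ?mul1r // gt_eqF.
rewrite E ln_div ?posrE // in h.
move: (ln (n.+1%:R : R)) (ln (n.+2%:R : R)) (n.+2%:R^-1 : R) h => x y z h.
by clear -h; lra.
Qed.

Lemma torsor_set_le (R : realType) : exists2 c : R, 0 < c &
  forall B : R, 2 <= B -> card_le (torsor_set B) (c * (B * ln B ^+ 6)).
Proof.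
pose X : R := 120 * 16 * 96; pose Z : R := 4 * (6 + 120 * 257 * 7).
have X0 : 0 < X by rewrite /X; lra.
have Z0 : 0 < Z by rewrite /Z; lra.
exists (6 ^+ 2 * (X * 7 ^+ 4 + Z * (7 ^+ 3 * 6 * (9 * 81)))).
  apply: mulr_gt0; first by rewrite exprn_gt0.
  apply: addr_gt0; apply: mulr_gt0 => //; first by rewrite exprn_gt0.
  by apply: mulr_gt0; rewrite mulr_gt0 // exprn_gt0.
move=> B B2; have B0 : 0 < B by lra.
have B1 : 1 <= B by lra.
pose N := Num.truncn B.
have N2 : (2 <= N)%N by rewrite truncn_ge_nat // ltW.
have NB : N%:R <= B by rewrite truncn_le ltW.
have BN : B <= N%:R + 1 by rewrite natr1 ltW // truncnS_gt.
pose n := (8 * N.+1)%N.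
have nB : 8 * B <= n%:R by rewrite natrM -natr1; lra.
have := torsor_set_sum_le B1 nB isT; rewrite -/N.
set L := (trunc_log 2 N).+2; rewrite -/X -/Z => H; apply: card_le_mono H _.
have l2 := ln2_ge R.
have lB : ln 2 <= ln B by rewrite ler_ln ?posrE.
(* [b >= 1 / 2] absorbs additive constants: [1 + 5 b <= 7 b] for the harmonic sums, and
   [2 b + 2 <= 6 b] for [L]. *)
pose b := ln B; have b0 : 1 / 2 <= b by rewrite /b; lra.
have lnle (m : nat) : (0 < m)%N -> m%:R <= 16 * B -> ln (m%:R : R) <= 5 * b.
  move=> m0 mB; have m0R : (0 : R) < m%:R by rewrite ltr0n.
  have : ln (m%:R : R) <= ln (16 * B) by rewrite ler_ln ?posrE // mulr_gt0.
  rewrite lnM ?posrE // -/b.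
  have -> : 16 = 2 ^+ 4 :> R by ring.
  rewrite lnXn // -(mulr_natl (ln 2)); rewrite -/b in lB; lra.
have hn : harm R n <= 7 * b.
  apply: le_trans (harm_le R (isT : (0 < n)%N)) _.
  have : ln (n%:R : R) <= 5 * b.
    apply: lnle => //; rewrite natrM -natr1.
    have : (1 : R) <= N%:R by rewrite ler1n ltnW.
    lra.
  lra.
have hN : harm R N <= 7 * b.
  apply: le_trans (harm_le R (ltnW N2)) _.
  have : ln (N%:R : R) <= 5 * b by apply: lnle; [exact: ltnW | lra].
  lra.
have LB : L%:R <= 6 * b.
  rewrite /L -[(_.+2)%N]addn2 natrD.
  have t2 : (2 : R) ^+ trunc_log 2 N <= B.
    by apply: le_trans NB; rewrite -natrX ler_nat trunc_logP // ltnW.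
  have : ln ((2 : R) ^+ trunc_log 2 N) <= b by rewrite ler_ln ?posrE // exprn_gt0.
  rewrite lnXn // -(mulr_natl (ln 2)).
  have tl0 : (0 : R) <= (trunc_log 2 N)%:R by exact: ler0n.
  move: ((trunc_log 2 N)%:R : R) tl0 => t t0 h.
  have : t * (1 / 2) <= t * ln 2 by rewrite ler_wpM2l.
  lra.
have hn0 := harm_ge0 R n; have hN0 := harm_ge0 R N; have L0 : (0 : R) <= L%:R by exact: ler0n.
have b00 : 0 <= b by lra.
have e1 : L%:R ^+ 2 <= (6 * b) ^+ 2 by rewrite ler_sqr ?nnegrE // mulr_ge0.
have e2 : harm R N ^+ 4 <= (7 * b) ^+ 4 by rewrite ler_pXn2r ?nnegrE // mulr_ge0.
have e3 : harm R n ^+ 3 <= (7 * b) ^+ 3 by rewrite ler_pXn2r ?nnegrE // mulr_ge0.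
have e4 : harm R n ^+ 3 * L%:R <= (7 * b) ^+ 3 * (6 * b).
  by apply: ler_pM => //; rewrite exprn_ge0.
have -> : 6 ^+ 2 * (X * 7 ^+ 4 + Z * (7 ^+ 3 * 6 * (9 * 81))) * (B * b ^+ 6) =
  (6 * b) ^+ 2 * B * (X * (7 * b) ^+ 4 + Z * ((7 * b) ^+ 3 * (6 * b) * (9 * 81))) by ring.
apply: ler_pM.
- by rewrite mulr_ge0 ?exprn_ge0 // ltW.
- apply: addr_ge0; first by rewrite mulr_ge0 ?exprn_ge0 // ltW.
  by rewrite mulr_ge0 ?(ltW Z0) // !mulr_ge0 ?exprn_ge0.
- by apply: ler_wpM2r => //; exact: ltW.
apply: lerD; first by apply: ler_wpM2l => //; exact: ltW.
by apply: ler_wpM2l; [exact: ltW | apply: ler_wpM2r; rewrite ?mulr_ge0].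
Qed.

(** * From the surface to the torsor *)

Definition gcd_sq (s : int) (e : int) : nat := gcdn `|e| (`|s| ^ 2).

(** In the height conditions the true denominator, which divides [gcdn (s^2) (a b c)], is replaced
    by its multiple [g]. This relaxation loses no point, which is what an upper bound asks for. *)
Definition triple_pt (R : realType) (B : R) (x : int * int * int) : Prop :=
  let: (a, b, c) := x in
  let s := a + b + c in
  let g := (gcd_sq s a * gcd_sq s b * gcd_sq s c)%N in
  [/\ gcdn (gcdn `|a| `|b|) `|c| = 1%N, [&& a != 0, b != 0 & c != 0], 0 < s,
      [/\ (`|s| ^ 2 * `|a|)%N%:R <= B * g%:R, (`|s| ^ 2 * `|b|)%N%:R <= B * g%:R &
          (`|s| ^ 2 * `|c|)%N%:R <= B * g%:R] &
      (`|a| * `|b| * `|c|)%N%:R <= B * g%:R].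

Definition gcd_y (s e : int) : nat := (gcd_sq s e %/ gcdn `|e| `|s|)%N.
Definition gcd_u (s e : int) : nat := (gcdn `|e| `|s| ^ 2 %/ gcd_sq s e)%N.

(** Both quotients are exact because [gcdn e s] divides [gcdn e (s^2)], which in turn divides the
    square of [gcdn e s]. *)
Lemma gcd_uyP (s e : int) : e != 0 -> s != 0 ->
  [/\ (0 < gcd_u s e)%N, (0 < gcd_y s e)%N, (0 < gcd_sq s e)%N,
      (gcd_u s e * gcd_y s e = gcdn `|e| `|s|)%N &
      (gcd_u s e * gcd_y s e ^ 2 = gcd_sq s e)%N].
Proof.
rewrite -!absz_gt0 /gcd_u /gcd_y /gcd_sq => e0 s0.
set h := gcdn `|e| `|s|; set d := gcdn `|e| (`|s| ^ 2).
have h0 : (0 < h)%N by rewrite gcdn_gt0 e0.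
have d0 : (0 < d)%N by rewrite gcdn_gt0 e0.
have hd : (h %| d)%N.
  by rewrite dvdn_gcd dvdn_gcdl -mulnn dvdn_mulr // dvdn_gcdr.
have dh : (d %| h ^ 2)%N.
  rewrite -mulnn /h muln_gcdl !muln_gcdr !dvdn_gcd.
  rewrite (dvdn_mulr _ (dvdn_gcdl _ _)) (dvdn_mulr _ (dvdn_gcdl _ _)).
  by rewrite (dvdn_mull _ (dvdn_gcdl _ _)) mulnn dvdn_gcdr.
have [y dE] := dvdnP hd; have [u hE] := dvdnP dh.
have yd : (d %/ h = y)%N by rewrite dE mulnK.
have ud : (h ^ 2 %/ d = u)%N by rewrite hE mulnK.
rewrite yd ud.
have E : (u * y = h)%N.
  by apply/eqP; rewrite -(eqn_pmul2r h0) -mulnA -dE -hE mulnn.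
have uy0 : (0 < u * y)%N by rewrite E.
move: (uy0); rewrite muln_gt0 => /andP[u0 y0].
by split=> //; rewrite -mulnn mulnA E mulnC dE.
Qed.

Lemma card_triple_rot (R : realType) (B r : R) :
  card_le (fun x => triple_pt B x /\ (`|x.2| <= `|x.1.1|)%N && (`|x.2| <= `|x.1.2|)%N) r ->
  card_le (triple_pt B) (r + (r + r)).
Proof.
set Q := fun x => _ => Qr.
have Qrot (f : int * int * int -> int * int * int) (P : int * int * int -> Prop) :
   injective f -> (forall x, P x -> Q (f x)) -> card_le P r.
  by move=> fi PQ; apply: card_le_inj PQ Qr => x y _ _; exact: fi.
have rotP a b c : triple_pt B (a, b, c) -> triple_pt B (b, c, a).
  have sE : b + c + a = a + b + c by ring.
  move=> [g1 /and3P[a0 b0 c0] s0 [h1 h2 h3] h]; rewrite /triple_pt sE.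
  have gE : (gcd_sq (a + b + c) b * gcd_sq (a + b + c) c * gcd_sq (a + b + c) a =
    gcd_sq (a + b + c) a * gcd_sq (a + b + c) b * gcd_sq (a + b + c) c)%N by rewrite mulnC mulnA.
  rewrite gE; split=> //.
  - by rewrite gcdnC gcdnA.
  - by rewrite a0 b0 c0.
  by move: h; rewrite -mulnA mulnC.
apply: (@card_leU R _ _ Q (fun x => triple_pt B x /\ ~ Q x)) => //.
  by move=> x Px; case: (pselect (Q x)); [left | right].
apply: (@card_leU R _ _ (fun x => triple_pt B x /\ ((`|x.1.1| <= `|x.1.2|)%N && (`|x.1.1| <= `|x.2|)%N))
  (fun x => triple_pt B x /\ ((`|x.1.2| <= `|x.2|)%N && (`|x.1.2| <= `|x.1.1|)%N))).
- move=> [[a b] c] [Px nQ] /=.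
  have nq : ~~ ((`|c| <= `|a|)%N && (`|c| <= `|b|)%N) by apply/negP => h; apply: nQ.
  case: (leqP `|a| `|b|) => ab; [left|right]; split=> //; move: nq; rewrite negb_and -!ltnNge; lia.
- apply: (Qrot (fun x => (x.1.2, x.2, x.1.1))).
    by move=> [[? ?] ?] [[? ?] ?] /= [-> -> ->].
  by move=> [[a b] c] [/rotP Px h].
apply: (Qrot (fun x => (x.2, x.1.1, x.1.2))).
  by move=> [[? ?] ?] [[? ?] ?] /= [-> -> ->].
by move=> [[a b] c] [/rotP/rotP Px h].
Qed.

(** Injectivity holds because each entry is [u y^2 t]. A common divisor of [s] and of two entries
    divides the third, so primitivity makes the three gcds with [s] pairwise coprime, and their
    product divides [s]. *)
Lemma triple_torsor_le (R : realType) (B r : R) : 0 <= B ->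
  card_le (torsor_set B) r ->
  card_le (fun x => triple_pt B x /\ (`|x.2| <= `|x.1.1|)%N && (`|x.2| <= `|x.1.2|)%N) r.
Proof.
move=> B0.
pose sm (x : int * int * int) := x.1.1 + x.1.2 + x.2.
pose tt (s e : int) : int := (e %/ (gcd_sq s e)%:Z)%Z.
pose hh (s e : int) : nat := gcdn `|e| `|s|.
pose f (x : int * int * int) :=
  let s := sm x in
  ((gcd_u s x.1.1, gcd_u s x.1.2, gcd_u s x.2,
     (`|s| %/ (hh s x.1.1 * hh s x.1.2 * hh s x.2))%N),
   ((gcd_y s x.1.1, gcd_y s x.1.2, gcd_y s x.2), (tt s x.1.1, tt s x.1.2, tt s x.2))).
have tE s e : (gcd_sq s e)%:Z * tt s e = e.
  by rewrite /tt mulrC divzK // dvdzE dvdn_gcdl.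
apply: (@card_le_inj R _ _ f).
  move=> [[a b] c] [[a' b'] c'] [Px _] [Px' _].
  have [_ /and3P[a0 b0 c0] s0 _ _] := Px; have [_ /and3P[a0' b0' c0'] s0' _ _] := Px'.
  have sn := lt0r_neq0 s0; have sn' := lt0r_neq0 s0'.
  rewrite /f /sm /=.
  have [_ _ _ _ d1] := gcd_uyP a0 sn; have [_ _ _ _ d1'] := gcd_uyP a0' sn'.
  have [_ _ _ _ d2] := gcd_uyP b0 sn; have [_ _ _ _ d2'] := gcd_uyP b0' sn'.
  have [_ _ _ _ d3] := gcd_uyP c0 sn; have [_ _ _ _ d3'] := gcd_uyP c0' sn'.
  move=> [u1 u2 u3 _ y1 y2 y3 t1 t2 t3].
  have ea : a = a' by rewrite -[LHS](tE (a + b + c)) -d1 u1 y1 t1 d1' tE.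
  have eb : b = b' by rewrite -[LHS](tE (a + b + c)) -d2 u2 y2 t2 d2' tE.
  have ec : c = c' by rewrite -[LHS](tE (a + b + c)) -d3 u3 y3 t3 d3' tE.
  by rewrite ea eb ec.
move=> [[a b] c] [Px /= /andP[ca cb]].
have [g1 /and3P[a0 b0 c0] s0 [h1 h2 h3] h4] := Px.
rewrite /f /sm /=; set s := a + b + c in s0 h1 h2 h3 h4 *.
have sn := lt0r_neq0 s0.
have [u10 y10 d10 e1 d1] := gcd_uyP a0 sn.
have [u20 y20 d20 e2 d2] := gcd_uyP b0 sn.
have [u30 y30 d30 e3 d3] := gcd_uyP c0 sn.
rewrite -/(hh s a) in e1; rewrite -/(hh s b) in e2; rewrite -/(hh s c) in e3.
have sp : (0 < `|s|)%N by rewrite absz_gt0.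
have hs e : (hh s e %| `|s|)%N by exact: dvdn_gcdr.
have he e : (hh s e %| `|e|)%N by exact: dvdn_gcdl.
have all3 k : (k %| `|s|)%N -> [|| (k %| `|a|)%N && (k %| `|b|)%N, (k %| `|a|)%N && (k %| `|c|)%N |
     (k %| `|b|)%N && (k %| `|c|)%N] -> k = 1%N.
  rewrite -!(dvdzE k%:Z) => ks H.
  have [ka kb kc] : [/\ (k%:Z %| a)%Z, (k%:Z %| b)%Z & (k%:Z %| c)%Z].
    case/or3P: H => /andP[x1 x2]; split=> //.
    - have -> : c = s - a - b by rewrite /s; ring.
      by rewrite rpredB // rpredB.
    - have -> : b = s - a - c by rewrite /s; ring.
      by rewrite rpredB // rpredB.
    - have -> : a = s - b - c by rewrite /s; ring.
      by rewrite rpredB // rpredB.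
  apply/eqP; rewrite -dvdn1 -g1 !dvdn_gcd.
  by rewrite !dvdzE /= in ka kb kc; rewrite ka kb kc.
have c12 : coprime (hh s a) (hh s b).
  rewrite /coprime; apply/eqP; apply: all3.
    exact: dvdn_trans (dvdn_gcdl _ _) (hs a).
  by rewrite (dvdn_trans (dvdn_gcdl _ _) (he a)) (dvdn_trans (dvdn_gcdr _ _) (he b)).
have c13 : coprime (hh s a) (hh s c).
  rewrite /coprime; apply/eqP; apply: all3.
    exact: dvdn_trans (dvdn_gcdl _ _) (hs a).
  by rewrite (dvdn_trans (dvdn_gcdl _ _) (he a)) (dvdn_trans (dvdn_gcdr _ _) (he c)) orbT.
have c23 : coprime (hh s b) (hh s c).
  rewrite /coprime; apply/eqP; apply: all3.
    exact: dvdn_trans (dvdn_gcdl _ _) (hs b).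
  by rewrite (dvdn_trans (dvdn_gcdl _ _) (he b)) (dvdn_trans (dvdn_gcdr _ _) (he c)) !orbT.
have hprod : (hh s a * hh s b * hh s c %| `|s|)%N.
  by rewrite Gauss_dvd ?coprimeMl ?c13 ?c23 // Gauss_dvd // !hs.
set k := (`|s| %/ _)%N.
have sk : `|s|%N = (hh s a * hh s b * hh s c * k)%N by rewrite mulnC divnK.
have k0 : (0 < k)%N by move: sp; rewrite sk muln_gt0 => /andP[].
set u1 := gcd_u s a in u10 e1 d1 *; set u2 := gcd_u s b in u20 e2 d2 *; set u3 := gcd_u s c in u30 e3 d3 *.
set y1 := gcd_y s a in y10 e1 d1 *; set y2 := gcd_y s b in y20 e2 d2 *; set y3 := gcd_y s c in y30 e3 d3 *.
have ta := tE s a; have tb := tE s b; have tc := tE s c.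
set t1 := tt s a in ta *; set t2 := tt s b in tb *; set t3 := tt s c in tc *.
have na : (u1 * y1 ^ 2 * `|t1| = `|a|)%N by rewrite d1 -[in RHS]ta abszM absz_nat.
have nb : (u2 * y2 ^ 2 * `|t2| = `|b|)%N by rewrite d2 -[in RHS]tb abszM absz_nat.
have nc : (u3 * y3 ^ 2 * `|t3| = `|c|)%N by rewrite d3 -[in RHS]tc abszM absz_nat.
set g := (gcd_sq s a * gcd_sq s b * gcd_sq s c)%N in h1 h2 h3 h4.
have g0 : (0 : R) < g%:R by rewrite ltr0n !muln_gt0 d10 d20.
have s2 : (`|s| ^ 2 = g * (u1 * u2 * u3 * k ^ 2))%N.
  by rewrite sk -e1 -e2 -e3 /g -d1 -d2 -d3; ring.
have div (m : nat) : (g * m)%N%:R <= B * g%:R -> m%:R <= B.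
  by rewrite natrM mulrC ler_pM2r.
split; first by rewrite u10 u20 u30 k0.
split.
- by rewrite /coprime_uy /= e1 e2 e3 c12 c13 c23 y10 y20 y30.
- rewrite /=; have sq (u y : nat) (t : int) : u%:Z * t * y%:Z ^+ 2 = (u * y ^ 2)%N%:Z * t.
    by rewrite PoszM -mulnn PoszM; ring.
  rewrite !sq d1 d2 d3 ta tb tc -/s.
  have <- : `|s|%N%:Z = s by rewrite gtz0_abs.
  by rewrite -PoszM sk -e1 -e2 -e3; congr Posz; ring.
- rewrite /= -!absz_gt0; move: a0 b0 c0; rewrite -!absz_gt0 -na -nb -nc !muln_gt0.
  by move=> /andP[_ ->] /andP[_ ->] /andP[_ ->].
- by rewrite /= na nb nc ca cb.
rewrite /= na nb; split.
- by apply: div; rewrite mulnA -s2.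
- by apply: div; rewrite mulnA -s2.
apply: div; move: h4; rewrite -na -nb -nc d1 d2 d3.
by have -> : (gcd_sq s a * `|t1| * (gcd_sq s b * `|t2|) * (gcd_sq s c * `|t3|) =
   g * (`|t1| * `|t2| * `|t3|))%N by rewrite /g; ring.
Qed.

Lemma gcdnM_dvd (m n q : nat) : (gcdn (m * n) q %| gcdn m q * gcdn n q)%N.
Proof.
rewrite muln_gcdl !muln_gcdr !dvdn_gcd dvdn_gcdl /=.
by rewrite (dvdn_mull _ (dvdn_gcdr _ _)) !(dvdn_mulr _ (dvdn_gcdr _ _)).
Qed.

(** The sign of the sum selects one of the two primitive vectors of a point. *)
Definition quad_pt (R : realType) (B : R) (x : int * int * int * int) : Prop :=
  let: (x1, x2, x3, x4) := x in
  [/\ gcdn (gcdn (gcdn `|x1| `|x2|) `|x3|) `|x4| = 1%N,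
      [&& x1 != 0, x2 != 0 & x3 != 0], 0 < x1 + x2 + x3,
      x1 * x2 * x3 = x4 * (x1 + x2 + x3) ^+ 2 &
      [/\ `|x1|%N%:R <= B, `|x2|%N%:R <= B, `|x3|%N%:R <= B & `|x4|%N%:R <= B]].

(** Let [G] be the gcd of the first three coordinates. It is coprime to [x4], so it divides [s^2];
    the cofactor [k] divides both [s^2] and [a b c], whence [k <= g]. For injectivity, the triple
    fixes the ratio of [x4] to [G], and these are coprime with [G > 0]. *)
Lemma quad_triple_le (R : realType) (B r : R) : 0 <= B ->
  card_le (triple_pt B) r -> card_le (quad_pt B) r.
Proof.
move=> B0.
pose gm (x : int * int * int * int) := gcdn (gcdn `|x.1.1.1| `|x.1.1.2|) `|x.1.2|.
pose f (x : int * int * int * int) : int * int * int :=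
  ((x.1.1.1 %/ (gm x)%:Z)%Z, (x.1.1.2 %/ (gm x)%:Z)%Z, (x.1.2 %/ (gm x)%:Z)%Z).
have main x1 x2 x3 x4 : quad_pt B (x1, x2, x3, x4) ->
   exists a b c G, [/\ f (x1, x2, x3, x4) = (a, b, c), (0 < G)%N,
     [/\ x1 = a * G%:Z, x2 = b * G%:Z & x3 = c * G%:Z],
     gcdn G `|x4| = 1%N /\ gcdn (gcdn `|a| `|b|) `|c| = 1%N &
     G%:Z * (a * b * c) = x4 * (a + b + c) ^+ 2].
  move=> [g1 /and3P[n1 n2 n3] s0 E _].
  pose G := gcdn (gcdn `|x1| `|x2|) `|x3|.
  have G0 : (0 < G)%N by rewrite gcdn_gt0 gcdn_gt0 absz_gt0 n1.
  have d1 : (G %| `|x1|)%N by rewrite (dvdn_trans (dvdn_gcdl _ _)) // dvdn_gcdl.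
  have d2 : (G %| `|x2|)%N by rewrite (dvdn_trans (dvdn_gcdl _ _)) // dvdn_gcdr.
  have d3 : (G %| `|x3|)%N by rewrite dvdn_gcdr.
  exists (x1 %/ G%:Z)%Z, (x2 %/ G%:Z)%Z, (x3 %/ G%:Z)%Z, G.
  have k1 : x1 = (x1 %/ G%:Z)%Z * G%:Z by rewrite divzK ?dvdzE.
  have k2 : x2 = (x2 %/ G%:Z)%Z * G%:Z by rewrite divzK ?dvdzE.
  have k3 : x3 = (x3 %/ G%:Z)%Z * G%:Z by rewrite divzK ?dvdzE.
  have GE : G = gcdn (gcdn `|x1| `|x2|) `|x3| by [].
  split=> //.
    split; first exact: g1.
    move: (x1 %/ G%:Z)%Z (x2 %/ G%:Z)%Z (x3 %/ G%:Z)%Z k1 k2 k3 => a b c k1 k2 k3.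
    apply/eqP; rewrite -(eqn_pmul2r G0) mul1n !muln_gcdl.
    by rewrite -[X in gcdn (gcdn (_ * X) (_ * X)) (_ * X)](absz_nat G) -!abszM -k1 -k2 -k3 -GE.
  move: (x1 %/ G%:Z)%Z (x2 %/ G%:Z)%Z (x3 %/ G%:Z)%Z k1 k2 k3 => a b c k1 k2 k3.
  have GZ : G%:Z ^+ 2 != 0 by rewrite expf_eq0 /= eqz_nat -lt0n.
  apply: (mulIf GZ).
  have -> : G%:Z * (a * b * c) * G%:Z ^+ 2 = (a * G%:Z) * (b * G%:Z) * (c * G%:Z) by ring.
  have -> : x4 * (a + b + c) ^+ 2 * G%:Z ^+ 2 = x4 * (a * G%:Z + b * G%:Z + c * G%:Z) ^+ 2 by ring.
  by rewrite -k1 -k2 -k3.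
apply: (@card_le_inj R _ _ f).
  move=> [[[x1 x2] x3] x4] [[[z1 z2] z3] z4] Px Pz fE.
  have [a [b [c [G [fx G0 [k1 k2 k3] [g4 g3] EG]]]]] := main _ _ _ _ Px.
  have [a' [b' [c' [G' [fz G0' [l1 l2 l3] [g4' g3'] EG']]]]] := main _ _ _ _ Pz.
  move: fE; rewrite fx fz => -[aE bE cE]; rewrite -aE -bE -cE in l1 l2 l3 EG'.
  have [_ /and3P[n1 n2 n3] s0 _ _] := Px.
  have abc0 : a * b * c != 0.
    rewrite !mulf_neq0 //; [move: n1; rewrite k1|move: n2; rewrite k2|move: n3; rewrite k3];
    by rewrite mulf_eq0 negb_or => /andP[].
  have s20 : (a + b + c) ^+ 2 != 0.
    rewrite expf_eq0 /=; apply: contraTneq s0 => s0; rewrite k1 k2 k3 -!mulrDl s0 mul0r ltxx //.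
  have cross : x4 * G'%:Z = z4 * G%:Z.
    apply: (mulIf s20); apply: (mulIf abc0).
    have -> : x4 * G'%:Z * (a + b + c) ^+ 2 * (a * b * c) =
       (x4 * (a + b + c) ^+ 2) * (G'%:Z * (a * b * c)) by ring.
    have -> : z4 * G%:Z * (a + b + c) ^+ 2 * (a * b * c) =
       (z4 * (a + b + c) ^+ 2) * (G%:Z * (a * b * c)) by ring.
    by rewrite -EG -EG' mulrC.
  have crossN : (`|x4| * G' = `|z4| * G)%N.
    by have := congr1 absz cross; rewrite !abszM !absz_nat.
  have GG : G = G'.
    apply/eqP; rewrite eqn_dvd; apply/andP; split.
      by have := dvdn_mull `|z4| (dvdnn G); rewrite -crossN Gauss_dvdr //; apply/eqP.
    by have := dvdn_mull `|x4| (dvdnn G'); rewrite crossN Gauss_dvdr //; apply/eqP.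
  have x4z4 : x4 = z4.
    by apply: (mulIf (_ : G%:Z != 0)); [rewrite eqz_nat -lt0n | rewrite -cross GG].
  by rewrite k1 k2 k3 l1 l2 l3 GG x4z4.
move=> [[[x1 x2] x3] x4] Px.
have [a [b [c [G [-> G0 [k1 k2 k3] [g4 g3] EG]]]]] := main _ _ _ _ Px.
have [_ /and3P[n1 n2 n3] s0 _ [b1 b2 b3 b4]] := Px.
have an : a != 0 by move: n1; rewrite k1 mulf_eq0 negb_or => /andP[].
have bn : b != 0 by move: n2; rewrite k2 mulf_eq0 negb_or => /andP[].
have cn : c != 0 by move: n3; rewrite k3 mulf_eq0 negb_or => /andP[].
have GZ : 0 < G%:Z by rewrite ltz_nat.
have sp : 0 < a + b + c.
  by move: s0; rewrite k1 k2 k3 -!mulrDl pmulr_lgt0.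
set s := a + b + c in sp EG *.
have Gs : (G %| `|s| ^ 2)%N.
  have : (G %| `|x4| * `|s| ^ 2)%N.
    by rewrite -abszX -abszM -EG abszM absz_nat dvdn_mulr.
  by rewrite Gauss_dvdr //; apply/eqP.
have [k sk] := dvdnP Gs.
have s2p : (0 < `|s| ^ 2)%N by rewrite expn_gt0 absz_gt0 lt0r_neq0.
have k0 : (0 < k)%N by move: s2p; rewrite sk muln_gt0 => /andP[].
have abcE : (`|a| * `|b| * `|c| = `|x4| * k)%N.
  apply/eqP; rewrite -(eqn_pmul2l G0); apply/eqP.
  have := congr1 absz EG; rewrite abszM absz_nat !abszM -!/(`|s|%N) => ->.
  by rewrite mulnn sk; ring.
pose g := (gcd_sq s a * gcd_sq s b * gcd_sq s c)%N.
have g0 : (0 < g)%N by rewrite !muln_gt0 !gcdn_gt0 !absz_gt0 an bn cn.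
have kg : (k <= g)%N.
  apply: dvdn_leq => //.
  have h : (k %| gcdn (`|a| * `|b| * `|c|) (`|s| ^ 2))%N.
    by rewrite dvdn_gcd abcE dvdn_mull // sk dvdn_mulr.
  apply: (dvdn_trans h); apply: (dvdn_trans (gcdnM_dvd _ _ _)).
  by apply: dvdn_mul => //; exact: gcdnM_dvd.
have bound (e x : int) : x = e * G%:Z -> `|x|%N%:R <= B -> (`|s| ^ 2 * `|e|)%N%:R <= B * g%:R.
  move=> xE xB; rewrite sk; have -> : (k * G * `|e| = `|x| * k)%N by rewrite xE abszM absz_nat; ring.
  by rewrite natrM; apply: ler_pM => //; rewrite ler_nat.
split=> //.
- by rewrite an bn cn.
- by split; [exact: (bound _ x1)|exact: (bound _ x2)|exact: (bound _ x3)].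
by rewrite abcE natrM; apply: ler_pM => //; rewrite ler_nat.
Qed.

(** * Rational points and primitive vectors *)

Lemma ord4_cases (i : 'I_4) :
  [\/ i = inord 0, i = inord 1, i = inord 2 | i = inord 3].
Proof.
case: i => [[|[|[|[|m]]]] //= h];
  [constructor 1|constructor 2|constructor 3|constructor 4];
  by apply: val_inj; rewrite /= inordK.
Qed.

Lemma big_ord4 (T : Type) (op : T -> T -> T) (idx : T) (F : 'I_4 -> T) :
  \big[op/idx]_(i < 4) F i =
  op (F (inord 0)) (op (F (inord 1)) (op (F (inord 2)) (op (F (inord 3)) idx))).
Proof.
rewrite !big_ord_recl big_ord0.
by congr (op (F _) (op (F _) (op (F _) (op (F _) _)))); apply: val_inj; rewrite /= inordK.
Qed.

Lemma zeros_vline (f : 'rV[rat]_4 -> rat) (p : P3 rat) (X : 'rV[rat]_4) :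
  line_of p = <[X]>%VS -> zeros f p <-> forall k, f (k *: X) = 0.
Proof.
move=> pX; split=> [h k|h v].
  by apply: h; rewrite pX memvZ // memv_line.
by rewrite pX => /vlineP[k ->].
Qed.

Lemma coprime_coordsN (p : P3 rat) (x : 'rV[int]_4) :
  coprime_coords p x -> coprime_coords p (- x).
Proof.
move=> [g1 px]; split.
  by rewrite -[RHS]g1; apply: eq_bigr => i _; rewrite mxE abszN.
have -> : map_mx intr (- x) = - map_mx intr x :> 'rV[rat]_4.
  by apply/rowP => i; rewrite !mxE rmorphN.
rewrite px; apply/eqP; rewrite eqEsubv -!memvE memvN memv_line andbT.
by rewrite -memvN memv_line.
Qed.

(** On the surface, if one of the first three coordinates vanishes, then so does [x4] or the sum of
    the other two, which puts the point on one of the six lines. *)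
Lemma openU_coords (p : P3 rat) (x : 'rV[int]_4) : coprime_coords p x ->
  openU p <->
  [/\ [&& x 0 (inord 0) != 0, x 0 (inord 1) != 0 & x 0 (inord 2) != 0] &
      x 0 (inord 0) * x 0 (inord 1) * x 0 (inord 2) =
      x 0 (inord 3) * (x 0 (inord 0) + x 0 (inord 1) + x 0 (inord 2)) ^+ 2].
Proof.
move=> [_ px]; rewrite /openU /surfX /six_lines.
have Z f := zeros_vline f px.
set X := map_mx intr x in px Z.
have X1 k : x1 (k *: X) = k * (x 0 (inord 0))%:~R by rewrite /x1 !mxE.
have X2 k : x2 (k *: X) = k * (x 0 (inord 1))%:~R by rewrite /x2 !mxE.
have X3 k : x3 (k *: X) = k * (x 0 (inord 2))%:~R by rewrite /x3 !mxE.
have X4 k : x4 (k *: X) = k * (x 0 (inord 3))%:~R by rewrite /x4 !mxE.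
move: (x 0 (inord 0)) (x 0 (inord 1)) (x 0 (inord 2)) (x 0 (inord 3)) X1 X2 X3 X4.
move=> a b c d X1 X2 X3 X4.
have za (f : 'rV[rat]_4 -> rat) (e : int) : (forall k, f (k *: X) = k * e%:~R) ->
    zeros f p <-> e = 0.
  move=> fE; split=> [/Z h|e0]; last by apply/Z => k; rewrite fE e0 mulr0.
  by have := h 1; rewrite fE mul1r => /eqP; rewrite intr_eq0 => /eqP.
have z1 := za _ _ X1; have z2 := za _ _ X2; have z3 := za _ _ X3; have z4 := za _ _ X4.
have z23 : zeros (fun v => x2 v + x3 v) p <-> b + c = 0.
  by apply: za => k; rewrite X2 X3 -mulrDr rmorphD.
have z31 : zeros (fun v => x3 v + x1 v) p <-> c + a = 0.
  by apply: za => k; rewrite X3 X1 -mulrDr rmorphD.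
have z12 : zeros (fun v => x1 v + x2 v) p <-> a + b = 0.
  by apply: za => k; rewrite X1 X2 -mulrDr rmorphD.
have zS : zeros (fun v => x1 v * x2 v * x3 v - x4 v * (x1 v + x2 v + x3 v) ^+ 2) p <->
    a * b * c = d * (a + b + c) ^+ 2.
  have E k : x1 (k *: X) * x2 (k *: X) * x3 (k *: X) - x4 (k *: X) * (x1 (k *: X) + x2 (k *: X) + x3 (k *: X)) ^+ 2
     = k ^+ 3 * (a * b * c - d * (a + b + c) ^+ 2)%:~R.
    by rewrite X1 X2 X3 X4 rmorphB /= !rmorphM /= !rmorphD /=; ring.
  split=> [/Z h|h]; last by apply/Z => k; rewrite E h subrr mulr0.
  by have := h 1; rewrite E expr1n mul1r => /eqP; rewrite intr_eq0 subr_eq0 => /eqP.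
split.
  move=> [/zS E nL]; split=> //.
  apply/and3P; split; apply/eqP => e0.
  - move: E; rewrite e0 !mul0r add0r => /esym/eqP; rewrite mulf_eq0 expf_eq0 /=.
    case/orP=> [/eqP d0|/eqP bc]; apply: nL.
      by do 5 left; split; [apply/z1|apply/z4].
    by do 2 left; right; split; [apply/z1|apply/z23].
  - move: E; rewrite e0 mulr0 !mul0r addr0 => /esym/eqP; rewrite mulf_eq0 expf_eq0 /=.
    case/orP=> [/eqP d0|/eqP ac]; apply: nL.
      by do 4 left; right; split; [apply/z2|apply/z4].
    by left; right; split; [apply/z2|apply/z31; rewrite addrC].
  - move: E; rewrite e0 mulr0 addr0 => /esym/eqP; rewrite mulf_eq0 expf_eq0 /=.
    case/orP=> [/eqP d0|/eqP ab]; apply: nL.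
      by do 3 left; right; split; [apply/z3|apply/z4].
    by right; split; [apply/z3|apply/z12].
move=> [/and3P[an bn cn] E]; split; first exact/zS.
have abc : a * b * c != 0 by rewrite !mulf_neq0.
have dn : d != 0 by apply: contraNneq abc => d0; rewrite E d0 mul0r.
move=> [[[[[]|]|]|]|] [].
- by move=> /z1 e _; rewrite e eqxx in an.
- by move=> /z2 e _; rewrite e eqxx in bn.
- by move=> /z3 e _; rewrite e eqxx in cn.
- by move=> /z1 e _; rewrite e eqxx in an.
- by move=> /z2 e _; rewrite e eqxx in bn.
- by move=> /z3 e _; rewrite e eqxx in cn.
Qed.

Lemma points_quad_le (R : realType) (B r : R) : card_le (quad_pt B) r ->
  card_le (fun p : P3 rat => openU p /\ (height p)%:R <= B) r.
Proof.
move=> Qr.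
pose co (x : 'rV[int]_4) := (x 0 (inord 0), x 0 (inord 1), x 0 (inord 2), x 0 (inord 3)).
pose Q (z : P3 rat * (int * int * int * int)) :=
  quad_pt B z.2 /\ exists2 x, coprime_coords z.1 x & z.2 = co x.
have QL : card_le Q r.
  apply: (@card_le_inj R _ _ snd _ _ r _ _ Qr); last by move=> z [].
  move=> [p z] [p' z'] [/= _ [x [_ px] zx]] [/= _ [x' [_ px'] zx']] zz; rewrite -zz in zx' *.
  congr pair; apply: val_inj; rewrite -/(line_of p) -/(line_of p') px px'.
  suff -> : x = x' by [].
  move: zx'; rewrite zx => -[e0 e1 e2 e3].
  by apply/rowP => i; case: (ord4_cases i) => ->.
apply: (card_le_sub _ (card_le_ex QL) (lexx r)).
move=> p [pU pB].
have [x0 x0P] := coprime_coords_exist p.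
(* Of the two primitive vectors, one has nonnegative sum. The sum is in fact positive, as a zero sum
   would annihilate the product of the first three coordinates. *)
have [x xP sx] : exists2 x, coprime_coords p x & 0 <= x 0 (inord 0) + x 0 (inord 1) + x 0 (inord 2).
  have [s0|s0] := leP 0 (x0 0 (inord 0) + x0 0 (inord 1) + x0 0 (inord 2)); first by exists x0.
  exists (- x0); first exact: coprime_coordsN.
  by rewrite !mxE -!opprD oppr_ge0 ltW.
exists (co x); split; last by exists x.
have [n0 E] := (openU_coords xP).1 pU.
have [g1 _] := xP.
split=> //.
- by rewrite big_ord4 /= gcdn0 in g1; rewrite -[RHS]g1 !gcdnA.
- rewrite lt_neqAle sx andbT eq_sym; apply/eqP => s0.
  move: n0 => /and3P[a0 b0 c0]; have := E; rewrite s0 expr2 mul0r mulr0 => /eqP.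
  by rewrite !mulf_eq0 (negPf a0) (negPf b0) (negPf c0).
have hB i : (absz (x 0 i))%:R <= B.
  by apply: le_trans pB; rewrite (heightE xP) ler_nat; exact: (leq_bigmax i).
by split.
Qed.

Lemma upper_bound (R : realType) : exists2 c : R, 0 < c & forall B : R, 2 <= B ->
  card_le (fun p : P3 rat => openU p /\ (height p)%:R <= B) (c * (B * ln B ^+ 6)).
Proof.
have [c c0 H] := torsor_set_le R.
exists (c + (c + c)); first by rewrite !addr_gt0.
move=> B B2; have B0 : 0 <= B by lra.
apply: points_quad_le; apply: quad_triple_le => //; rewrite !mulrDl.
by apply: card_triple_rot; apply: triple_torsor_le => //; exact: H.
Qed.

(** * Points with prescribed gcds *)

(** Converse to the extraction of [u] and [y]: coprime cofactors make [u y] and [u y^2] the actual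
    gcds with the sum and with its square. *)
Lemma gcd_exact (u y W s a : nat) : (0 < u)%N -> (0 < y)%N ->
  coprime (u * y) W -> coprime a (u * y * W) -> coprime a s ->
  coprime s (u * y * W) ->
  gcdn (u * y ^ 2 * a) (u * y * W * s) = (u * y)%N /\
  gcdn (u * y ^ 2 * a) ((u * y * W * s) ^ 2) = (u * y ^ 2)%N.
Proof.
rewrite !coprimeMr !coprimeMl => u0 y0 /andP[uW yW] /andP[/andP[au ay] aW] as_ /andP[/andP[su sy] sW].
split.
  have -> : (u * y ^ 2 * a = (u * y) * (y * a))%N by ring.
  rewrite -[X in gcdn _ X]mulnA -muln_gcdr.
  suff /eqP -> : coprime (y * a) (W * s) by rewrite muln1.
  by rewrite coprimeMl !coprimeMr yW aW as_ coprime_sym sy.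
have -> : ((u * y * W * s) ^ 2 = (u * y ^ 2) * (u * (W ^ 2 * s ^ 2)))%N by ring.
rewrite -muln_gcdr.
suff /eqP -> : coprime a (u * (W ^ 2 * s ^ 2)) by rewrite muln1.
by rewrite coprimeMr au coprimeMr !coprimeXr.
Qed.

Definition rowz (x : int * int * int * int) : 'rV[int]_4 :=
  \row_(i < 4) nth 0 [:: x.1.1.1; x.1.1.2; x.1.2; x.2] i.

Lemma rowzE x : [/\ rowz x 0 (inord 0) = x.1.1.1, rowz x 0 (inord 1) = x.1.1.2,
  rowz x 0 (inord 2) = x.1.2 & rowz x 0 (inord 3) = x.2].
Proof. by split; rewrite mxE inordK. Qed.

Lemma rowz_inj : injective rowz.
Proof.
move=> x y E; have [a1 a2 a3 a4] := rowzE x; have [b1 b2 b3 b4] := rowzE y.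
rewrite E b1 b2 b3 b4 in a1 a2 a3 a4.
by case: x y {E b1 b2 b3 b4} a1 a2 a3 a4 => [[[? ?] ?] ?] [[[? ?] ?] ?] /= -> -> -> ->.
Qed.

Lemma quad_point (x1 x2 x3 x4 : int) (N : nat) :
  gcdn (gcdn (gcdn `|x1| `|x2|) `|x3|) `|x4| = 1%N ->
  [&& x1 != 0, x2 != 0 & x3 != 0] ->
  x1 * x2 * x3 = x4 * (x1 + x2 + x3) ^+ 2 ->
  [&& (`|x1| <= N)%N, (`|x2| <= N)%N, (`|x3| <= N)%N & (`|x4| <= N)%N] ->
  exists p : P3 rat, [/\ openU p, (height p <= N)%N & coprime_coords p (rowz (x1, x2, x3, x4))].
Proof.
move=> g1 n0 E /and4P[b1 b2 b3 b4]; set x := rowz _.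
have [/= e1 e2 e3 e4] := rowzE (x1, x2, x3, x4).
have X0 : map_mx intr x != 0 :> 'rV[rat]_4.
  apply/eqP => /rowP/(_ (inord 0)) /eqP; rewrite !mxE inordK //= intr_eq0.
  by move: n0 => /and3P[/negPf ->].
have dX : \dim <[map_mx intr x : 'rV[rat]_4]>%VS == 1%N by rewrite dim_vline X0.
pose p : P3 rat := exist (fun L : {vspace 'rV[rat]_4} => \dim L == 1%N) _ dX.
have cp : coprime_coords p x.
  split=> //; rewrite big_ord4 -/x e1 e2 e3 e4 gcdn0 -[RHS]g1 !gcdnA //.
exists p; split=> //.
  by apply/(openU_coords cp); rewrite e1 e2 e3 e4.
rewrite (heightE cp); apply/bigmax_leqP => i _.
by case: (ord4_cases i) => ->; rewrite ?e1 ?e2 ?e3 ?e4.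
Qed.

Definition sixw (n : nat * nat * nat * nat * nat * nat) : nat :=
  let: (u1, y1, u2, y2, u3, y3) := n in (u1 * y1 * (u2 * y2) * (u3 * y3))%N.
Definition sixd1 (n : nat * nat * nat * nat * nat * nat) : nat :=
  let: (u1, y1, u2, y2, u3, y3) := n in (u1 * y1 ^ 2)%N.
Definition sixd2 (n : nat * nat * nat * nat * nat * nat) : nat :=
  let: (u1, y1, u2, y2, u3, y3) := n in (u2 * y2 ^ 2)%N.
Definition sixd3 (n : nat * nat * nat * nat * nat * nat) : nat :=
  let: (u1, y1, u2, y2, u3, y3) := n in (u3 * y3 ^ 2)%N.
Definition six_pos (n : nat * nat * nat * nat * nat * nat) : bool :=
  let: (u1, y1, u2, y2, u3, y3) := n in
  [&& (0 < u1)%N, (0 < y1)%N, (0 < u2)%N, (0 < y2)%N & (0 < u3)%N && (0 < y3)%N].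
Definition six_coprime (n : nat * nat * nat * nat * nat * nat) : bool :=
  let: (u1, y1, u2, y2, u3, y3) := n in
  [&& coprime (u1 * y1) (u2 * y2), coprime (u1 * y1) (u3 * y3) & coprime (u2 * y2) (u3 * y3)].

(* [s], [a], [b], [c] stand for the cofactors left after extracting the
   prescribed gcds from [x1 + x2 + x3], [x1], [x2], [x3]. *)
Definition exact_data (n : nat * nat * nat * nat * nat * nat) (s a b : nat) (c : int) : Prop :=
  [/\ six_pos n && six_coprime n,
      [&& (1 < s)%N, (0 < a)%N & (0 < b)%N],
      (sixd1 n * a + sixd2 n * b)%N%:Z + (sixd3 n)%:Z * c = (sixw n * s)%N%:Z,
      [&& coprime s (sixw n), coprime a (sixw n), coprime b (sixw n) & coprime `|c| (sixw n)] &
      [&& coprime a s, coprime b s & coprime `|c| s]].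

(** With [S = sixw n * s] one has [S^2 = d1 d2 d3 F]. The vector is
    [(a1 S^2, a2 S^2, a3 S^2, a1 a2 a3)] for [a1 = d1 a], [a2 = d2 b], [a3 = d3 c], divided by
    [d1 d2 d3]. *)
Definition exact_quad (n : nat * nat * nat * nat * nat * nat) (s a b : nat) (c : int) :=
  let: (u1, y1, u2, y2, u3, y3) := n in
  let F := (u1 * u2 * u3 * s ^ 2)%N%:Z in
  ((sixd1 n * a)%N%:Z * F, (sixd2 n * b)%N%:Z * F, (sixd3 n)%:Z * c * F, (a * b)%N%:Z * c).

Lemma exact_gcd n s a b c : exact_data n s a b c ->
  let: (u1, y1, u2, y2, u3, y3) := n in
  let S := (sixw n * s)%N in
  [/\ [/\ gcdn (sixd1 n * a) S = (u1 * y1)%N & gcdn (sixd1 n * a) (S ^ 2) = sixd1 n],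
      [/\ gcdn (sixd2 n * b) S = (u2 * y2)%N & gcdn (sixd2 n * b) (S ^ 2) = sixd2 n] &
      [/\ gcdn (sixd3 n * `|c|) S = (u3 * y3)%N & gcdn (sixd3 n * `|c|) (S ^ 2) = sixd3 n]].
Proof.
case: n => [[[[[u1 y1] u2] y2] u3] y3].
move=> [/andP[/and5P[u10 y10 u20 y20 /andP[u30 y30]] /and3P[c12 c13 c23]] _ _ /and4P[sw aw bw cw] /and3P[as_ bs cs]].
rewrite /sixw /sixd1 /sixd2 /sixd3 in sw aw bw cw *.
have E1 : (u1 * y1 * (u2 * y2 * (u3 * y3)) = u1 * y1 * (u2 * y2) * (u3 * y3))%N by ring.
have E2 : (u2 * y2 * (u1 * y1 * (u3 * y3)) = u1 * y1 * (u2 * y2) * (u3 * y3))%N by ring.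
have E3 : (u3 * y3 * (u1 * y1 * (u2 * y2)) = u1 * y1 * (u2 * y2) * (u3 * y3))%N by ring.
have k1 : coprime (u1 * y1) (u2 * y2 * (u3 * y3)) by rewrite coprimeMr c12 c13.
have k2 : coprime (u2 * y2) (u1 * y1 * (u3 * y3)) by rewrite coprimeMr coprime_sym c12 c23.
have k3 : coprime (u3 * y3) (u1 * y1 * (u2 * y2)) by rewrite coprimeMr coprime_sym c13 coprime_sym c23.
have [g1 g1'] := @gcd_exact u1 y1 (u2 * y2 * (u3 * y3)) s a u10 y10 k1
  (eq_ind_r (fun m => is_true (coprime a m)) aw E1) as_ (eq_ind_r (fun m => is_true (coprime s m)) sw E1).
have [g2 g2'] := @gcd_exact u2 y2 (u1 * y1 * (u3 * y3)) s b u20 y20 k2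
  (eq_ind_r (fun m => is_true (coprime b m)) bw E2) bs (eq_ind_r (fun m => is_true (coprime s m)) sw E2).
have [g3 g3'] := @gcd_exact u3 y3 (u1 * y1 * (u2 * y2)) s `|c| u30 y30 k3
  (eq_ind_r (fun m => is_true (coprime `|c| m)) cw E3) cs (eq_ind_r (fun m => is_true (coprime s m)) sw E3).
rewrite E1 in g1 g1'; rewrite E2 in g2 g2'; rewrite E3 in g3 g3'.
by split; split; auto.
Qed.

(** Multiplied by [d1 d2 d3], each coordinate becomes a product of three of the numbers [w s],
    [d1 a], [d2 b], [d3 c]. All of these are at most [A] in absolute value, and [A^3] is at most
    [N d1 d2 d3]. *)
Lemma exact_point (n : nat * nat * nat * nat * nat * nat) s a b c (N A : nat) :
  exact_data n s a b c -> (A ^ 3 <= N * (sixd1 n * sixd2 n * sixd3 n))%N ->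
  (2 * (sixw n * s) <= A)%N -> (4 * (sixd1 n * a) <= A)%N -> (4 * (sixd2 n * b) <= A)%N ->
  exists p : P3 rat, [/\ openU p, (height p <= N)%N &
    coprime_coords p (rowz (exact_quad n s a b c))].
Proof.
move=> D hA hs ha hb.
have G := exact_gcd D.
have [/andP[np nc] /and3P[s1 a0 b0] E /and4P[sw aw bw cw] /and3P[as_ bs cs]] := D.
(* [s > 1] excludes [c = 0], because [gcdn 0 s] is [s]. *)
have c0 : c != 0.
  apply: contraTneq cs => ->; rewrite absz0 /coprime gcd0n; apply/eqP => s1'.
  by rewrite s1' in s1.
have E3 : (sixd3 n)%:Z * c = (sixw n * s)%N%:Z - (sixd1 n * a + sixd2 n * b)%N%:Z by rewrite -E; ring.
case: n np nc G E E3 sw aw bw cw D hA hs ha hb => [[[[[u1 y1] u2] y2] u3] y3].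
rewrite /exact_quad.
set d1 := sixd1 _; set d2 := sixd2 _; set d3 := sixd3 _; set w := sixw _.
move=> /and5P[u10 y10 u20 y20 /andP[u30 y30]] _ [[g1 g1'] [g2 g2'] [g3 g3']] E E3 sw aw bw cw D hA hs ha hb.
set F := (u1 * u2 * u3 * s ^ 2)%N.
have d10 : (0 < d1)%N by rewrite /d1 /= muln_gt0 u10 expn_gt0 y10.
have d20 : (0 < d2)%N by rewrite /d2 /= muln_gt0 u20 expn_gt0 y20.
have d30 : (0 < d3)%N by rewrite /d3 /= muln_gt0 u30 expn_gt0 y30.
have F0 : (0 < F)%N by rewrite /F -mulnn !muln_gt0 u10 u20 u30 !(ltnW s1).
have wF : ((w * s) ^ 2 = d1 * d2 * d3 * F)%N by rewrite /w /d1 /d2 /d3 /F /=; ring.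
have sE : (d1 * a)%N%:Z * F%:Z + (d2 * b)%N%:Z * F%:Z + d3%:Z * c * F%:Z = (w * s)%N%:Z * F%:Z.
  by rewrite -E PoszD; ring.
have cab : coprime (a * b * `|c|) (w * s).
  have cws x : coprime x w -> coprime x s -> coprime x (w * s).
    by move=> h1 h2; rewrite coprimeMr h1 h2.
  by rewrite !coprimeMl !cws.
have cF : coprime (a * b * `|c|) F.
  have : coprime (a * b * `|c|) ((w * s) ^ 2) by rewrite coprimeXr.
  by rewrite wF coprimeMr => /andP[].
have g0 : (0 < d1 * d2 * d3)%N by rewrite (muln_gt0 (d1 * d2)) (muln_gt0 d1) d10 d20.
(* [d3 c] is the difference of [w s] and [d1 a + d2 b], both between 0 and [A / 2]. *)
have c4 : (`|(d3%:Z * c)%R| <= A)%N.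
  rewrite E3; clear -hs ha hb; lia.
have pb (e : nat) : (e <= A)%N -> (e * F <= N)%N.
  move=> eA; rewrite -(leq_pmul2l g0); apply: (@leq_trans (A ^ 3)); last by rewrite mulnC.
  have -> : (d1 * d2 * d3 * (e * F) = e * (w * s) ^ 2)%N by rewrite wF; ring.
  have -> : (A ^ 3 = A * A ^ 2)%N by rewrite expnS.
  apply: leq_mul => //; rewrite leq_exp2r //.
  by apply: leq_trans hs; rewrite leq_pmull.
apply: quad_point.
- rewrite !abszM !absz_nat -!muln_gcdl.
  (* A common divisor of the three terms divides their sum [w s]; both [w s] and [F] are coprime to
     [a b c], so the vector is primitive. *)
  set h := gcdn (gcdn (d1 * a) (d2 * b)) (d3 * `|c|).
  suff : gcdn (h * F) (a * b * `|c|) = 1%N by [].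
  apply/eqP; rewrite -/(coprime (h * F) (a * b * `|c|)) coprimeMl coprime_sym [X in _ && X]coprime_sym cF andbT.
  have hS : (h %| w * s)%N.
    have : (h%:Z %| (w * s)%N%:Z)%Z.
      rewrite -E PoszD; apply: rpredD; [apply: rpredD|].
      - by rewrite dvdzE /= (dvdn_trans (dvdn_gcdl _ _)) // dvdn_gcdl.
      - by rewrite dvdzE /= (dvdn_trans (dvdn_gcdl _ _)) // dvdn_gcdr.
      by rewrite dvdzE /= abszM /= dvdn_gcdr.
    by rewrite dvdzE.
  exact: coprime_dvdr hS cab.
- have Fz : F%:Z != 0 by rewrite eqz_nat -lt0n.
  have z1 : (d1 * a)%N%:Z != 0 by rewrite eqz_nat -lt0n (muln_gt0 d1) d10.
  have z2 : (d2 * b)%N%:Z != 0 by rewrite eqz_nat -lt0n (muln_gt0 d2) d20.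
  have z3 : d3%:Z != 0 by rewrite eqz_nat -lt0n.
  by apply/and3P; split; rewrite mulf_neq0 // mulf_neq0.
- rewrite sE.
  have -> : ((w * s)%N%:Z * F%:Z) ^+ 2 = ((w * s) ^ 2)%N%:Z * F%:Z * F%:Z.
    by rewrite -mulnn PoszM; ring.
  by rewrite wF !PoszM; ring.
apply/and4P; split.
- by rewrite -PoszM absz_nat; apply: pb; apply: leq_trans ha; rewrite leq_pmull.
- by rewrite -PoszM absz_nat; apply: pb; apply: leq_trans hb; rewrite leq_pmull.
- by rewrite abszM absz_nat; apply: pb.
rewrite abszM absz_nat -(leq_pmul2l g0).
apply: (@leq_trans (A ^ 3)); last by rewrite mulnC.
have -> : (d1 * d2 * d3 * (a * b * `|c|) = (d1 * a) * ((d2 * b) * (d3 * `|c|)))%N by ring.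
rewrite !expnS expn0 muln1; apply: leq_mul; first by apply: leq_trans ha; rewrite leq_pmull.
apply: leq_mul; first by apply: leq_trans hb; rewrite leq_pmull.
by move: c4; rewrite abszM absz_nat.
Qed.

(** The number [F] is the gcd of the first three coordinates, so the terms [d1 a], [d2 b], [d3 c]
    and their sum [S] are known. Their gcds with [S] and with [S^2] return each [u y] and
    [u y^2]. *)
Lemma exact_quad_inj n s a b c n' s' a' b' c' :
  exact_data n s a b c -> exact_data n' s' a' b' c' ->
  exact_quad n s a b c = exact_quad n' s' a' b' c' -> [/\ n = n', s = s', a = a' & b = b'].
Proof.
move=> D D'; have G := exact_gcd D; have G' := exact_gcd D'.
have [/andP[np _] /and3P[s1 a0 b0] E /and4P[sw aw bw cw] /and3P[as_ bs cs]] := D.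
have [/andP[np' _] /and3P[s1' a0' b0'] E' /and4P[sw' aw' bw' cw'] /and3P[as_' bs' cs']] := D'.
(* The three terms have no common factor: it would divide [S], hence both of the gcds [u1 y1] and
   [u2 y2], which are coprime. *)
have key k t p q r (e : int) (F : nat) : exact_data k t p q e ->
   gcdn (gcdn `|((sixd1 k * p)%N%:Z * F%:Z)%R| `|((sixd2 k * q)%N%:Z * F%:Z)%R|) `|((sixd3 k)%:Z * e * F%:Z)%R| = r -> r = F.
  move=> Dk; have Gk := exact_gcd Dk; have [/andP[_ pc] _ Ek /and4P[tw pw qw ew] /and3P[pt qt et]] := Dk.
  rewrite !abszM !absz_nat -!muln_gcdl.
  suff -> : gcdn (gcdn (sixd1 k * p) (sixd2 k * q)) (sixd3 k * `|e|) = 1%N by rewrite mul1n.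
  set h := gcdn _ _.
  have h1 : (h %| sixd1 k * p)%N by rewrite (dvdn_trans (dvdn_gcdl _ _)) // dvdn_gcdl.
  have h2 : (h %| sixd2 k * q)%N by rewrite (dvdn_trans (dvdn_gcdl _ _)) // dvdn_gcdr.
  have h3 : (h %| sixd3 k * `|e|)%N by rewrite dvdn_gcdr.
  have hS : (h %| sixw k * t)%N.
    have : (h%:Z %| (sixw k * t)%N%:Z)%Z.
      rewrite -Ek PoszD; apply: rpredD; first by apply: rpredD; rewrite dvdzE.
      by rewrite dvdzE /= abszM.
    by rewrite dvdzE.
  move: Gk pc; case: (k) h1 h2 hS => [[[[[u1 y1] u2] y2] u3] y3] h1 h2 hS [[g1 _] [g2 _] _] /and3P[c12 _ _].
  apply/eqP; rewrite -dvdn1 -(eqP c12) dvdn_gcd -g1 -g2 !dvdn_gcd h1 h2 hS //.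
case: n n' D D' G G' np np' E E' key {sw aw bw cw sw' aw' bw' cw'} => [[[[[u1 y1] u2] y2] u3] y3] [[[[[v1 z1] v2] z2] v3] z3].
set n := (u1, y1, u2, y2, u3, y3); set n' := (v1, z1, v2, z2, v3, z3).
move=> D D' [[g1 g1'] [g2 g2'] [g3 g3']] [[k1 k1'] [k2 k2'] [k3 k3']].
move=> /and5P[u10 y10 u20 y20 /andP[u30 y30]] /and5P[v10 z10 v20 z20 /andP[v30 z30]] E E' key.
rewrite /exact_quad -/n -/n' => eqq.
have e1 : (sixd1 n * a)%N%:Z * (u1 * u2 * u3 * s ^ 2)%N%:Z =
    (sixd1 n' * a')%N%:Z * (v1 * v2 * v3 * s' ^ 2)%N%:Z := congr1 (fun x => x.1.1.1) eqq.
have e2 : (sixd2 n * b)%N%:Z * (u1 * u2 * u3 * s ^ 2)%N%:Z =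
    (sixd2 n' * b')%N%:Z * (v1 * v2 * v3 * s' ^ 2)%N%:Z := congr1 (fun x => x.1.1.2) eqq.
have e3 : (sixd3 n)%:Z * c * (u1 * u2 * u3 * s ^ 2)%N%:Z =
    (sixd3 n')%:Z * c' * (v1 * v2 * v3 * s' ^ 2)%N%:Z := congr1 (fun x => x.1.2) eqq.
have F0 : (0 < u1 * u2 * u3 * s ^ 2)%N by rewrite -mulnn !muln_gt0 u10 u20 u30 !(ltnW s1).
have FF : (u1 * u2 * u3 * s ^ 2 = v1 * v2 * v3 * s' ^ 2)%N.
  rewrite -(key _ _ _ _ _ _ (u1 * u2 * u3 * s ^ 2)%N D (erefl _)).
  by rewrite -(key _ _ _ _ _ _ (v1 * v2 * v3 * s' ^ 2)%N D' (erefl _)) e1 e2 e3.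
have FZ : (u1 * u2 * u3 * s ^ 2)%N%:Z != 0 by rewrite eqz_nat -lt0n.
rewrite -FF in e1 e2 e3.
have /eqP a1 := mulIf FZ e1; have /eqP a2 := mulIf FZ e2; have a3 := mulIf FZ e3.
rewrite eqz_nat in a1; rewrite eqz_nat in a2; move/eqP in a1; move/eqP in a2.
have a3n : (sixd3 n * `|c| = sixd3 n' * `|c'|)%N.
  by have := congr1 absz a3; rewrite !abszM !absz_nat.
have SS : (sixw n * s = sixw n' * s')%N.
  by apply/eqP; rewrite -eqz_nat -E -E' a1 a2 a3.
rewrite a1 SS k1 in g1; rewrite a1 SS k1' in g1'.
rewrite a2 SS k2 in g2; rewrite a2 SS k2' in g2'.
rewrite a3n SS k3 in g3; rewrite a3n SS k3' in g3'.
have uy (u y v z : nat) : (0 < v)%N -> (0 < z)%N -> (v * z = u * y)%N -> (v * z ^ 2 = u * y ^ 2)%N -> u = v /\ y = z.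
  move=> v0 z0 h1 h2.
  have yz : y = z.
    by apply/eqP; rewrite -(eqn_pmul2l (_ : 0 < v * z)%N) ?muln_gt0 ?v0 // {1}h1 -!mulnA !mulnn h2.
  by split=> //; apply/eqP; rewrite -(eqn_pmul2r z0) h1 yz.
have [q1 r1] := uy _ _ _ _ v10 z10 g1 g1'.
have [q2 r2] := uy _ _ _ _ v20 z20 g2 g2'.
have [q3 r3] := uy _ _ _ _ v30 z30 g3 g3'.
have w0 : (0 < sixw n')%N by rewrite /= !muln_gt0 v10 z10 v20 z20 v30 z30.
have dd1 : (0 < sixd1 n')%N by rewrite /= muln_gt0 v10 expn_gt0 z10.
have dd2 : (0 < sixd2 n')%N by rewrite /= muln_gt0 v20 expn_gt0 z20.
have wn : sixw n = sixw n' by rewrite /n /n' /= -g1 -g2 -g3.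
split.
- by rewrite /n /n' q1 r1 q2 r2 q3 r3.
- by apply/eqP; rewrite -(eqn_pmul2l w0) -wn SS wn.
- by apply/eqP; rewrite -(eqn_pmul2l dd1) -a1 g1'.
- by apply/eqP; rewrite -(eqn_pmul2l dd2) -a2 g2'.
Qed.

(** * Coprimality conditions inside a box *)

(** Each element is charged to a single admissible index, picked by [xget], so overlaps do no
    harm. *)
Lemma card_le_bigU (R : realType) (T : eqType) (l : seq nat) (P : T -> Prop)
    (Pm : nat -> T -> Prop) (F : nat -> R) :
  (forall x, P x -> exists2 m, m \in l & Pm m x) ->
  (forall m, m \in l -> card_le (Pm m) (F m)) -> card_le P (\sum_(m <- l) F m).
Proof.
move=> PU PF.
pose f x := xget 0%N (fun m => m \in l /\ Pm m x).
have fP x : P x -> f x \in l /\ Pm (f x) x.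
  move=> /PU[m ml Pmx].
  exact: (xgetPex 0%N (ex_intro (fun m => m \in l /\ Pm m x) m (conj ml Pmx))).
apply: (@card_le_fib _ _ _ f) => [x /fP[]//|m ml].
by apply: (card_le_sub _ (PF m ml) (lexx _)) => x [/fP[_ Px] <-].
Qed.

Lemma residue_le (R : realType) (m L : nat) (P : nat -> Prop) : (0 < m)%N ->
  (forall l l', P l -> P l' -> (l' < l)%N -> (m %| l - l')%N) ->
  card_le (fun l => (l < L)%N /\ P l) (1 + L%:R / m%:R : R).
Proof.
move=> m0 H; apply: (@spaced_le _ _ _ (fun l => l%:R)); rewrite ?ltr0n ?ler0n //.
- have W l l' : P l -> P l' -> (l' < l)%N -> m%:R <= `|l%:R - l'%:R| :> R.
    move=> Pl Pl' ll; rewrite -natrB ?(ltnW ll) // normr_nat ler_nat.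
    by apply: dvdn_leq; [rewrite subn_gt0|exact: H].
  move=> x y [_ Px] [_ Py] /eqP; rewrite neq_ltn => /orP[h|h]; last exact: W.
  by rewrite distrC; exact: W.
move=> x y [xL _] [yL _].
have x0 := ler0n R x; have y0 := ler0n R y.
have xl : x%:R <= L%:R :> R by rewrite ler_nat ltnW.
have yl : y%:R <= L%:R :> R by rewrite ler_nat ltnW.
by rewrite ler_norml; apply/andP; split; lra.
Qed.

(** No 1 is added to [J / m]: the values [j + 1] start at 1, and none below [m] is a multiple of it.
    This matters because, unlike [I] and [L], the side [J] need not be large compared with [m]. *)
Lemma multiples_le (R : realType) (m J : nat) : (0 < m)%N ->
  card_le (fun j => (j < J)%N /\ (m %| j.+1)%N) (J%:R / m%:R : R).
Proof.
move=> m0; apply: (@card_le_mono _ _ _ ((J %/ m)%N%:R)); last first.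
  by rewrite ler_pdivlMr ?ltr0n // -natrM ler_nat leq_trunc_div.
apply: (@card_le_inj _ _ _ (fun j => j.+1 %/ m)%N _ (fun k => (1 <= k < 1 + J %/ m)%N)); last exact: card_le_iota.
- by move=> x y [_ dx] [_ dy] e; apply: succn_inj; rewrite -(divnK dx) -(divnK dy) e.
by move=> x [xJ dx]; rewrite divn_gt0 // dvdn_leq //= add1n ltnS; exact: leq_div2r.
Qed.

Lemma box_le (R : realType) (Qi Qj : nat -> Prop) (Ql : nat -> nat -> nat -> Prop) (a b c : R) :
  card_le Qi a -> card_le Qj b -> 0 <= c -> (forall i j, card_le (Ql i j) c) ->
  card_le (fun x : nat * nat * nat => [/\ Qi x.1.1, Qj x.1.2 & Ql x.1.1 x.1.2 x.2]) (a * b * c).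
Proof.
move=> Ha Hb c0 Hc.
apply: (@card_le_fibM _ _ _ fst _ _ _ _ c0 _ (card_le_prod Ha Hb)) => [x []//|[i j] _].
apply: (@card_le_inj _ _ _ snd _ _ _ _ _ (Hc i j)).
- by move=> [x1 x2] [y1 y2] [_ /= ->] [_ /= ->] ->.
- by move=> [[x1 x2] x3] [[_ _ /= h] /= [<- <-]].
Qed.

Lemma sum_inv_sq_gt (R : realType) (Z n : nat) : (0 < Z)%N ->
  \sum_(m <- iota 1 n | (Z < m)%N) (m%:R ^+ 2)^-1 <= Z%:R^-1 :> R.
Proof.
move=> Z0; have Zr : (0 : R) < Z%:R by rewrite ltr0n.
apply: (@le_trans _ _ (if (n <= Z)%N then 0 else Z%:R^-1 - n%:R^-1)); last first.
  case: ifP => _; first by rewrite invr_ge0 ltW.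
  by rewrite lerBlDr lerDl invr_ge0.
elim: n => [|n IH]; first by rewrite big_nil.
have -> : iota 1 n.+1 = iota 1 n ++ [:: n.+1] by have := iotaD 1 n 1; rewrite addn1 add1n.
rewrite big_cat /= big_cons big_nil.
case: (leqP n.+1 Z) => nZ.
  by rewrite (leq_trans (leqnSn _) nZ) in IH; rewrite addr0.
rewrite addr0 -lerBrDr; apply: le_trans IH _.
have n0 : (0 : R) < n%:R by rewrite ltr0n; exact: leq_trans Z0 nZ.
have key : (n.+1%:R ^+ 2)^-1 <= n%:R^-1 - n.+1%:R^-1 :> R.
  rewrite -natr1; set x := n%:R in n0 *.
  have x1 : x + 1 != 0 by rewrite gt_eqF //; lra.
  have -> : x^-1 - (x + 1)^-1 = (x * (x + 1))^-1.
    by field; rewrite x1 gt_eqF.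
  by rewrite lef_pV2 ?posrE ?exprn_gt0 ?mulr_gt0 //; nra.
move: key; set p := (_ ^+ 2)^-1; set q := n.+1%:R^-1 => key.
case: ifP => h; last by move: (n%:R^-1) (Z%:R^-1) key => u v; lra.
have nE : n = Z by apply/eqP; rewrite eqn_leq h -ltnS.
by rewrite nE in key; move: (Z%:R^-1) key => v; lra.
Qed.

Definition card_ge (R : realType) (T : eqType) (P : T -> Prop) (r : R) : Prop :=
  exists s : seq T, [/\ uniq s, forall x, x \in s -> P x & r <= (size s)%:R].

Lemma card_ge_diff (R : realType) (T : eqType) (s : seq T) (P Q : T -> Prop) (r : R) :
  uniq s -> (forall x, x \in s -> P x \/ Q x) -> card_le Q r ->
  card_ge P ((size s)%:R - r).
Proof.
move=> us PQ Qr; pose p x := `[< P x >].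
exists [seq x <- s | p x]; split.
- exact: filter_uniq.
- by move=> x; rewrite mem_filter => /andP[/asboolP].
rewrite lerBlDr -(count_predC p s) natrD size_filter lerD2l -size_filter.
apply: Qr; first exact: filter_uniq.
by move=> x; rewrite mem_filter => /andP[/asboolPn np xs]; case: (PQ x xs).
Qed.

Lemma card_ge_mono (R : realType) (T : eqType) (P Q : T -> Prop) (r r' : R) :
  (forall x, P x -> Q x) -> card_ge P r -> r' <= r -> card_ge Q r'.
Proof.
move=> PQ [s [us sP sr]] rr; exists s; split=> // [x /sP /PQ //|].
exact: le_trans rr sr.
Qed.

Lemma card_ge_sum (R : realType) (T I : eqType) (l : seq I) (P : I -> T -> Prop) (F : I -> R) :
  uniq l -> (forall i, i \in l -> card_ge (P i) (F i)) ->
  card_ge (fun x : I * T => x.1 \in l /\ P x.1 x.2) (\sum_(i <- l) F i).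
Proof.
elim: l => [|i l IH] /=; first by move=> _ _; exists [::]; rewrite big_nil.
move=> /andP[il ul] H.
have [s [us sP sF]] := H i (mem_head _ _).
have [t [ut tP tF]] : card_ge (fun x : I * T => x.1 \in l /\ P x.1 x.2) (\sum_(i <- l) F i).
  by apply: IH => // j jl; apply: H; rewrite inE jl orbT.
exists (map (pair i) s ++ t); split.
- rewrite cat_uniq map_inj_uniq ?us ?ut ?andbT /=; last by move=> x y [].
  apply/hasPn => x /tP[xl _]; apply/mapP => -[y _ xE].
  by rewrite xE /= (negPf il) in xl.
- move=> x; rewrite mem_cat => /orP[/mapP[y ys ->]|/tP[xl Px]] /=; rewrite inE.
    by rewrite eqxx; split=> //; exact: sP.
  by rewrite xl orbT.
by rewrite big_cons size_cat size_map natrD; exact: lerD.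
Qed.

Lemma not_coprimeP (a b : nat) : (0 < b)%N -> ~~ coprime a b ->
  exists m, [/\ prime m, (m %| a)%N & (m %| b)%N].
Proof.
move=> b0 nc; exists (pdiv (gcdn a b)).
have g1 : (1 < gcdn a b)%N by rewrite ltn_neqAle eq_sym nc gcdn_gt0 b0 orbT.
split; first exact: pdiv_prime.
- exact: dvdn_trans (pdiv_dvd _) (dvdn_gcdl _ _).
exact: dvdn_trans (pdiv_dvd _) (dvdn_gcdr _ _).
Qed.

Definition in_box (I J L : nat) (x : nat * nat * nat) : bool :=
  [&& (x.1.1 < I)%N, (x.1.2 < J)%N & (x.2 < L)%N].

(** The value is 1 modulo [K], so its prime factors do not divide [K]; the shift of [i] keeps it
    above 1 when [K > 0]. *)
Definition spar (K i : nat) : nat := (1 + K * i.+1)%N.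

Lemma spar_residue (R : realType) (K m I : nat) : (0 < m)%N ->
  card_le (fun i => (i < I)%N /\ (coprime m K /\ (m %| spar K i)%N)) (1 + I%:R / m%:R : R).
Proof.
move=> m0; apply: residue_le => // i i' [mK mi] [_ mi'] ii.
have := dvdn_sub mi mi'; rewrite /spar subnDl -mulnBr subSS.
by rewrite Gauss_dvdr.
Qed.

Lemma b_residue (R : realType) (be d3 m L : nat) : (0 < m)%N ->
  card_le (fun l => (l < L)%N /\ (coprime m d3 /\ (m %| be + d3 * l)%N)) (1 + L%:R / m%:R : R).
Proof.
move=> m0; apply: residue_le => // i i' [mK mi] [_ mi'] ii.
have := dvdn_sub mi mi'; rewrite subnDl -mulnBr.
by rewrite Gauss_dvdr.
Qed.

(** For fixed [i] and [j], raising [l] by one raises [b] by [d3] and lowers [c] by [d2], a unit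
    modulo [m]. *)
Lemma c_residue (R : realType) (X Y d2 d3 be m L : nat) (ce : nat -> int) :
  (0 < m)%N -> (0 < d3)%N ->
  (forall l, (X + d2 * (be + d3 * l))%N%:Z + d3%:Z * ce l = Y%:Z) ->
  card_le (fun l => (l < L)%N /\ (coprime m d2 /\ (m %| `|ce l|)%N)) (1 + L%:R / m%:R : R).
Proof.
move=> m0 d30 E; apply: residue_le => // l l' [mK ml] [_ ml'] ll.
have E' k : d3%:Z * ce k = Y%:Z - (X + d2 * (be + d3 * k))%N%:Z.
  by rewrite -(E k) addrC addKr.
have d3n : d3%:Z != 0 by rewrite eqz_nat -lt0n.
have cE : ce l' - ce l = (d2 * (l - l'))%N%:Z.
  apply: (mulfI d3n); rewrite mulrBr !E' PoszM -subzn ?(ltnW ll) //.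
  by rewrite !PoszD !PoszM !PoszD !PoszM; ring.
have : (m%:Z %| ce l' - ce l)%Z by apply: rpredB; rewrite dvdzE.
by rewrite cE dvdzE /= Gauss_dvdr.
Qed.

Lemma card_le_or (R : realType) (T : eqType) (P1 P2 : T -> Prop) (a b : R) :
  card_le P1 a -> card_le P2 b -> card_le (fun x => P1 x \/ P2 x) (a + b).
Proof. exact: card_leU. Qed.

Lemma card_le_lt (R : realType) (M : nat) : card_le (fun i => (i < M)%N) (M%:R : R).
Proof. by apply: (card_le_sub _ (@card_le_iota R 0 M) (lexx _)) => i; rewrite add0n. Qed.

(** The coprimality clauses are those under which the divisibility fixes [l] modulo [m]. For a prime
    factor of [w] at which they fail, the equation leads back to the first alternative. *)
Definition bad_div (m d2 d3 : nat) (be : nat -> nat -> nat)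
    (ce : nat -> nat -> nat -> int) (x : nat * nat * nat) : Prop :=
  [\/ (m %| x.1.2.+1)%N, coprime m d3 /\ (m %| be x.1.1 x.1.2 + d3 * x.2)%N |
      coprime m d2 /\ (m %| `|ce x.1.1 x.1.2 x.2|)%N].

(** Each single divisibility has density about [1 / m]. Since [m <= I] and [m <= L], the added ones
    at most double the counts, and the total stays below 8. *)
Lemma bad_w_le (R : realType) (w d1 d2 d3 K I J L m : nat)
    (be : nat -> nat -> nat) (ce : nat -> nat -> nat -> int) :
  (0 < d3)%N -> (0 < m <= I)%N -> (m <= L)%N ->
  (forall i j l, (d1 * j.+1 + d2 * (be i j + d3 * l))%N%:Z + d3%:Z * ce i j l =
     (w * spar K i)%N%:Z) ->
  card_le (fun x => in_box I J L x /\ ((coprime m K /\ (m %| spar K x.1.1)%N) \/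
     bad_div m d2 d3 be ce x)) (8 * (I%:R * J%:R * L%:R / m%:R) : R).
Proof.
move=> d30 /andP[m0 mI] mL E.
have g0 : (0 : R) <= 1 + L%:R / m%:R by rewrite addr_ge0 // divr_ge0.
have H1 := box_le (@spar_residue R K m I m0) (@card_le_lt R J) (ler0n R L) (fun i j => @card_le_lt R L).
have H2 := box_le (@card_le_lt R I) (@multiples_le R m J m0) (ler0n R L) (fun i j => @card_le_lt R L).
have H3 := box_le (@card_le_lt R I) (@card_le_lt R J) g0
  (fun i j => @b_residue R (be i j) d3 m L m0).
have H4 := box_le (@card_le_lt R I) (@card_le_lt R J) g0
  (fun i j => @c_residue R _ _ _ _ _ m L (ce i j) m0 d30 (E i j)).
apply: (card_le_sub _ (card_le_or H1 (card_le_or H2 (card_le_or H3 H4)))).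
  move=> [[i j] l] [/and3P[/= iI jJ lL] [h|[/= h|/= h|/= h]]].
  - by left.
  - by right; left.
  - by right; right; left.
  - by right; right; right.
set i := I%:R; set j := J%:R; set l := L%:R; set t := m%:R; set T := i * j * l / t.
have t0 : 0 < t by rewrite ltr0n.
have x1 : 1 <= i / t by rewrite ler_pdivlMr // mul1r ler_nat.
have z1 : 1 <= l / t by rewrite ler_pdivlMr // mul1r ler_nat.
have jl : j * l <= T.
  have -> : T = (i / t) * (j * l) by rewrite /T; ring.
  by rewrite ler_peMl // mulr_ge0 // ler0n.
have ij : i * j <= T.
  have -> : T = (l / t) * (i * j) by rewrite /T; ring.
  by rewrite ler_peMl // mulr_ge0 // ler0n.
have T0 : 0 <= T by apply: le_trans ij; rewrite mulr_ge0 // ler0n.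
have -> : (1 + i / t) * j * l + (i * (j / t) * l + (i * j * (1 + l / t) + i * j * (1 + l / t))) =
  j * l + T + T + 2 * (i * j + T) by rewrite /T; ring.
by lra.
Qed.

(** Divisibility of [s] and of one of [a], [b], [c] together have density about [1 / m^2]. Beyond
    [minn I L] the added ones matter, but [m <= 2 K I] still gives [1 + I / m <= (2 K + 1) I / m],
    and similarly for [L]. *)
Lemma bad_s_le (R : realType) (w d1 d2 d3 K I J L m : nat)
    (be : nat -> nat -> nat) (ce : nat -> nat -> nat -> int) :
  (0 < d3)%N -> (0 < L)%N -> (0 < m <= 2 * K * I)%N ->
  (forall i j l, (d1 * j.+1 + d2 * (be i j + d3 * l))%N%:Z + d3%:Z * ce i j l =
     (w * spar K i)%N%:Z) ->
  card_le (fun x => in_box I J L x /\ ((coprime m K /\ (m %| spar K x.1.1)%N) /\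
     bad_div m d2 d3 be ce x))
   (I%:R * J%:R * L%:R * (10 * (m%:R ^+ 2)^-1 + (if (minn I L < m)%N then
      3 * (2 * K).+1%:R * (2 * K * I + L)%N%:R / L%:R * (m%:R ^+ 2)^-1 else 0)) : R).
Proof.
move=> d30 L0 /andP[m0 mM] E.
have g0 : (0 : R) <= 1 + L%:R / m%:R by rewrite addr_ge0 // divr_ge0.
have H2 := box_le (@spar_residue R K m I m0) (@multiples_le R m J m0) (ler0n R L) (fun i j => @card_le_lt R L).
have H3 := box_le (@spar_residue R K m I m0) (@card_le_lt R J) g0
  (fun i j => @b_residue R (be i j) d3 m L m0).
have H4 := box_le (@spar_residue R K m I m0) (@card_le_lt R J) g0
  (fun i j => @c_residue R _ _ _ _ _ m L (ce i j) m0 d30 (E i j)).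
apply: (card_le_sub _ (card_le_or H2 (card_le_or H3 H4))).
  move=> [[i j] l] [/and3P[/= iI jJ lL] [h0 [/= h|/= h|/= h]]].
  - by left.
  - by right; left.
  - by right; right.
have jj0 := ler0n R J; have ii0 := ler0n R I; have ll0 : 0 < L%:R :> R by rewrite ltr0n.
have t0 : (0 : R) < m%:R by rewrite ltr0n.
have key (X Y Y' : R) : 1 + I%:R / m%:R <= X -> 1 + L%:R / m%:R <= Y -> L%:R / m%:R <= Y' ->
    (1 + I%:R / m%:R) * (J%:R / m%:R) * L%:R + ((1 + I%:R / m%:R) * J%:R * (1 + L%:R / m%:R) +
      (1 + I%:R / m%:R) * J%:R * (1 + L%:R / m%:R)) <= X * J%:R * (Y' + Y + Y).
  move=> hX hY hY'.
  have x0 : (0 : R) <= 1 + I%:R / m%:R by rewrite addr_ge0 // divr_ge0.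
  have z0 : (0 : R) <= L%:R / m%:R by rewrite divr_ge0.
  have XJ : (1 + I%:R / m%:R) * J%:R <= X * J%:R by apply: ler_wpM2r.
  have xj0 : 0 <= (1 + I%:R / m%:R) * J%:R :> R by rewrite mulr_ge0.
  have -> : X * J%:R * (Y' + Y + Y) = X * J%:R * Y' + (X * J%:R * Y + X * J%:R * Y) by ring.
  apply: lerD; last by apply: lerD; apply: ler_pM => //; rewrite addr_ge0.
  have -> : (1 + I%:R / m%:R) * (J%:R / m%:R) * L%:R = (1 + I%:R / m%:R) * J%:R * (L%:R / m%:R) :> R by ring.
  by apply: ler_pM.
case: (ltnP (minn I L) m) => hm.
  apply: le_trans (key ((2 * K).+1%:R * I%:R / m%:R) ((2 * K * I + L)%N%:R / m%:R)
    ((2 * K * I + L)%N%:R / m%:R) _ _ _) _.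
  - have -> : 1 + I%:R / m%:R = (m%:R + I%:R) / m%:R :> R by rewrite mulrDl divff ?gt_eqF.
    rewrite ler_pM2r ?invr_gt0 // -natrM -natrD ler_nat.
    by rewrite mulSn addnC leq_add2l.
  - have -> : 1 + L%:R / m%:R = (m%:R + L%:R) / m%:R :> R by rewrite mulrDl divff ?gt_eqF.
    by rewrite ler_pM2r ?invr_gt0 // -natrD ler_nat leq_add2r.
  - by rewrite ler_pM2r ?invr_gt0 // ler_nat leq_addl.
  rewrite [leRHS]mulrDr.
  set X := (2 * K).+1%:R; set Y := (2 * K * I + L)%N%:R.
  have -> : I%:R * J%:R * L%:R * (3 * X * Y / L%:R * (m%:R ^+ 2)^-1) =
     X * I%:R / m%:R * J%:R * (Y / m%:R + Y / m%:R + Y / m%:R).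
    by rewrite -exprVn; field; rewrite !gt_eqF.
  by rewrite lerDr !mulr_ge0 // invr_ge0 exprn_ge0 // ltW.
rewrite addr0.
(* [10] is [2 * (1 + 2 + 2)]. *)
apply: le_trans (key (2 * (I%:R / m%:R)) (2 * (L%:R / m%:R)) (L%:R / m%:R) _ _ (lexx _)) _.
- have : 1 <= I%:R / m%:R :> R.
    by rewrite ler_pdivlMr // mul1r ler_nat (leq_trans hm) // geq_minl.
  by lra.
- have : 1 <= L%:R / m%:R :> R.
    by rewrite ler_pdivlMr // mul1r ler_nat (leq_trans hm) // geq_minr.
  by lra.
by rewrite -exprVn le_eqVlt; apply/orP; left; apply/eqP; ring.
Qed.

(** Union bound over primes above [P0]. Those dividing [w] spoil at most [8 / 32] of the box. Those
    dividing [s] spoil at most [10 / 320], plus a tail beyond [minn I L] that the hypothesis with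
    [96] limits to [3 / 96]. *)
Lemma coprime_triples_many (R : realType) (w d1 d2 d3 K P0 Q I J L : nat)
   (be : nat -> nat -> nat) (ce : nat -> nat -> nat -> int) :
  (0 < w)%N -> (0 < d3)%N -> coprime d1 d2 -> coprime d1 d3 ->
  (forall m, prime m -> (m %| d2)%N || (m %| d3)%N -> (m %| w)%N) ->
  (forall m, (0 < m <= P0)%N -> (m %| K)%N) -> (0 < K)%N -> coprime w K ->
  (forall m, prime m -> (m %| w)%N -> (m <= Q)%N) ->
  (320 <= P0)%N -> (0 < I)%N -> (Q <= I)%N -> (Q <= L)%N ->
  (96 * (2 * K).+1 * (2 * K * I + L) <= L * minn I L)%N ->
  \sum_(m <- iota 1 Q | [&& prime m, (P0 < m)%N & (m %| w)%N]) m%:R^-1 <= 1 / 32 :> R ->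
  (forall i j l, (d1 * j.+1 + d2 * (be i j + d3 * l))%N%:Z + d3%:Z * ce i j l =
     (w * spar K i)%N%:Z) ->
  card_ge (fun x => in_box I J L x /\
    let s := spar K x.1.1 in let a := x.1.2.+1 in
    let b := (be x.1.1 x.1.2 + d3 * x.2)%N in let c := `|ce x.1.1 x.1.2 x.2|%N in
    [&& coprime s w, coprime a w, coprime b w & coprime c w] &&
    [&& coprime a s, coprime b s & coprime c s]) (I%:R * J%:R * L%:R / 2 : R).
Proof.
move=> w0 d30 c12 c13 hd hK K0 wK hQ P320 I0 QI QL hbig hsig E.
have L0 : (0 < L)%N.
  case: (posnP L) hbig => // ->; rewrite mul0n leqn0 !muln_eq0 /= addn0 !muln_eq0 /=.
  by rewrite !gtn_eqF.
have pK m : prime m -> coprime m K -> (P0 < m)%N.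
  move=> pm; apply: contraLR; rewrite -leqNgt => mP.
  by rewrite prime_coprime // hK // prime_gt0.
have sK m i : prime m -> (m %| spar K i)%N -> coprime m K.
  move=> pm ms; rewrite prime_coprime //; apply/negP => mK; move: ms.
  rewrite /spar dvdn_addl ?dvdn_mulr // dvdn1 => /eqP m1.
  by rewrite m1 in pm.
pose s3 := [seq (x, l) | x <- [seq (i, j) | i <- iota 0 I, j <- iota 0 J], l <- iota 0 L].
have us3 : uniq s3.
  apply: allpairs_uniq; [|exact: iota_uniq|by move=> [x l] [x' l'] _ _ [-> ->]].
  by apply: allpairs_uniq; [exact: iota_uniq|exact: iota_uniq|move=> [x l] [x' l'] _ _ [-> ->]].
have sz : (size s3)%:R = I%:R * J%:R * L%:R :> R.
  by rewrite !size_allpairs !size_iota !natrM.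
have ms3 x : x \in s3 -> in_box I J L x.
  move=> /allpairsP[[y l] /= [/allpairsP[[i j] /= [ii jj ->]] ll ->]].
  by move: ii jj ll; rewrite /in_box /= !mem_iota !add0n !leq0n /= => -> -> ->.
set T : R := I%:R * J%:R * L%:R in sz *.
have T0 : 0 <= T by rewrite !mulr_ge0.
pose lB := [seq m <- iota 1 Q | [&& prime m, (P0 < m)%N & (m %| w)%N]].
pose lC := [seq m <- iota 1 (2 * K * I) | (P0 < m)%N].
pose PB m (x : nat * nat * nat) := in_box I J L x /\ ((coprime m K /\ (m %| spar K x.1.1)%N) \/
     bad_div m d2 d3 be ce x).
pose PC m (x : nat * nat * nat) := in_box I J L x /\ ((coprime m K /\ (m %| spar K x.1.1)%N) /\
     bad_div m d2 d3 be ce x).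
have HB : card_le (fun x => exists2 m, m \in lB & PB m x) (\sum_(m <- lB) 8 * (T / m%:R)).
  apply: (@card_le_bigU _ _ _ _ PB) => // m; rewrite mem_filter mem_iota add1n ltnS.
  move=> /andP[_ /andP[m0 mQ]]; apply: bad_w_le E => //; first by rewrite m0 (leq_trans mQ).
  exact: leq_trans QL.
pose kap : R := 3 * (2 * K).+1%:R * (2 * K * I + L)%N%:R / L%:R.
have HC : card_le (fun x => exists2 m, m \in lC & PC m x) (\sum_(m <- lC)
    T * (10 * (m%:R ^+ 2)^-1 + (if (minn I L < m)%N then kap * (m%:R ^+ 2)^-1 else 0))).
  apply: (@card_le_bigU _ _ _ _ PC) => // m; rewrite mem_filter mem_iota add1n ltnS.
  by move=> /andP[_ mM]; exact: bad_s_le E.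
have Bw : \sum_(m <- lB) 8 * (T / m%:R) <= T / 4.
  rewrite /lB big_filter -mulr_sumr -mulr_sumr.
  have := ler_wpM2l T0 hsig; lra.
have Z0 : (0 < minn I L)%N by rewrite leq_min I0 L0.
have Zr : (0 : R) < (minn I L)%:R by rewrite ltr0n.
have Lr : (0 : R) < L%:R by rewrite ltr0n.
have kap0 : 0 <= kap by rewrite /kap !mulr_ge0 // invr_ge0.
have Cw : \sum_(m <- lC) T * (10 * (m%:R ^+ 2)^-1 +
    (if (minn I L < m)%N then kap * (m%:R ^+ 2)^-1 else 0)) <= T / 4.
  rewrite -mulr_sumr; apply: ler_wpM2l => //; rewrite big_split /= -mulr_sumr.
  have h1 : \sum_(m <- lC) (m%:R ^+ 2)^-1 <= P0%:R^-1 :> R.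
    by rewrite /lC big_filter; apply: sum_inv_sq_gt; apply: leq_trans P320.
  have h2 : \sum_(m <- lC) (if (minn I L < m)%N then kap * (m%:R ^+ 2)^-1 else 0) <= kap * (minn I L)%:R^-1.
    apply: le_trans (ler_wpM2l kap0 (@sum_inv_sq_gt R (minn I L) (2 * K * I) Z0)).
    rewrite mulr_sumr [leRHS]big_mkcond /= /lC big_filter [leLHS]big_mkcond /=.
    apply: ler_sum => m _; case: ifP => _ //; case: ifP => _ //.
    by rewrite mulr_ge0 // invr_ge0 exprn_ge0.
  have h3 : P0%:R^-1 <= 1 / 320 :> R.
    by rewrite div1r lef_pV2 ?posrE ?ltr0n ?(ler_nat R 320 P0) //; apply: leq_trans P320.
  have h4 : kap * (minn I L)%:R^-1 <= 1 / 32.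
    rewrite ler_pdivrMr // /kap ler_pdivrMr //.
    have := hbig; rewrite -(ler_nat R) natrM 2!(natrM R); lra.
  apply: (@le_trans _ _ (10 * P0%:R^-1 + kap * (minn I L)%:R^-1)).
    by apply: lerD => //; apply: ler_wpM2l.
  by move: (P0%:R^-1 : R) (kap * _) h3 h4 => u v h3 h4; lra.
have : card_le (fun x => (exists2 m, m \in lB & PB m x) \/ (exists2 m, m \in lC & PC m x)) (T / 2).
  by apply: (card_le_mono (card_le_or HB HC)); lra.
move=> HBC; have -> : T / 2 = (size s3)%:R - T / 2 by rewrite sz; lra.
apply: (card_ge_diff us3 _ HBC) => -[[i j] l] /ms3 bx.
case: (boolP ([&& coprime (spar K i) w, coprime j.+1 w, coprime (be i j + d3 * l) w & coprime `|ce i j l| w] &&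
    [&& coprime j.+1 (spar K i), coprime (be i j + d3 * l) (spar K i) & coprime `|ce i j l| (spar K i)])) => good.
  by left.
right.
(* A prime factor of [w] dividing two terms of the equation divides the third. If it divides [d2] or
   [d3], it is prime to [d1] and so divides [a], where the count needs no residue class for [l]. *)
have dva m : (m %| w)%N -> (m %| d2 * (be i j + d3 * l))%N -> (m %| d3 * `|ce i j l|)%N -> (m %| d1 * j.+1)%N.
  move=> mw m2 m3; have e := E i j l.
  have : (m%:Z %| (d1 * j.+1)%N%:Z)%Z.
    have -> : (d1 * j.+1)%N%:Z = (w * spar K i)%N%:Z - (d2 * (be i j + d3 * l))%N%:Z - d3%:Z * ce i j l.
      by rewrite -e PoszD; ring.
    apply: rpredB; last by rewrite dvdzE abszM.
    by apply: rpredB; rewrite dvdzE //= dvdn_mulr.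
  by rewrite dvdzE.
have wB m : prime m -> (m %| w)%N -> [\/ (m %| spar K i)%N, (m %| j.+1)%N, (m %| be i j + d3 * l)%N |
    (m %| `|ce i j l|)%N] -> exists2 m, m \in lB & PB m (i, j, l).
  move=> pm mw h; have mK : coprime m K by apply: coprime_dvdl mw wK.
  exists m; first by rewrite mem_filter pm mw pK // mem_iota prime_gt0 // add1n ltnS hQ.
  split=> //; rewrite /bad_div /=.
  case: h => h; first by left.
  - by right; constructor 1.
  - case: (boolP (coprime m d3)) => md3; first by right; constructor 2.
    rewrite prime_coprime // negbK in md3; right; constructor 1.
    have := dva m mw (dvdn_mull _ h) (dvdn_mulr _ md3).
    by rewrite Gauss_dvdr // coprime_sym; apply: coprime_dvdr md3 c13.
  - case: (boolP (coprime m d2)) => md2; first by right; constructor 3.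
    rewrite prime_coprime // negbK in md2; right; constructor 1.
    have := dva m mw (dvdn_mulr _ md2) (dvdn_mull _ h).
    by rewrite Gauss_dvdr // coprime_sym; apply: coprime_dvdr md2 c12.
have s0 : (0 < spar K i)%N by rewrite /spar addn_gt0.
have sC m : prime m -> (m %| spar K i)%N -> [\/ (m %| j.+1)%N, (m %| be i j + d3 * l)%N |
    (m %| `|ce i j l|)%N] -> (exists2 m, m \in lB & PB m (i, j, l)) \/ (exists2 m, m \in lC & PC m (i, j, l)).
  move=> pm ms h; case: (boolP (m %| w)%N) => mw; first by left; apply: (wB m) => //; constructor 1.
  have mK := sK m i pm ms.
  right; exists m.
    rewrite mem_filter pK // mem_iota prime_gt0 //= add1n ltnS.
    apply: leq_trans (dvdn_leq s0 ms) _; move: bx => /and3P[/= iI _ _].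
    have : (K * i.+1 <= K * I)%N by rewrite leq_mul2l iI orbT.
    have : (0 < K * I)%N by rewrite muln_gt0 K0.
    by rewrite /spar -mulnA; move: (K * i.+1)%N (K * I)%N => u v; lia.
  split=> //; split=> //; rewrite /bad_div /=.
  have md2 : coprime m d2 by rewrite prime_coprime //; apply: contraNN mw => h2; apply: hd; rewrite ?h2.
  have md3 : coprime m d3 by rewrite prime_coprime //; apply: contraNN mw => h2; apply: hd; rewrite ?h2 ?orbT.
  by case: h => h; [constructor 1|constructor 2|constructor 3].
move: good; rewrite negb_and !negb_and => /orP[/or4P[] h|/or3P[] h].
- by have [m [pm m1 m2]] := not_coprimeP w0 h; left; apply: (wB m) => //; constructor 1.
- by have [m [pm m1 m2]] := not_coprimeP w0 h; left; apply: (wB m) => //; constructor 2.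
- by have [m [pm m1 m2]] := not_coprimeP w0 h; left; apply: (wB m) => //; constructor 3.
- by have [m [pm m1 m2]] := not_coprimeP w0 h; left; apply: (wB m) => //; constructor 4.
- by have [m [pm m1 m2]] := not_coprimeP s0 h; apply: (sC m) => //; constructor 1.
- by have [m [pm m1 m2]] := not_coprimeP s0 h; apply: (sC m) => //; constructor 2.
- by have [m [pm m1 m2]] := not_coprimeP s0 h; apply: (sC m) => //; constructor 3.
Qed.

(** * Weighted sums over sextuples *)

Definition sum3 (R : realType) (T : eqType) (l : seq T) (F : T -> T -> T -> R) : R :=
  \sum_(p <- l) \sum_(q <- l) \sum_(r <- l) F p q r.

Lemma sum3_le (R : realType) (T : eqType) (l : seq T) (F G : T -> T -> T -> R) :
  (forall p q r, p \in l -> q \in l -> r \in l -> F p q r <= G p q r) ->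
  sum3 l F <= sum3 l G.
Proof.
move=> FG; rewrite /sum3 big_seq [leRHS]big_seq; apply: ler_sum => p pl.
rewrite big_seq [leRHS]big_seq; apply: ler_sum => q ql.
by rewrite big_seq [leRHS]big_seq; apply: ler_sum => r rl; exact: FG.
Qed.

Lemma sum3D (R : realType) (T : eqType) (l : seq T) (F G : T -> T -> T -> R) :
  sum3 l (fun p q r => F p q r + G p q r) = sum3 l F + sum3 l G.
Proof.
rewrite /sum3 -big_split; apply: eq_bigr => p _ /=.
rewrite -big_split; apply: eq_bigr => q _ /=.
by rewrite -big_split.
Qed.

Lemma sum3M (R : realType) (T : eqType) (l : seq T) (f g h : T -> R) :
  sum3 l (fun p q r => f p * g q * h r) =
  (\sum_(p <- l) f p) * (\sum_(p <- l) g p) * (\sum_(p <- l) h p).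
Proof.
rewrite /sum3 !mulr_suml; apply: eq_bigr => p _.
rewrite [f p * _]mulr_sumr mulr_suml; apply: eq_bigr => q _.
by rewrite mulr_sumr.
Qed.

Lemma sum3_exchange (R : realType) (T : eqType) (l : seq T) (s : seq nat) (c : pred nat)
    (F : nat -> T -> T -> T -> R) :
  sum3 l (fun p q r => \sum_(m <- s | c m) F m p q r) = \sum_(m <- s | c m) sum3 l (F m).
Proof.
rewrite /sum3 [RHS]exchange_big /=; apply: eq_bigr => p _.
rewrite [RHS]exchange_big /=; apply: eq_bigr => q _.
by rewrite [RHS]exchange_big.
Qed.

Definition coprimes_to (K Q : nat) : seq nat := [seq k <- iota 1 Q | coprime k K].

Definition pairs_to (K Q : nat) : seq (nat * nat) :=
  [seq (u, y) | u <- coprimes_to K Q, y <- coprimes_to K Q].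

Definition invsum (R : realType) (K Q : nat) : R := \sum_(k <- coprimes_to K Q) k%:R^-1.

Definition invp (R : realType) (p : nat * nat) : R := p.1%:R^-1 * p.2%:R^-1.

Definition divs (m : nat) (p : nat * nat) : nat := ((m %| p.1) + (m %| p.2))%N.

Lemma coprimes_toP (K Q k : nat) : reflect ((0 < k <= Q)%N /\ coprime k K) (k \in coprimes_to K Q).
Proof.
rewrite mem_filter mem_iota add1n ltnS.
by apply: (iffP andP) => -[].
Qed.

Lemma pairs_toP (K Q : nat) (p : nat * nat) : p \in pairs_to K Q ->
  [/\ (0 < p.1 <= Q)%N, coprime p.1 K, (0 < p.2 <= Q)%N & coprime p.2 K].
Proof. by move=> /allpairsP[[u y] /= [/coprimes_toP[? ?] /coprimes_toP[? ?] ->]]. Qed.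

Lemma invsum_ge0 (R : realType) (K Q : nat) : 0 <= invsum R K Q.
Proof. by apply: sumr_ge0 => k _; rewrite invr_ge0. Qed.

Lemma sum_invp (R : realType) (K Q : nat) :
  \sum_(p <- pairs_to K Q) invp R p = invsum R K Q ^+ 2.
Proof.
rewrite /pairs_to big_allpairs /invp /= expr2 /invsum mulr_suml.
by apply: eq_bigr => u _; rewrite mulr_sumr.
Qed.

Lemma invsum_multiples (R : realType) (K Q m : nat) : (0 < m)%N ->
  \sum_(k <- coprimes_to K Q | (m %| k)%N) k%:R^-1 <= invsum R K Q / m%:R.
Proof.
move=> m0; pose F k : R := if coprime k K then k%:R^-1 else 0.
have F0 k : 0 <= F k by rewrite /F; case: ifP; rewrite ?invr_ge0.
have -> : \sum_(k <- coprimes_to K Q | (m %| k)%N) k%:R^-1 = \sum_(k <- iota 1 Q | (m %| k)%N) F k :> R.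
  rewrite big_mkcond /= /coprimes_to big_filter [RHS]big_mkcond [LHS]big_mkcond /=.
  by apply: eq_bigr => k _; rewrite /F; case: ifP; case: ifP.
apply: le_trans (sum_multiples_le _ m0 F0) _.
have -> : invsum R K Q = \sum_(k <- iota 1 Q) F k.
  by rewrite /invsum /coprimes_to big_filter big_mkcond.
rewrite mulr_suml; apply: ler_sum => k _; rewrite /F coprimeMl.
case: (coprime k K); last by rewrite andbF mul0r.
by rewrite andbT; case: ifP => _; rewrite ?natrM ?invfM 1?mulrC // mulr_ge0 // invr_ge0.
Qed.

(** Each of the two entries is a multiple of [m] with weighted density at most [1 / m]. *)
Lemma sum_invp_divs (R : realType) (K Q m : nat) : (0 < m)%N ->
  \sum_(p <- pairs_to K Q) invp R p * (divs m p)%:R <= 2 * invsum R K Q ^+ 2 / m%:R.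
Proof.
move=> m0; set S := invsum R K Q; have S0 : 0 <= S := invsum_ge0 R K Q.
pose Sm := \sum_(k <- coprimes_to K Q) k%:R^-1 * (m %| k)%N%:R : R.
have SmE : Sm = \sum_(k <- coprimes_to K Q | (m %| k)%N) k%:R^-1.
  rewrite /Sm [RHS]big_mkcond; apply: eq_bigr => k _.
  by case: (m %| k)%N; rewrite ?mulr1 ?mulr0.
have SmS : Sm <= S / m%:R by rewrite SmE; exact: invsum_multiples.
have -> : \sum_(p <- pairs_to K Q) invp R p * (divs m p)%:R = Sm * S + S * Sm.
  rewrite /pairs_to big_allpairs /invp /divs /= /S /invsum /Sm.
  rewrite !mulr_suml -big_split; apply: eq_bigr => u _ /=.
  rewrite !mulr_sumr -big_split; apply: eq_bigr => y _ /=.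
  by rewrite natrD; ring.
have h := ler_wpM2l S0 SmS.
have -> : 2 * S ^+ 2 / m%:R = S * (S / m%:R) + S * (S / m%:R) by ring.
by rewrite [Sm * S]mulrC lerD.
Qed.

Definition six_of (p q r : nat * nat) := (p.1, p.2, q.1, q.2, r.1, r.2).

Definition prime_load (R : realType) (P0 Q w : nat) : R :=
  \sum_(m <- iota 1 Q | [&& prime m, (P0 < m)%N & (m %| w)%N]) m%:R^-1.

Definition nice (R : realType) (P0 Q : nat) (p q r : nat * nat) : bool :=
  six_coprime (six_of p q r) && (prime_load R P0 Q (sixw (six_of p q r)) <= 1 / 32).

Lemma prime_dvd_pair (m : nat) (p : nat * nat) : prime m ->
  (m %| p.1 * p.2)%N = (0 < divs m p)%N.
Proof. by move=> pm; rewrite Euclid_dvdM // /divs addn_gt0 !lt0b. Qed.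

(** A failure of coprimality exhibits a prime dividing two of the three pairs. A load above [1 / 32]
    is treated as in Markov's inequality, through multiplication by 32. Primes up to [P0] divide [K]
    and do not occur in the pairs. *)
Lemma not_nice_le (R : realType) (K P0 Q : nat) (p q r : nat * nat) :
  (forall m, (0 < m <= P0)%N -> (m %| K)%N) ->
  p \in pairs_to K Q -> q \in pairs_to K Q -> r \in pairs_to K Q ->
  ~~ nice R P0 Q p q r ->
  1 <= \sum_(m <- iota 1 Q | (P0 < m)%N)
    ((divs m p * divs m q + divs m p * divs m r + divs m q * divs m r)%N%:R +
     32 * ((divs m p + divs m q + divs m r)%N%:R / m%:R)) :> R.
Proof.
move=> hK pl ql rl.
pose G m : R := ((divs m p * divs m q + divs m p * divs m r + divs m q * divs m r)%N%:R +
     32 * ((divs m p + divs m q + divs m r)%N%:R / m%:R)).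
change (~~ nice R P0 Q p q r -> 1 <= \sum_(m <- iota 1 Q | (P0 < m)%N) G m).
have G0 m : 0 <= G m by rewrite /G addr_ge0 // mulr_ge0 // divr_ge0.
have big (m : nat) (x y : nat * nat) : x \in pairs_to K Q -> prime m -> (m %| x.1 * x.2)%N ->
    (0 < m <= Q)%N && (P0 < m)%N.
  move=> /pairs_toP[/andP[x10 x1Q] x1K /andP[x20 x2Q] x2K] pm mx.
  have mK : coprime m K by apply: (coprime_dvdl mx); rewrite coprimeMl x1K.
  rewrite prime_gt0 //=; apply/andP; split.
    by move: mx; rewrite Euclid_dvdM // => /orP[] /dvdn_leq h; apply: leq_trans (h _) _.
  rewrite ltnNge; apply/negP => mP; move: mK; rewrite prime_coprime // hK // prime_gt0 //.
have one m : (0 < m <= Q)%N && (P0 < m)%N -> 1 <= G m -> 1 <= \sum_(m <- iota 1 Q | (P0 < m)%N) G m.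
  move=> /andP[mQ mP] Gm; rewrite big_mkcond (bigD1_seq m) /= ?iota_uniq ?mem_iota ?add1n ?ltnS //.
  rewrite mP; apply: le_trans Gm _; rewrite lerDl; apply: sumr_ge0 => k _; by case: ifP.
rewrite /nice negb_and => /orP[|]; last first.
  rewrite -ltNge => hl.
  apply: (@le_trans _ _ (32 * prime_load R P0 Q (sixw (six_of p q r)))); first by lra.
  rewrite /prime_load mulr_sumr big_mkcond [leRHS]big_mkcond /=; apply: ler_sum => m _.
  case: ifP => [/and3P[pm -> mw]|_]; last by case: ifP.
  have h1 : (1 <= divs m p + divs m q + divs m r)%N.
    have : (m %| p.1 * p.2 * (q.1 * q.2) * (r.1 * r.2))%N := mw.
    rewrite (Euclid_dvdM (p.1 * p.2 * (q.1 * q.2)) _ pm) (Euclid_dvdM (p.1 * p.2) _ pm).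
    rewrite !prime_dvd_pair //.
    by move: (divs m p) (divs m q) (divs m r) => a b c; lia.
  rewrite /G -[leLHS]add0r; apply: lerD => //; rewrite ler_wpM2l //.
  by rewrite -[leLHS]mul1r ler_wpM2r ?invr_ge0 // (ler_nat R 1).
have key (m : nat) (k : nat) : (0 < m <= Q)%N && (P0 < m)%N -> (0 < k)%N ->
    (k <= divs m p * divs m q + divs m p * divs m r + divs m q * divs m r)%N ->
    1 <= \sum_(m <- iota 1 Q | (P0 < m)%N) G m.
  move=> hm k0 hk; apply: (one m) => //; rewrite /G -[leLHS]addr0; apply: lerD.
    by rewrite (ler_nat R 1) (leq_trans k0).
  by rewrite mulr_ge0 // divr_ge0.
have pos x : x \in pairs_to K Q -> (0 < x.1 * x.2)%N.
  by move=> /pairs_toP[/andP[x1 _] _ /andP[x2 _] _]; rewrite muln_gt0 x1.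
rewrite /six_coprime /six_of !negb_and => /or3P[] h.
- have [m [pm m1 m2]] := not_coprimeP (pos _ ql) h.
  apply: (key m (divs m p * divs m q)%N (big m p p pl pm m1)); last by rewrite -addnA leq_addr.
  by rewrite muln_gt0 -!prime_dvd_pair // m1.
- have [m [pm m1 m2]] := not_coprimeP (pos _ rl) h.
  apply: (key m (divs m p * divs m r)%N (big m p p pl pm m1)).
    by rewrite muln_gt0 -!prime_dvd_pair // m1.
  by rewrite addnAC leq_addl.
- have [m [pm m1 m2]] := not_coprimeP (pos _ rl) h.
  apply: (key m (divs m q * divs m r)%N (big m q q ql pm m1)); last by rewrite leq_addl.
  by rewrite muln_gt0 -!prime_dvd_pair // m1.
Qed.

(** First moment with weight [1 / sixw]. For each [m], three products of two densities [2 / m] give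
    [12 / m^2], and three single densities with the factor [32 / m] give [192 / m^2]. Summed over
    [m > P0] this is at most [204 / P0], hence at most one half for [P0 >= 408]. *)
Lemma nice_sum_ge (R : realType) (K P0 Q : nat) :
  (forall m, (0 < m <= P0)%N -> (m %| K)%N) -> (408 <= P0)%N ->
  invsum R K Q ^+ 6 / 2 <= sum3 (pairs_to K Q) (fun p q r =>
    if nice R P0 Q p q r then invp R p * invp R q * invp R r else 0).
Proof.
move=> hK P408; set S := invsum R K Q; set l := pairs_to K Q.
have S0 : 0 <= S := invsum_ge0 R K Q.
have W0 p : 0 <= invp R p by rewrite /invp mulr_ge0 // invr_ge0.
pose G m p q r : R := invp R p * invp R q * invp R r *
  ((divs m p * divs m q + divs m p * divs m r + divs m q * divs m r)%N%:R +
     32 * ((divs m p + divs m q + divs m r)%N%:R / m%:R)).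
have tot : sum3 l (fun p q r => invp R p * invp R q * invp R r) = S ^+ 6.
  by rewrite sum3M sum_invp -/S; ring.
have le1 : S ^+ 6 <= sum3 l (fun p q r =>
    (if nice R P0 Q p q r then invp R p * invp R q * invp R r else 0) +
    \sum_(m <- iota 1 Q | (P0 < m)%N) G m p q r).
  rewrite -tot; apply: sum3_le => p q r pl ql rl.
  have w0 : 0 <= invp R p * invp R q * invp R r := mulr_ge0 (mulr_ge0 (W0 p) (W0 q)) (W0 r).
  rewrite /G -mulr_sumr; case: ifP => [_|/negbT nn].
    rewrite lerDl mulr_ge0 //; apply: sumr_ge0 => m _.
    by rewrite addr_ge0 // mulr_ge0 // divr_ge0.
  by rewrite add0r ler_peMr //; exact: (@not_nice_le R K P0 Q p q r hK pl ql rl nn).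
rewrite sum3D sum3_exchange in le1.
have Gm m : (0 < m)%N -> sum3 l (G m) <= 204 * S ^+ 6 * (m%:R ^+ 2)^-1.
  move=> m0; pose B p : R := invp R p * (divs m p)%:R.
  have -> : sum3 l (G m) = sum3 l (fun p q r => (B p * B q * invp R r + B p * invp R q * B r) +
      invp R p * B q * B r + ((32 / m%:R * B p) * invp R q * invp R r +
      (32 / m%:R * invp R p) * B q * invp R r + (32 / m%:R * invp R p) * invp R q * B r)).
    rewrite /sum3; apply: eq_bigr => p _; apply: eq_bigr => q _; apply: eq_bigr => r _.
    rewrite /G /B; move: (divs m p) (divs m q) (divs m r) (invp R p) (invp R q) (invp R r) => a b c x y z.
    by rewrite !natrD !natrM; ring.
  rewrite !sum3D !sum3M -!mulr_sumr sum_invp -/S; set H := \sum_(p <- l) B p.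
  have HS : H <= 2 * S ^+ 2 / m%:R by exact: sum_invp_divs.
  have H0 : 0 <= H by apply: sumr_ge0 => p _; exact: mulr_ge0 (W0 p) (ler0n _ _).
  have mr : (0 : R) < m%:R by rewrite ltr0n.
  have HH : H * H <= (2 * S ^+ 2 / m%:R) * (2 * S ^+ 2 / m%:R) by apply: ler_pM.
  have h1 : H * H * S ^+ 2 <= (2 * S ^+ 2 / m%:R) * (2 * S ^+ 2 / m%:R) * S ^+ 2.
    by apply: ler_wpM2r => //; rewrite exprn_ge0.
  have h2 : 32 / m%:R * (S ^+ 2 * S ^+ 2) * H <= 32 / m%:R * (S ^+ 2 * S ^+ 2) * (2 * S ^+ 2 / m%:R).
    by apply: ler_wpM2l => //; rewrite !mulr_ge0 ?exprn_ge0 // invr_ge0 ltW.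
  have -> : 204 * S ^+ 6 * (m%:R ^+ 2)^-1 = 3 * ((2 * S ^+ 2 / m%:R) * (2 * S ^+ 2 / m%:R) * S ^+ 2) +
     3 * (32 / m%:R * (S ^+ 2 * S ^+ 2) * (2 * S ^+ 2 / m%:R)) by rewrite -exprVn; ring.
  have -> : H * H * S ^+ 2 + H * S ^+ 2 * H + S ^+ 2 * H * H + (32 / m%:R * H * S ^+ 2 * S ^+ 2 +
      32 / m%:R * S ^+ 2 * H * S ^+ 2 + 32 / m%:R * S ^+ 2 * S ^+ 2 * H) =
      3 * (H * H * S ^+ 2) + 3 * (32 / m%:R * (S ^+ 2 * S ^+ 2) * H) by ring.
  by apply: lerD; rewrite ler_wpM2l.
have Gs : \sum_(m <- iota 1 Q | (P0 < m)%N) sum3 l (G m) <= 204 * S ^+ 6 / P0%:R.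
  apply: (@le_trans _ _ (\sum_(m <- iota 1 Q | (P0 < m)%N) 204 * S ^+ 6 * (m%:R ^+ 2)^-1)).
    by apply: ler_sum => m mP; apply: Gm; apply: leq_ltn_trans mP.
  rewrite -mulr_sumr; apply: ler_wpM2l; first by rewrite mulr_ge0 ?exprn_ge0.
  by apply: sum_inv_sq_gt; apply: leq_trans P408.
have : 204 * S ^+ 6 / P0%:R <= S ^+ 6 / 2.
  rewrite ler_pdivrMr ?ltr0n; last by apply: leq_trans P408.
  have : (408%:R : R) <= P0%:R by rewrite ler_nat.
  have : 0 <= S ^+ 6 by rewrite exprn_ge0.
  by move: (S ^+ 6) (P0%:R : R) => x y; nra.
lra.
Qed.

(** * Harmonic sums from below *)

Lemma harm_ge (R : realType) (n : nat) : ln (n.+1%:R : R) <= harm R n.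
Proof.
elim: n => [|n IH]; first by rewrite ln1 harm_ge0.
have -> : harm R n.+1 = harm R n + n.+1%:R^-1.
  rewrite /harm; have -> : iota 1 n.+1 = iota 1 n ++ [:: n.+1] by have := iotaD 1 n 1; rewrite addn1 add1n.
  by rewrite big_cat /= big_seq1.
have n0 : (0 : R) < n.+1%:R by rewrite ltr0n.
have -> : n.+2%:R = n.+1%:R * (1 + n.+1%:R^-1) :> R.
  by rewrite mulrDr mulr1 divff ?gt_eqF // natr1.
have v0 : (0 : R) < n.+1%:R^-1 by rewrite invr_gt0.
have p1 : (0 : R) < 1 + n.+1%:R^-1 by rewrite addr_gt0.
rewrite lnM ?posrE //.
by apply: lerD => //; apply: le_ln1Dx; apply: lt_trans v0; rewrite ltrN10.
Qed.

(** The numbers [1 + K j] are coprime to [K] and at most [K (j + 1)], so they alone contribute a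
    harmonic sum divided by [K]. *)
Lemma invsum_ge (R : realType) (K Q : nat) : (0 < K)%N -> (0 < Q)%N ->
  (ln (Q%:R : R) - ln (K%:R : R)) / K%:R <= invsum R K Q.
Proof.
move=> K0 Q0; have Kr : (0 : R) < K%:R by rewrite ltr0n.
have Qr : (0 : R) < Q%:R by rewrite ltr0n.
pose T := (Q %/ K)%N.
apply: (@le_trans _ _ (harm R T / K%:R)).
  rewrite ler_pM2r ?invr_gt0 //; apply: le_trans (harm_ge R T).
  rewrite -ln_div ?posrE // ler_ln ?posrE ?divr_gt0 ?ltr0n //.
  by rewrite ler_pdivrMr // -natrM ler_nat ltnW // ltn_ceil.
rewrite /harm mulr_suml.
have -> : \sum_(i <- iota 1 T) i%:R^-1 / K%:R = \sum_(j <- iota 0 T) (j.+1%:R^-1 / K%:R) :> R.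
  by rewrite (iotaDl 1 0) big_map; apply: eq_bigr => j _; rewrite add1n.
apply: (@le_trans _ _ (\sum_(j <- iota 0 T) (1 + K * j)%N%:R^-1)).
  apply: ler_sum => j _; rewrite -invfM lef_pV2 ?posrE ?mulr_gt0 ?ltr0n //.
  have -> : (j.+1%:R * K%:R = (K + K * j)%N%:R :> R) by rewrite -natrM mulnC mulnS.
  by rewrite ler_nat leq_add2r.
rewrite -(big_map (fun j => 1 + K * j)%N xpredT (fun k => k%:R^-1 : R)).
apply: sum_sub_le; last by move=> k; rewrite invr_ge0.
  rewrite map_inj_uniq ?iota_uniq // => x y /eqP.
  by rewrite eqn_add2l eqn_mul2l gtn_eqF //= => /eqP.
move=> k /mapP[j]; rewrite mem_iota add0n => /andP[_ jT] ->; apply/coprimes_toP; split.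
  rewrite addn_gt0 /=; apply: leq_trans (leq_trunc_div Q K); rewrite -/T.
  have : (K * j.+1 <= T * K)%N by rewrite mulnC leq_mul2r jT orbT.
  by rewrite mulnS; apply: leq_trans; rewrite leq_add2r.
have -> : (1 + K * j = j * K + 1)%N by ring.
by rewrite /coprime gcdnC gcdnMDl gcdn1.
Qed.

(** * List bounds and the counting function *)

Lemma NUH_le (R : realType) (B r : R) :
  card_le (fun p : P3 rat => openU p /\ (height p)%:R <= B) r -> (NUH B)%:R <= r.
Proof.
move=> H; rewrite /NUH.
case: (pselect (finite_set [set p : P3 rat | openU p /\ (height p)%:R <= B]%classic)) => fA.
  apply: H; first exact: fset_uniq.
  by move=> p; rewrite in_fset_set // => /set_mem.
(* In the infinite case [fset_set] is empty, and the claim is [0 <= r]. *)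
rewrite /fset_set; case: pselect => // _; rewrite cardfs0.
exact: card_le_ge0 H.
Qed.

(** The upper bound supplies finiteness, without which the count would be 0 by convention. *)
Lemma NUH_ge (R : realType) (B r x : R) :
  card_le (fun p : P3 rat => openU p /\ (height p)%:R <= B) r ->
  card_ge (fun p : P3 rat => openU p /\ (height p)%:R <= B) x -> x <= (NUH B)%:R.
Proof.
move=> H [s [us sP sx]]; apply: le_trans sx _; rewrite /NUH.
have fA : finite_set [set p : P3 rat | openU p /\ (height p)%:R <= B]%classic.
  apply: contrapT => /(@infinite_set_fset _ _ (Num.truncn r).+1)[S SA].
  have := H (enum_fset S) (fset_uniq S) (fun p pS => SA p pS).
  move=> Sr /(leq_trans (ltnSn _)); rewrite ltnNge => /negP; apply.
  by rewrite -ltnS; move: (le_lt_trans Sr (truncnS_gt r)); rewrite ltr_nat.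
rewrite ler_nat; apply: uniq_leq_size => // p /sP Pp.
by rewrite in_fset_set //; apply/mem_set.
Qed.

Lemma unit_point : exists p : P3 rat, openU p /\ (height p <= 1)%N.
Proof.
by have [//|//|//|//|p [p1 p2 _]] := @quad_point 1 1 (-1) (-1) 1; exists p.
Qed.

(** A point fixes its primitive vector up to sign, and positivity of the first coordinate settles
    the sign. *)
Lemma points_ge (R : realType) (B : R) (N : nat) (T : eqType) (P : T -> Prop)
    (f : T -> int * int * int * int) (r : R) : N%:R <= B ->
  (forall x, P x -> exists p : P3 rat,
     [/\ openU p, (height p <= N)%N & coprime_coords p (rowz (f x))]) ->
  (forall x, P x -> 0 < (f x).1.1.1) ->
  (forall x y, P x -> P y -> f x = f y -> x = y) ->
  card_ge P r -> card_ge (fun p : P3 rat => openU p /\ (height p)%:R <= B) r.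
Proof.
move=> NB pt pos inj [s [us sP sr]].
have [p0 _] := unit_point.
pose Q x (p : P3 rat) := [/\ openU p, (height p <= N)%N & coprime_coords p (rowz (f x))].
pose g x := xget p0 (Q x).
have gP x : P x -> Q x (g x).
  by move=> /pt[p Qp]; exact: (xgetPex p0 (ex_intro (Q x) p Qp)).
exists (map g s); split; last by rewrite size_map.
- rewrite map_inj_in_uniq // => x y /sP Px /sP Py gxy.
  have [_ _ cx] := gP x Px; have [_ _ cy] := gP y Py; rewrite -gxy in cy.
  case: (coprime_coords_uniq cx cy) => [/rowz_inj|e]; first exact: inj.
  have [e0 _ _ _] := rowzE (f x); have [e1 _ _ _] := rowzE (f y).
  have := pos x Px; rewrite -e0 e mxE e1 oppr_gt0 => h.
  by have := lt_trans h (pos y Py); rewrite ltxx.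
- move=> p /mapP[x /sP /gP[h1 h2 _] ->]; split=> //.
  by apply: le_trans NB; rewrite ler_nat.
Qed.

(** * Boxes of parameters for the lower bound *)

(** For positive [C] and [e] this is the largest [A] with [C A^e <= X]; raising [X] by one raises it
    by at most one. *)
Fixpoint power_root (C e X : nat) : nat :=
  if X is X'.+1 then
    let A := power_root C e X' in if (C * A.+1 ^ e <= X)%N then A.+1 else A
  else 0%N.

Lemma power_rootP (C e X : nat) : (0 < C)%N -> (0 < e)%N ->
  (C * power_root C e X ^ e <= X < C * (power_root C e X).+1 ^ e)%N.
Proof.
move=> C0 e0; elim: X => [|X IH].
  by rewrite exp0n // muln0 exp1n muln1.
rewrite /=; set A := power_root C e X in IH *; case/andP: IH => h1 h2.
case: ifP => h3; last by rewrite ltnNge h3 (leq_trans h1).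
rewrite h3 /=; apply: leq_ltn_trans h2 _.
by rewrite ltn_mul2l C0 /= ltn_exp2r.
Qed.

(** The representative is taken in [1 .. d3] and not in [0 .. d3 - 1], which keeps [b] positive. *)
Definition bsol (d2 d3 : nat) (z : int) : nat :=
  xget 0%N (fun b => (0 < b <= d3)%N /\ (d3%:Z %| z - (d2 * b)%N%:Z)%Z).

Lemma bsolP (d2 d3 : nat) (z : int) : (0 < d3)%N -> coprime d2 d3 ->
  (0 < bsol d2 d3 z <= d3)%N /\ (d3%:Z %| z - (d2 * bsol d2 d3 z)%N%:Z)%Z.
Proof.
move=> d30 cd; rewrite /bsol; apply: (@xgetPex _ 0%N (fun b => (0 < b <= d3)%N /\ (d3%:Z %| z - (d2 * b)%N%:Z)%Z)).
have : coprimez d2 d3 by rewrite /coprimez /gcdz /= eqz_nat.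
move=> /coprimezP[[u v] /= uv].
have d3n : d3%:Z != 0 by rewrite eqz_nat -lt0n.
(* The Bezout coefficient [u] inverts [d2] modulo [d3]; reducing [z u - 1] and adding 1 lands in
   [1 .. d3]. *)
have r0 := modz_ge0 (z * u - 1) d3n.
have r1 : ((z * u - 1) %% d3 < d3)%Z by rewrite ltz_pmod // ltz_nat.
have rE := divz_eq (z * u - 1) d3.
move: ((z * u - 1) %% d3)%Z ((z * u - 1) %/ d3)%Z r0 r1 rE => r q.
case: r => // r _ r1 rE; exists r.+1; split; first by rewrite /= -ltz_nat.
have -> : z - (d2 * r.+1)%N%:Z = (z * v + d2%:Z * q) * d3%:Z.
  have rE' : r%:Z = z * u - 1 - q * d3%:Z by rewrite rE; ring.
  rewrite PoszM -addn1 PoszD rE'.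
  rewrite mulrDl; have -> : z * v * d3%:Z = z * (1 - u * d2%:Z) by rewrite -uv; ring.
  by ring.
exact: dvdz_mull.
Qed.

Definition nA (N : nat) n : nat := power_root 1 3 (N * (sixd1 n * sixd2 n * sixd3 n)).
Definition nI (N K : nat) n : nat := (nA N n %/ (4 * (sixw n * K)))%N.
Definition nJ (N : nat) n : nat := (nA N n %/ (4 * sixd1 n))%N.
Definition nL (N : nat) n : nat := (nA N n %/ (4 * (sixd2 n * sixd3 n)))%N.
(** For given [s] and [a], integrality of [c] is a congruence on [b] modulo [d3]; this is its first
    positive solution. *)
Definition nbe (K : nat) n (i j : nat) : nat :=
  bsol (sixd2 n) (sixd3 n) ((sixw n * spar K i)%N%:Z - (sixd1 n * j.+1)%N%:Z).
Definition nb (K : nat) n (i j l : nat) : nat := (nbe K n i j + sixd3 n * l)%N.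
Definition nc (K : nat) n (i j l : nat) : int :=
  (((sixw n * spar K i)%N%:Z - (sixd1 n * j.+1 + sixd2 n * nb K n i j l)%N%:Z) %/ (sixd3 n)%:Z)%Z.

Definition good (N K : nat) n (x : nat * nat * nat) : Prop :=
  in_box (nI N K n) (nJ N n) (nL N n) x /\
  exact_data n (spar K x.1.1) x.1.2.+1 (nb K n x.1.1 x.1.2 x.2) (nc K n x.1.1 x.1.2 x.2).

Lemma six_facts n : six_pos n -> six_coprime n ->
  [/\ (0 < sixw n)%N, [/\ (0 < sixd1 n)%N, (0 < sixd2 n)%N & (0 < sixd3 n)%N],
      [/\ coprime (sixd1 n) (sixd2 n), coprime (sixd1 n) (sixd3 n) & coprime (sixd2 n) (sixd3 n)] &
      forall m, prime m -> (m %| sixd2 n)%N || (m %| sixd3 n)%N -> (m %| sixw n)%N].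
Proof.
case: n => [[[[[u1 y1] u2] y2] u3] y3] /and5P[u10 y10 u20 y20 /andP[u30 y30]] /and3P[c12 c13 c23].
rewrite /sixw /sixd1 /sixd2 /sixd3.
have cc (u y v z : nat) : coprime (u * y) (v * z) -> coprime (u * y ^ 2) (v * z ^ 2).
  have sq (a b : nat) : (a * b ^ 2 %| (a * b) ^ 2)%N by rewrite expnMn dvdn_mul // dvdn_exp.
  move=> h; apply: coprime_dvdl (sq u y) _; apply: coprime_dvdr (sq v z) _.
  by rewrite coprimeXl // coprimeXr.
have dd (m u y : nat) : prime m -> (m %| u * y ^ 2)%N -> (m %| u * y)%N.
  by move=> pm; rewrite (Euclid_dvdM u (y ^ 2) pm) (Euclid_dvdM u y pm) (Euclid_dvdX _ _ pm) andbT.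
split.
- by rewrite !muln_gt0 u10 y10 u20 y20 u30.
- by split; rewrite muln_gt0 expn_gt0 ?u10 ?y10 ?u20 ?y20 ?u30 ?y30.
- by split; apply: cc.
move=> m pm /orP[/(dd _ _ _ pm) h|/(dd _ _ _ pm) h]; last by rewrite dvdn_mull.
by rewrite dvdn_mulr // dvdn_mull.
Qed.

Lemma nc_eq (K : nat) n (i j l : nat) : six_pos n -> six_coprime n ->
  (sixd1 n * j.+1 + sixd2 n * (nbe K n i j + sixd3 n * l))%N%:Z +
    (sixd3 n)%:Z * nc K n i j l = (sixw n * spar K i)%N%:Z.
Proof.
move=> np nc'; have [w0 [d10 d20 d30] [c12 c13 c23] _] := six_facts np nc'.
rewrite -/(nb K n i j l) /nc mulrC divzK; first by rewrite addrC subrK.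
have [_ h] := bsolP ((sixw n * spar K i)%N%:Z - (sixd1 n * j.+1)%N%:Z) d30 c23.
have -> : (sixw n * spar K i)%N%:Z - (sixd1 n * j.+1 + sixd2 n * nb K n i j l)%N%:Z =
  ((sixw n * spar K i)%N%:Z - (sixd1 n * j.+1)%N%:Z - (sixd2 n * nbe K n i j)%N%:Z) -
  (sixd2 n * l)%N%:Z * (sixd3 n)%:Z.
  by rewrite /nb mulnDr !PoszD !PoszM; ring.
by apply: rpredB => //; exact: dvdz_mull.
Qed.

Lemma good_point (N K : nat) n x : (0 < K)%N -> good N K n x ->
  exists p : P3 rat, [/\ openU p, (height p <= N)%N & coprime_coords p (rowz
    (exact_quad n (spar K x.1.1) x.1.2.+1 (nb K n x.1.1 x.1.2 x.2) (nc K n x.1.1 x.1.2 x.2)))].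
Proof.
move=> K0 [/and3P[iI jJ lL] D]; have [/andP[np nc'] _ _ _ _] := D.
have [w0 [d10 d20 d30] [c12 c13 c23] _] := six_facts np nc'.
case: x iI jJ lL D => [[i j] l] /= iI jJ lL D.
have [hA _] := andP (@power_rootP 1 3 (N * (sixd1 n * sixd2 n * sixd3 n)) isT isT).
rewrite mul1n -/(nA N n) in hA.
apply: (exact_point D hA).
- have : (nI N K n * (4 * (sixw n * K)) <= nA N n)%N by exact: leq_trunc_div.
  (* From [i < I] one gets [s = 1 + K (i + 1) <= 2 K I], hence [2 w s <= 4 w K I <= A]. *)
  apply: leq_trans; have : (spar K i <= 2 * K * nI N K n)%N.
    have h1 : (K * i.+1 <= K * nI N K n)%N by rewrite leq_mul2l iI orbT.
    have h2 : (0 < K * nI N K n)%N by rewrite muln_gt0 K0; apply: leq_ltn_trans iI.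
    by rewrite /spar -mulnA; move: (K * i.+1)%N (K * nI N K n)%N h1 h2 => a b; clear; lia.
  move=> h; have -> : (nI N K n * (4 * (sixw n * K)) = 2 * (sixw n * (2 * K * nI N K n)))%N by ring.
  by rewrite leq_mul2l leq_mul2l h orbT.
- have : (nJ N n * (4 * sixd1 n) <= nA N n)%N by exact: leq_trunc_div.
  apply: leq_trans; rewrite mulnA [X in (_ <= X)%N]mulnC leq_mul2l jJ orbT //.
have : (nL N n * (4 * (sixd2 n * sixd3 n)) <= nA N n)%N by exact: leq_trunc_div.
apply: leq_trans; rewrite /nb.
have [/andP[_ hb] _] := bsolP ((sixw n * spar K i)%N%:Z - (sixd1 n * j.+1)%N%:Z) d30 c23.
have : (nbe K n i j + sixd3 n * l <= sixd3 n * nL N n)%N.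
  apply: (@leq_trans (sixd3 n * l.+1)); first by rewrite mulnS leq_add2r.
  by rewrite leq_mul2l lL orbT.
move=> h; have -> : (nL N n * (4 * (sixd2 n * sixd3 n)) = 4 * (sixd2 n * (sixd3 n * nL N n)))%N by ring.
by rewrite leq_mul2l leq_mul2l h orbT.
Qed.

Lemma good_inj (N K : nat) n n' x x' : (0 < K)%N -> good N K n x -> good N K n' x' ->
  exact_quad n (spar K x.1.1) x.1.2.+1 (nb K n x.1.1 x.1.2 x.2) (nc K n x.1.1 x.1.2 x.2) =
  exact_quad n' (spar K x'.1.1) x'.1.2.+1 (nb K n' x'.1.1 x'.1.2 x'.2) (nc K n' x'.1.1 x'.1.2 x'.2) ->
  n = n' /\ x = x'.
Proof.
move=> K0 [_ D] [_ D'] /(exact_quad_inj D D')[nn ss aa bb]; have [/andP[np nc'] _ _ _ _] := D.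
have [w0 [d10 d20 d30] _ _] := six_facts np nc'.
split=> //; case: x x' {D D'} ss aa bb => [[i j] l] [[i' j'] l'] /=.
rewrite -nn => /eqP; rewrite /spar eqn_add2l eqn_mul2l gtn_eqF //= eqSS => /eqP <- [<-] /eqP.
by rewrite /nb eqn_add2l eqn_mul2l gtn_eqF //= => /eqP <-.
Qed.

Lemma good_quad_gt0 (N K : nat) n x : good N K n x ->
  0 < (exact_quad n (spar K x.1.1) x.1.2.+1 (nb K n x.1.1 x.1.2 x.2) (nc K n x.1.1 x.1.2 x.2)).1.1.1.
Proof.
move=> [_ D]; have [/andP[np _] /and3P[s1 a0 _] _ _ _] := D.
case: n np {D} s1 => [[[[[u1 y1] u2] y2] u3] y3] /and5P[u10 y10 u20 y20 /andP[u30 y30]] s1.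
rewrite /exact_quad /= -PoszM ltz_nat muln_gt0 -!mulnn !muln_gt0 u10 y10 u20 u30 !(ltnW s1) //.
Qed.

Lemma leq_2divn (A d : nat) : (0 < d)%N -> (d <= A)%N -> (A <= 2 * (A %/ d) * d)%N.
Proof.
move=> d0 dA; apply: leq_trans (ltnW (ltn_ceil A d0)) _.
rewrite leq_mul2r; apply/orP; right; rewrite mul2n -addnn -addn1 leq_add2l.
by rewrite divn_gt0.
Qed.

(** Rounding down a positive side loses at most a factor 2, which with the [4] in its definition
    makes [8] per side. The remaining [8] is the cube of the factor lost in the integer cube
    root. *)
Lemma box_size_ge (N K : nat) n : (0 < K)%N -> six_pos n -> six_coprime n ->
  (0 < nI N K n)%N -> (0 < nJ N n)%N -> (0 < nL N n)%N ->
  (N <= 8 * (8 * 8 * 8) * (sixw n * K * (nI N K n * nJ N n * nL N n)))%N.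
Proof.
move=> K0 np nc I0 J0 L0; have [w0 [d10 d20 d30] _ _] := six_facts np nc.
have [_ hA] := andP (@power_rootP 1 3 (N * (sixd1 n * sixd2 n * sixd3 n)) isT isT).
rewrite mul1n -/(nA N n) in hA.
have d230 : (0 < sixd2 n * sixd3 n)%N by rewrite muln_gt0 d20.
have wK0 : (0 < sixw n * K)%N by rewrite muln_gt0 w0.
have hI : (nA N n <= 2 * nI N K n * (4 * (sixw n * K)))%N.
  have q0 : (0 < 4 * (sixw n * K))%N by rewrite muln_gt0.
  by apply: leq_2divn => //; move: I0; rewrite /nI divn_gt0.
have hJ : (nA N n <= 2 * nJ N n * (4 * sixd1 n))%N.
  have q0 : (0 < 4 * sixd1 n)%N by rewrite muln_gt0.
  by apply: leq_2divn => //; move: J0; rewrite /nJ divn_gt0.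
have hL : (nA N n <= 2 * nL N n * (4 * (sixd2 n * sixd3 n)))%N.
  have q0 : (0 < 4 * (sixd2 n * sixd3 n))%N by rewrite muln_gt0.
  by apply: leq_2divn => //; move: L0; rewrite /nL divn_gt0.
have A0 : (0 < nA N n)%N.
  by case: (posnP (nA N n)) J0 => // A0; rewrite /nJ A0 div0n.
move: (sixd1 n) (sixd2 n) (sixd3 n) (sixw n) (nA N n) (nI N K n) (nJ N n) (nL N n) d10 d20 d30 hA hI hJ hL A0.
move=> d1 d2 d3 w A I J L d10 d20 d30 hA hI hJ hL A0.
have g0 : (0 < d1 * d2 * d3)%N by rewrite !muln_gt0 d10 d20.
rewrite -(leq_pmul2r g0).
apply: leq_trans (ltnW hA) _.
apply: (@leq_trans ((2 * A) ^ 3)); first by rewrite leq_exp2r // mul2n -addnn -addn1 leq_add2l.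
have -> : ((2 * A) ^ 3 = 8 * (A * A * A))%N by ring.
have -> : (8 * (8 * 8 * 8) * (w * K * (I * J * L)) * (d1 * d2 * d3) =
   8 * ((2 * I * (4 * (w * K))) * (2 * J * (4 * d1)) * (2 * L * (4 * (d2 * d3)))))%N by ring.
by rewrite leq_mul2l /= leq_mul // leq_mul.
Qed.

(** When [L < I], replacing [I] by [2 Q6 L] gives coefficients [384 + 96]; otherwise they are
    [192 + 96]. Both totals are below [800]. *)
Lemma box_dominates (k K I L Q6 : nat) : (0 < K)%N -> (0 < Q6)%N ->
  (800 * k * K * Q6 <= I)%N -> (800 * k * K * Q6 <= L)%N -> (I <= 2 * (Q6 * L))%N ->
  (96 * k * (2 * K * I + L) <= L * minn I L)%N.
Proof.
move=> K0 Q0 hI hL hIL.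
have MI : (800 * (k * K) <= I)%N.
  by apply: leq_trans hI; rewrite !mulnA leq_pmulr.
have ML : (800 * (k * K) <= L)%N.
  by apply: leq_trans hL; rewrite !mulnA leq_pmulr.
have kx : (k <= k * K)%N by rewrite leq_pmulr.
have -> : (96 * k * (2 * K * I + L) = 192 * (k * K * I) + 96 * (k * L))%N by ring.
have hL' : (800 * (k * K * Q6) <= L)%N by move: hL; rewrite !mulnA.
move: (k * K)%N kx MI ML hL' => x kx MI ML hL' {hI hL}.
have e1 : (800 * (x * I) <= L * I)%N by rewrite mulnA leq_mul2r ML orbT.
have e2 : (800 * (x * L) <= L * I)%N by rewrite mulnA mulnC leq_mul2l MI orbT.
have e3 : (k * L <= x * L)%N by rewrite leq_mul2r kx orbT.
have e4 : (x * I <= x * (2 * (Q6 * L)))%N by rewrite leq_mul2l hIL orbT.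
have e5 : (800 * (x * (Q6 * L)) <= L * L)%N.
  have -> : (800 * (x * (Q6 * L)) = 800 * (x * Q6) * L)%N by ring.
  by rewrite leq_mul2r hL' orbT.
have e6 : (800 * (x * L) <= L * L)%N by rewrite mulnA leq_mul2r ML orbT.
have e7 : (x * (2 * (Q6 * L)) = 2 * (x * (Q6 * L)))%N by ring.
rewrite e7 in e4.
have [_|_] := leqP I L.
  by move: (x * I)%N (x * L)%N (k * L)%N (L * I)%N e1 e2 e3; clear; lia.
by move: (x * I)%N (x * L)%N (k * L)%N (L * L)%N (x * (Q6 * L))%N e3 e4 e5 e6; clear; lia.
Qed.

(** The exponent 12 leaves [M Q^6] for the sides [I] and [L] after division of [A] by [4 w K] or
    [4 d2 d3], both at most [4 K Q^6]. In the conclusion the first [2] is the half of the box that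
    survives the sieve. *)
Lemma good_many (R : realType) (N K P0 Q : nat) (p q r : nat * nat) :
  (forall m, (0 < m <= P0)%N -> (m %| K)%N) -> (0 < K)%N -> (320 <= P0)%N -> (0 < Q)%N ->
  p \in pairs_to K Q -> q \in pairs_to K Q -> r \in pairs_to K Q -> nice R P0 Q p q r ->
  ((4 * (800 * (2 * K).+1 * K) * K * Q ^ 12) ^ 3 <= N)%N ->
  card_ge (good N K (six_of p q r))
    (N%:R / (2 * 8 * (8 * 8 * 8) * K%:R) * (invp R p * invp R q * invp R r)).
Proof.
move=> hK K0 P320 Q0 pl ql rl /andP[nco nl] hN.
have [/andP[p10 p1Q] p1K /andP[p20 p2Q] p2K] := pairs_toP pl.
have [/andP[q10 q1Q] q1K /andP[q20 q2Q] q2K] := pairs_toP ql.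
have [/andP[r10 r1Q] r1K /andP[r20 r2Q] r2K] := pairs_toP rl.
have np : six_pos (six_of p q r) by rewrite /six_pos /six_of p10 p20 q10 q20 r10 r20.
have [w0 [d10 d20 d30] [c12 c13 c23] hd] := six_facts np nco.
have wK : coprime (sixw (six_of p q r)) K.
  by rewrite /sixw /six_of !coprimeMl p1K p2K q1K q2K r1K r2K.
have hQ m : prime m -> (m %| sixw (six_of p q r))%N -> (m <= Q)%N.
  have aux x : (0 < x)%N -> (x <= Q)%N -> (m %| x)%N -> (m <= Q)%N.
    by move=> x0 xQ /(dvdn_leq x0) h; exact: leq_trans xQ.
  move=> pm; rewrite /sixw /six_of !Euclid_dvdM //.
  by move=> /orP[/orP[/orP[]|/orP[]]|/orP[]]; apply: aux.
have wQ : (sixw (six_of p q r) <= Q ^ 6)%N.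
  have -> : (Q ^ 6 = Q * Q * (Q * Q) * (Q * Q))%N by ring.
  by rewrite /sixw /six_of leq_mul // ?leq_mul // leq_mul.
have dQ : (sixd2 (six_of p q r) * sixd3 (six_of p q r) <= Q ^ 6)%N.
  have -> : (Q ^ 6 = Q * Q ^ 2 * (Q * Q ^ 2))%N by ring.
  by rewrite /sixd2 /sixd3 /six_of leq_mul // leq_mul // leq_exp2r.
have d1Q : (sixd1 (six_of p q r) <= Q ^ 12)%N.
  apply: (@leq_trans (Q ^ 3)); last by rewrite leq_pexp2l.
  by rewrite expnS /sixd1 /six_of leq_mul // leq_exp2r.
have WE : invp R p * invp R q * invp R r = (sixw (six_of p q r))%:R^-1.
  by rewrite /invp /sixw /six_of !natrM !invfM; ring.
rewrite {}WE.
move: (six_of p q r) nco nl np w0 d10 d20 d30 c12 c13 c23 hd wK hQ wQ dQ d1Q => n.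
move=> nco nl np w0 d10 d20 d30 c12 c13 c23 hd wK hQ wQ dQ d1Q.
set M := (800 * (2 * K).+1 * K)%N in hN.
have M0 : (0 < M)%N by rewrite /M !muln_gt0 K0.
have g0 : (0 < sixd1 n * sixd2 n * sixd3 n)%N by rewrite !muln_gt0 d10 d20.
have [_ hA2] := andP (@power_rootP 1 3 (N * (sixd1 n * sixd2 n * sixd3 n)) isT isT).
rewrite mul1n -/(nA N n) in hA2.
have hA : (4 * M * K * Q ^ 12 <= nA N n)%N.
  rewrite leqNgt; apply/negP => h.
  have : (N * (sixd1 n * sixd2 n * sixd3 n) < (4 * M * K * Q ^ 12) ^ 3)%N.
    by apply: leq_trans hA2 _; rewrite leq_exp2r.
  by rewrite ltnNge (leq_trans hN) // leq_pmulr.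
have Q60 : (0 < Q ^ 6)%N by rewrite expn_gt0 Q0.
have QE : (4 * M * K * Q ^ 12 = M * Q ^ 6 * (4 * (Q ^ 6 * K)))%N by ring.
have hL : (M * Q ^ 6 <= nL N n)%N.
  rewrite /nL leq_divRL; last by rewrite muln_gt0 muln_gt0 d20 d30.
  apply: leq_trans hA; rewrite QE leq_mul2l; apply/orP; right; rewrite leq_mul2l /=.
  by apply: leq_trans dQ _; rewrite leq_pmulr.
have hI : (M * Q ^ 6 <= nI N K n)%N.
  rewrite /nI leq_divRL; last by rewrite muln_gt0 muln_gt0 w0 K0.
  apply: leq_trans hA; rewrite QE leq_mul2l; apply/orP; right; rewrite leq_mul2l /=.
  by rewrite leq_mul2r wQ orbT.
have MQ0 : (0 < M * Q ^ 6)%N by rewrite muln_gt0 M0.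
have I0 : (0 < nI N K n)%N by exact: leq_trans hI.
have L0 : (0 < nL N n)%N by exact: leq_trans hL.
have QMQ : (Q <= M * Q ^ 6)%N.
  by apply: (@leq_trans (Q ^ 6)); [rewrite -{1}(expn1 Q) leq_pexp2l|rewrite leq_pmull].
have J0 : (0 < nJ N n)%N.
  rewrite /nJ divn_gt0 ?muln_gt0 //; apply: leq_trans hA.
  have -> : (4 * M * K * Q ^ 12 = 4 * (M * K * Q ^ 12))%N by ring.
  rewrite leq_mul2l /=; apply: leq_trans d1Q _.
  by rewrite leq_pmull // (muln_gt0 M) M0 K0.
have hIL : (nI N K n <= 2 * (Q ^ 6 * nL N n))%N.
  have h1 : (nI N K n * (4 * (sixw n * K)) <= nA N n)%N by exact: leq_trunc_div.
  have q0 : (0 < 4 * (sixd2 n * sixd3 n))%N by rewrite muln_gt0 muln_gt0 d20 d30.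
  have h2 : (nA N n <= 2 * nL N n * (4 * (sixd2 n * sixd3 n)))%N.
    by apply: leq_2divn => //; move: L0; rewrite /nL divn_gt0.
  have h3 : (nI N K n * 4 <= nI N K n * (4 * (sixw n * K)))%N.
    by rewrite leq_mul2l leq_pmulr ?orbT // muln_gt0 w0.
  have h4 : (2 * nL N n * (4 * (sixd2 n * sixd3 n)) <= 2 * nL N n * (4 * Q ^ 6))%N.
    by rewrite leq_mul2l leq_mul2l dQ !orbT.
  have h5 := leq_trans h3 (leq_trans h1 (leq_trans h2 h4)).
  rewrite -(@leq_pmul2r 4) //; apply: leq_trans h5 _.
  have -> : (2 * nL N n * (4 * Q ^ 6) = 2 * (Q ^ 6 * nL N n) * 4)%N by ring.
  by [].
have hbig := @box_dominates (2 * K).+1 K (nI N K n) (nL N n) (Q ^ 6) K0 Q60 hI hL hIL.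
have H := @coprime_triples_many R (sixw n) (sixd1 n) (sixd2 n) (sixd3 n) K P0 Q (nI N K n)
  (nJ N n) (nL N n) (nbe K n) (nc K n) w0 d30 c12 c13 hd hK K0 wK hQ P320 I0
  (leq_trans QMQ hI) (leq_trans QMQ hL) hbig nl (fun i j l => nc_eq K i j l np nco).
apply: (card_ge_mono _ H).
  move=> [[i j] l] [bx /= /andP[h1 h2]]; split=> //=; split=> //.
  - by rewrite np nco.
  - rewrite /spar -[X in (X < _)%N]addn0 ltn_add2l muln_gt0 K0 /= /nb addn_gt0.
    by have [/andP[-> _] _] := bsolP ((sixw n * spar K i)%N%:Z - (sixd1 n * j.+1)%N%:Z) d30 c23.
  - exact: nc_eq.
have := box_size_ge K0 np nco I0 J0 L0.
rewrite -(ler_nat R) !(natrM R).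
move: (nI N K n)%:R (nJ N n)%:R (nL N n)%:R => I J L h.
have wr : (0 : R) < (sixw n)%:R by rewrite ltr0n.
have Kr : (0 : R) < K%:R by rewrite ltr0n.
rewrite ler_pdivrMr //.
rewrite ler_pdivrMr; last by rewrite !mulr_gt0.
by apply: le_trans h _; rewrite le_eqVlt; apply/orP; left; apply/eqP; field.
Qed.

Lemma pairs_to_uniq (K Q : nat) : uniq (pairs_to K Q).
Proof.
by apply: allpairs_uniq; rewrite ?filter_uniq ?iota_uniq // => -[x l] [x' l'] _ _ [-> ->].
Qed.

Lemma NUH_ge_invsum (R : realType) (B : R) (N K P0 Q : nat) :
  (forall m, (0 < m <= P0)%N -> (m %| K)%N) -> (0 < K)%N -> (408 <= P0)%N -> (0 < Q)%N ->
  2 <= B -> N%:R <= B -> ((4 * (800 * (2 * K).+1 * K) * K * Q ^ 12) ^ 3 <= N)%N ->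
  N%:R / (2 * 8 * (8 * 8 * 8) * K%:R) * (invsum R K Q ^+ 6 / 2) <= (NUH B)%:R.
Proof.
move=> hK K0 P408 Q0 B2 NB hN.
have [c c0 U] := upper_bound R; apply: (NUH_ge (U B B2)).
set l := pairs_to K Q; set k : R := N%:R / _.
have k0 : 0 <= k by rewrite /k divr_ge0 // !mulr_ge0.
pose lT := [seq (pq, r) | pq <- [seq (p, q) | p <- l, q <- l], r <- l].
pose ok (t : (nat * nat) * (nat * nat) * (nat * nat)) := nice R P0 Q t.1.1 t.1.2 t.2.
pose W (t : (nat * nat) * (nat * nat) * (nat * nat)) : R := invp R t.1.1 * invp R t.1.2 * invp R t.2.
pose lN := [seq t <- lT | ok t].
have ul := pairs_to_uniq K Q.
have uT : uniq lT.
  apply: allpairs_uniq => //; last by move=> [x y] [x' y'] _ _ [-> ->].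
  by apply: allpairs_uniq => //; move=> [x y] [x' y'] _ _ [-> ->].
have P320 : (320 <= P0)%N by apply: leq_trans P408.
have G : card_ge (fun x => x.1 \in lN /\ good N K (six_of x.1.1.1 x.1.1.2 x.1.2) x.2)
    (\sum_(t <- lN) k * W t).
  apply: (@card_ge_sum R _ _ lN (fun t => good N K (six_of t.1.1 t.1.2 t.2)) (fun t => k * W t)).
    exact: filter_uniq.
  move=> t; rewrite mem_filter => /andP[okt /allpairsP[[pq r] /= [/allpairsP[[p q] /= [pl ql ->]] rl tE]]].
  by move: okt; rewrite tE /ok /W /= => okt; apply: (@good_many R N K P0 Q p q r).
pose f (x : ((nat * nat) * (nat * nat) * (nat * nat)) * (nat * nat * nat)) :=
  exact_quad (six_of x.1.1.1 x.1.1.2 x.1.2) (spar K x.2.1.1) x.2.1.2.+1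
    (nb K (six_of x.1.1.1 x.1.1.2 x.1.2) x.2.1.1 x.2.1.2 x.2.2)
    (nc K (six_of x.1.1.1 x.1.1.2 x.1.2) x.2.1.1 x.2.1.2 x.2.2).
apply: (@points_ge R B N _ _ f _ NB _ _ _ (card_ge_mono (fun x h => h) G _)).
- by move=> x [_ gx]; exact: good_point gx.
- by move=> x [_ gx]; exact: good_quad_gt0 gx.
- move=> [[[[u1 y1] [u2 y2]] [u3 y3]] x] [[[[v1 z1] [v2 z2]] [v3 z3]] x'] [_ gx] [_ gx'].
  by move=> /(good_inj K0 gx gx')[/= [-> -> -> -> -> ->] ->].
rewrite -mulr_sumr ler_wpM2l //.
apply: le_trans (nice_sum_ge R Q hK P408) _.
rewrite /lN big_filter big_mkcond /= /lT big_allpairs big_allpairs /sum3 /=.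
exact: lexx.
Qed.

(** * Choice of [Q] and the final constants *)

(** Rounding gives [B <= 2 C (2 Q)^e] for the integer root [Q]. The logarithm of the constant factor
    and the term in [K] go into [E], and [E <= ln B] excludes [Q = 0]. *)
Lemma ln_power_root (R : realType) (C K e : nat) : (0 < C)%N -> (0 < K)%N -> (0 < e)%N ->
  exists2 E : R, 0 < E & forall B : R, 2 <= B -> E <= ln B ->
    (0 < power_root C e (Num.truncn B))%N /\
    ln B - E <= e%:R * (ln ((power_root C e (Num.truncn B))%:R : R) - ln (K%:R : R)).
Proof.
move=> C0 K0 e0; pose Z : R := 2 * C%:R * 2 ^+ e.
have C1 : 1 <= C%:R :> R by rewrite (ler_nat R 1).
have p1 : 1 <= 2 ^+ e :> R by rewrite exprn_ege1 // ler1n.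
have Z2 : 2 * C%:R <= Z by rewrite /Z ler_peMr //; lra.
have Z0 : 0 < Z by apply: lt_le_trans Z2; lra.
have lK : 0 <= ln (K%:R : R) by apply: ln_ge0; rewrite (ler_nat R 1).
have lZ : 0 < ln Z by apply: ln_gt0; apply: lt_le_trans Z2; lra.
have eK : 0 <= e%:R * ln (K%:R : R) by rewrite mulr_ge0.
exists (ln Z + e%:R * ln (K%:R : R)); first by lra.
move=> B B2 EB; set N := Num.truncn B; set Q := power_root C e N.
have B0 : 0 < B by lra.
have BN : B <= 2 * N%:R.
  have h1 : B < N.+1%:R := truncnS_gt B.
  have h2 : (1 <= N)%N by rewrite /N truncn_gt0; lra.
  have h3 : 1 <= N%:R :> R by rewrite (ler_nat R 1).
  by move: h1; rewrite -natr1; lra.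
have [hQ1 hQ2] := andP (@power_rootP C e N C0 e0); rewrite -/Q in hQ1 hQ2.
have Q0 : (0 < Q)%N.
  rewrite lt0n; apply/eqP => Q0; move: hQ2; rewrite Q0 exp1n muln1 => NC.
  have h : B < 2 * C%:R.
    by apply: le_lt_trans BN _; rewrite ltr_pM2l // ltr_nat.
  have : ln B < ln Z by rewrite ltr_ln ?posrE //; apply: lt_le_trans Z2.
  by move: (ln B) (ln Z) (e%:R * ln (K%:R : R)) EB eK => x y z; lra.
split=> //.
have Qr : (0 : R) < Q%:R by rewrite ltr0n.
have h : B <= Z * Q%:R ^+ e.
  apply: le_trans BN _; have -> : Z * Q%:R ^+ e = 2 * (C * (2 * Q) ^ e)%N%:R.
    by rewrite /Z natrM natrX natrM exprMn; ring.
  rewrite ler_pM2l // ler_nat; apply: leq_trans (ltnW hQ2) _.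
  by rewrite leq_mul2l leq_exp2r // mul2n -addnn -addn1 leq_add2l Q0 orbT.
have : ln B <= ln Z + e%:R * ln (Q%:R : R).
  have pz : Z \is Num.pos by rewrite posrE.
  have pq : Q%:R ^+ e \is @Num.pos R by rewrite posrE exprn_gt0.
  have zq : 0 < Z * Q%:R ^+ e := mulr_gt0 Z0 (exprn_gt0 e Qr).
  by rewrite mulr_natl -lnXn // -(lnM pz pq) ler_ln ?posrE.
by rewrite mulrBr; lra.
Qed.

Lemma lower_bound (R : realType) : exists2 c : R, 0 < c & forall B : R, 2 <= B ->
  c * (B * ln B ^+ 6) <= (NUH B)%:R.
Proof.
have [K [K0 hK]] : exists K, (0 < K)%N /\ forall m, (0 < m <= 408)%N -> (m %| K)%N.
  by exists 408`!; split; [exact: fact_gt0|move=> m; exact: dvdn_fact].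
pose C := ((4 * (800 * (2 * K).+1 * K) * K) ^ 3)%N.
have C0 : (0 < C)%N by rewrite /C expn_gt0 !muln_gt0 K0.
(* [36] is [12 * 3]: [C Q^36 <= N] is the size condition of [good_many]. *)
have [E E0 HE] := @ln_power_root R C K 36 C0 K0 isT.
have Kr : (0 : R) < K%:R by rewrite ltr0n.
(* [72] is [2 * 36], because half of [ln B] survives the subtraction of [E]. The [4] combines
   [B / 2 <= N] with the half in [NUH_ge_invsum]. *)
pose c' : R := (4 * (2 * 8 * (8 * 8 * 8) * K%:R))^-1 * (72 * K%:R)^-1 ^+ 6.
pose c'' : R := (expR (2 * E) * (2 * E) ^+ 6)^-1.
have c'0 : 0 < c' by rewrite /c' mulr_gt0 ?exprn_gt0 ?invr_gt0 ?mulr_gt0.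
have e20 : 0 < 2 * E by lra.
have c''0 : 0 < c'' by rewrite invr_gt0 mulr_gt0 ?expR_gt0 ?exprn_gt0.
exists (Num.min c' c''); first by rewrite lt_min c'0.
move=> B B2; have B0 : 0 < B by lra.
have lB : 0 <= ln B by apply: ln_ge0; lra.
have X0 : 0 <= B * ln B ^+ 6 by rewrite mulr_ge0 ?exprn_ge0 // ltW.
(* For [ln B < 2 E] one point of height at most 1 is enough, [B (ln B)^6] being bounded there. *)
have [hB|hB] := leP (2 * E) (ln B); last first.
  apply: (@le_trans _ _ 1); last first.
    have [c c0 U] := upper_bound R; apply: (NUH_ge (U B B2)).
    have [p [pU p1]] := unit_point; exists [:: p]; split=> // x; rewrite inE => /eqP ->.
    split=> //; apply: (@le_trans _ _ 1); last by lra.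
    by rewrite (ler_nat R _ 1).
  apply: (@le_trans _ _ (c'' * (B * ln B ^+ 6))); first by rewrite ler_wpM2r // ge_min lexx orbT.
  rewrite mulrC ler_pdivrMr ?mul1r; last by rewrite mulr_gt0 ?expR_gt0 ?exprn_gt0.
  apply: ler_pM; rewrite ?exprn_ge0 // ?(ltW B0) //.
    by rewrite -[leLHS](lnK (_ : B \in Num.pos)) ?posrE // ler_expR ltW.
  by apply: lerXn2r; rewrite ?nnegrE ?(ltW e20) // ltW.
have EB : E <= ln B by lra.
have [Q0 hQ] := HE B B2 EB.
set N := Num.truncn B in Q0 hQ; set Q := power_root C 36 N in Q0 hQ.
have [hN _] := andP (@power_rootP C 36 N C0 isT); rewrite -/Q in hN.
have NB : N%:R <= B by rewrite truncn_le ltW.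
have hN' : ((4 * (800 * (2 * K).+1 * K) * K * Q ^ 12) ^ 3 <= N)%N.
  by move: hN; rewrite expnMn -expnM.
apply: le_trans (@NUH_ge_invsum R B N K 408 Q hK K0 isT Q0 B2 NB hN').
have BN : B / 2 <= N%:R.
  have h1 : B < N.+1%:R := truncnS_gt B.
  have h2 : (1 <= N)%N by rewrite /N truncn_gt0; lra.
  have h3 : 1 <= N%:R :> R by rewrite (ler_nat R 1).
  by move: h1; rewrite -natr1; lra.
have S1 : ln B * (72 * K%:R)^-1 <= invsum R K Q.
  apply: le_trans (invsum_ge R K0 Q0).
  have -> : ln B * (72 * K%:R)^-1 = (ln B / 72) / K%:R by rewrite invfM mulrA.
  rewrite ler_pM2r ?invr_gt0 //.
  by move: (ln Q%:R) (ln K%:R) hQ hB => x y; lra.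
have S6 : (ln B * (72 * K%:R)^-1) ^+ 6 <= invsum R K Q ^+ 6.
  apply: lerXn2r; rewrite ?nnegrE // ?invsum_ge0 //.
  by rewrite mulr_ge0 // invr_ge0 mulr_ge0 // ltW.
apply: (@le_trans _ _ (c' * (B * ln B ^+ 6))); first by rewrite ler_wpM2r // ge_min lexx.
have D0 : 0 < 2 * 8 * (8 * 8 * 8) * K%:R :> R by rewrite !mulr_gt0.
apply: (@le_trans _ _ ((B / 2) / (2 * 8 * (8 * 8 * 8) * K%:R) * ((ln B * (72 * K%:R)^-1) ^+ 6 / 2))).
  rewrite /c' exprMn; move: ((72 * K%:R)^-1 ^+ 6) => z.
  move: (2 * 8 * (8 * 8 * 8) * K%:R) (ln B ^+ 6) D0 => D y D0.
  by rewrite le_eqVlt; apply/orP; left; apply/eqP; field; rewrite gt_eqF.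
apply: ler_pM.
- by rewrite !divr_ge0 // ltW.
- by rewrite divr_ge0 // exprn_ge0 // mulr_ge0 // invr_ge0 mulr_ge0 // ltW.
- by rewrite ler_pM2r // invr_gt0.
- by rewrite ler_pM2r // invr_gt0.
Qed.

Theorem mainTheorem1 (R : realType) :
  exists c1 c2 : R, [/\ 0 < c1, 0 < c2 &
    forall B : R, 2 <= B ->
      c1 * (B * ln B ^+ 6) <= (NUH B)%:R /\
      (NUH B)%:R <= c2 * (B * ln B ^+ 6)].
Proof.
have [c1 c10 lo] := lower_bound R; have [c2 c20 up] := upper_bound R.
exists c1, c2; split=> // B B2; split; first exact: lo.
by apply: NUH_le; exact: up.
Qed.
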